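(* Let $(\mathfrak{A},\mathbf{A})$ be a maximal Banach ideal such that the product ideal $(\mathfrak{L}_2\circ\mathfrak{A},\mathbf{L}_2\circ\mathbf{A})$ is normed. Let $X$ and $Y$ be arbitrary Banach spaces such that both $X'$ and $Y$ have cotype 2. Then $$\mathfrak{A}^{*}(X,Y)\stackrel{1}{\subseteq}(\mathfrak{L}_2\circ\mathfrak{A})^{*}(X,Y)\subseteq\mathfrak{L}_2(X,Y)$$ and $$\mathbf{L}_2(T)\le\bigl(2\,\mathbf{C}_2(X')\cdot\mathbf{C}_2(Y)\bigr)^{3/2}\cdot(\mathbf{L}_2\circ\mathbf{A})^{*}(T)\le\bigl(2\,\mathbf{C}_2(X')\cdot\mathbf{C}_2(Y)\bigr)^{3/2}\cdot\mathbf{A}^{*}(T)$$ for all operators $T\in\mathfrak{A}^{*}(X,Y)$.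
   Context: All Banach spaces are over $\mathbb{K}\in\{\mathbb{R},\mathbb{C}\}$; ''operator'' means bounded linear operator, $\mathfrak{L}(X,Y)$ is the space of all operators from $X$ to $Y$, and $X'$ is the dual of $X$. Quasi-Banach (operator) ideals $(\mathfrak{A},\mathbf{A})$ are meant in the sense of Pietsch. $(\mathfrak{A},\mathbf{A})$ is a Banach ideal (also: 1-Banach ideal, or ''normed'') if the given ideal quasi-norm $\mathbf{A}$ itself is a norm. Product ideal: $T\in(\mathfrak{A}\circ\mathfrak{B})(X,Y)$ iff $T=RS$ with $S\in\mathfrak{B}(X,Z)$, $R\in\mathfrak{A}(Z,Y)$ for some Banach space $Z$; $(\mathbf{A}\circ\mathbf{B})(T)=\inf\mathbf{A}(R)\,\mathbf{B}(S)$ over all such factorizations. The product ideal is normed if $\mathbf{A}\circ\mathbf{B}$ is a norm. $(\mathfrak{L}_2,\mathbf{L}_2)$: the operators that factor through a Hilbert space, $\mathbf{L}_2(T)=\inf\{\|R\|\|S\|: T=RS \text{ through a Hilbert space}\}$. Maximal: the maximal hull $(\mathfrak{A}^{\max},\mathbf{A}^{\max})$ consists of all $T\in\mathfrak{L}(X,Y)$ such that $RTS\in\mathfrak{A}(X_0,Y_0)$ for all Banach spaces $X_0,Y_0$ and all approximable operators (norm limits of finite rank operators) $S:X_0\to X$, $R:Y\to Y_0$, with $\mathbf{A}^{\max}(T)=\sup\{\mathbf{A}(RTS):\|R\|,\|S\|\le1\}$. $(\mathfrak{A},\mathbf{A})$ is maximal if it coincides isometrically with its maximal hull. Adjoint ideal: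 $\mathfrak{A}^{*}(X,Y)$ is the set of all $T\in\mathfrak{L}(X,Y)$ with $\mathbf{A}^{*}(T):=\sup\{|\mathrm{tr}(TJ_E^XSQ_K^Y)|\}<\infty$, the supremum being over all finite-dimensional subspaces $E\subseteq X$, all closed finite-codimensional subspaces $K\subseteq Y$, and all $S\in\mathfrak{L}(Y/K,E)$ with $\mathbf{A}(S)\le1$; here $J_E^X:E\to X$ is the inclusion and $Q_K^Y:Y\to Y/K$ the quotient map. This applies to any quasi-Banach ideal, in particular to $\mathfrak{L}_2\circ\mathfrak{A}$ with $(\mathbf{L}_2\circ\mathbf{A})^{*}$ the corresponding norm. The symbol $\stackrel{1}{\subseteq}$ denotes inclusion with the norm of the larger space dominated by the norm of the smaller. $\mathbf{C}_2(X)$ is the cotype 2 constant of $X$: the least $C$ with $(\sum_k\|x_k\|^2)^{1/2}\le C\,(\int_0^1\|\sum_k r_k(t)x_k\|^2dt)^{1/2}$ for all finite families $(x_k)$ in $X$, $r_k$ being the Rademacher functions. *)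

(* Defs.v *)
From HB Require Import structures.
From mathcomp Require Import all_boot all_order all_algebra complex sesquilinear.
From mathcomp Require Import all_classical all_reals all_analysis.
From mathcomp Require Import ring lra.
Set Implicit Arguments.
Unset Strict Implicit.
Unset Printing Implicit Defensive.
Import Order.TTheory GRing.Theory Num.Theory numFieldNormedType.Exports.
Local Open Scope classical_set_scope.
Local Open Scope ring_scope.
Local Open Scope quotient_scope.

Inductive scalar_kind := real_scalars | complex_scalars.

Definition scalar_field (R : realType) (k : scalar_kind) : numFieldType :=
  match k with
  | real_scalars => R
  | complex_scalars => (complex R : numFieldType)
  end.

Section Scalars.
Variables (R : realType) (k : scalar_kind).
Local Notation K := (scalar_field R k).

(* Norms in the library take values in the scalar field K itself.  [re] and
   [emb] transport between the nonnegative reals of K and R; [rnorm] below is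
   the R-valued norm. *)
Definition re : K -> R :=
  match k return scalar_field R k -> R with
  | real_scalars => id
  | complex_scalars => @complex.Re R
  end.

Definition emb : R -> K :=
  match k return R -> scalar_field R k with
  | real_scalars => id
  | complex_scalars => fun r => Complex r 0
  end.

Definition scalar_conj : K -> K :=
  match k return scalar_field R k -> scalar_field R k with
  | real_scalars => id
  | complex_scalars => @conjc R
  end.

Lemma embK r : re (emb r) = r. Proof. by rewrite /re /emb; case: k. Qed.

Lemma reK (x : K) : 0 <= x -> emb (re x) = x.
Proof.
rewrite /re /emb; move: x; case: k => //= x x0; apply: RRe_real.
exact: ger0_real.
Qed.

Lemma re_le (x y : K) : x <= y -> re x <= re y.
Proof.
rewrite /re; move: x y; case: k => //= x y; rewrite lecE => /andP[]//.
Qed.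

Lemma emb_le r s : (emb r <= emb s) = (r <= s).
Proof. by rewrite /emb; case: k => //=; rewrite lecR. Qed.

Lemma embD r s : emb (r + s) = emb r + emb s.
Proof. by rewrite /emb; case: k => //=; exact: (rmorphD (real_complex R)). Qed.

Lemma embM r s : emb (r * s) = emb r * emb s.
Proof. by rewrite /emb; case: k => //=; exact: (rmorphM (real_complex R)). Qed.

Lemma emb0 : emb 0 = 0. Proof. by rewrite /emb; case: k. Qed.

Lemma emb1 : emb 1 = 1. Proof. by rewrite /emb; case: k. Qed.

Lemma emb_inj : injective emb. Proof. exact: can_inj embK. Qed.

Lemma re0 : re 0 = 0. Proof. by rewrite -emb0 embK. Qed.

Lemma reD (x y : K) : re (x + y) = re x + re y.
Proof. by rewrite /re; move: x y; case: k => //= -[a b] [c d]. Qed.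

Lemma reM (x y : K) : 0 <= x -> 0 <= y -> re (x * y) = re x * re y.
Proof. by move=> x0 y0; rewrite -{1}(reK x0) -{1}(reK y0) -embM embK. Qed.

Lemma emb_lt r s : (emb r < emb s) = (r < s).
Proof. by rewrite !lt_neqAle emb_le (inj_eq emb_inj). Qed.

Lemma re_gt0 (x : K) : 0 < x -> 0 < re x.
Proof. by move=> x0; rewrite -emb_lt emb0 reK// ltW. Qed.

Lemma re_normV (a : K) : re `|a^-1| = (re `|a|)^-1.
Proof.
have [->|a0] := eqVneq a 0; first by rewrite invr0 normr0 re0 invr0.
rewrite normfV; apply: (@mulfI _ (re `|a|)).
  by rewrite gt_eqF// re_gt0 ?normr_gt0.
rewrite -reM// ?invr_ge0// divff ?normr_eq0// mulfV ?gt_eqF// ?re_gt0 ?normr_gt0//.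
by rewrite -emb1 embK.
Qed.

Definition rnorm (V : normedModType K) (x : V) : R := re `|x|.

Section RNorm.
Variable V : normedModType K.
Implicit Types x y : V.

Lemma rnormE x : emb (rnorm x) = `|x|. Proof. exact: reK. Qed.

Lemma rnorm_ge0 x : 0 <= rnorm x. Proof. by rewrite -re0; apply: re_le. Qed.

Lemma rnormD x y : rnorm (x + y) <= rnorm x + rnorm y.
Proof. by rewrite -reD; apply/re_le/ler_normD. Qed.

Lemma rnormZ a x : rnorm (a *: x) = re `|a| * rnorm x.
Proof. by rewrite -reM// /rnorm normrZ. Qed.

Lemma rnorm0 : rnorm (0 : V) = 0. Proof. by rewrite /rnorm normr0 re0. Qed.

Lemma rnorm0_eq0 x : rnorm x = 0 -> x = 0.
Proof. by move=> h; apply/eqP; rewrite -normr_eq0 -rnormE h emb0. Qed.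

Lemma rnormN x : rnorm (- x) = rnorm x.
Proof. by rewrite /rnorm normrN. Qed.

Lemma rnormB x y : rnorm (x - y) = rnorm (y - x).
Proof. by rewrite -opprB rnormN. Qed.

Lemma cvg_rnormP (F : set_system V) (l : V) : Filter F ->
  (forall e : R, 0 < e -> F [set x | rnorm (l - x) < e]) -> F --> l.
Proof.
move=> FF h; apply/cvgrPdist_lt => e e0.
apply: filterS (h _ (re_gt0 e0)) => x /=.
by rewrite -emb_lt rnormE reK// ltW.
Qed.

Lemma cvg_rnorm_lt (F : set_system V) (l : V) : Filter F -> F --> l ->
  forall e : R, 0 < e -> F [set x | rnorm (l - x) < e].
Proof.
move=> FF h e e0; move/cvgrPdist_lt : h => /(_ (emb e)).
rewrite -emb0 emb_lt => /(_ e0); apply: filterS => x /=.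
by rewrite -rnormE emb_lt.
Qed.

Lemma cauchy_rnorm (F : set_system V) : ProperFilter F -> cauchy F ->
  forall e : R, 0 < e -> exists a, F [set x | rnorm (a - x) < e].
Proof.
move=> FF /cauchyP h e e0; have [|a Fa] := h (emb e).
  by rewrite -emb0 emb_lt.
exists a; apply: filterS Fa => x.
by rewrite -ball_normE /= -rnormE emb_lt.
Qed.

Lemma rnorm_cauchy (F : set_system V) : ProperFilter F ->
  (forall e : R, 0 < e -> exists a, F [set x | rnorm (a - x) < e]) -> cauchy F.
Proof.
move=> FF h; apply/cauchyP => e e0; have [a Fa] := h _ (re_gt0 e0).
exists a; apply: filterS Fa => x /=.
by rewrite -ball_normE /= -emb_lt rnormE reK// ltW.
Qed.

Lemma rnorm_closed (C : set V) : closed C -> forall l,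
  (forall e : R, 0 < e -> exists2 x, C x & rnorm (l - x) < e) -> C l.
Proof.
move=> cC l h; apply: cC => B /nbhs_normP[e /= e0 eB].
have [x Cx lx] := h _ (re_gt0 e0); exists x; split => //; apply: eB => /=.
by rewrite -rnormE -[e]reK ?emb_lt// ltW.
Qed.

End RNorm.

Lemma normc_ge_Im (z : R[i]) : `|complex.Im z| <= complex.Re `|z|.
Proof.
have := normc_ge_Re (z * 'i%C); rewrite ReiNIm normrN normrM.
have -> : `|'i%C : R[i]| = 1 by rewrite normc_def/= expr0n expr1n add0r sqrtr1.
by rewrite mulr1 lecE => /andP[].
Qed.

Let scalar_cauchy_cvg (F : set_system K^o) :
  ProperFilter F -> cauchy F -> cvg F.
Proof.
move=> FF /cauchy_rnorm; rewrite /rnorm; move: F FF; rewrite /re; case: k => F FF h.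
  apply: R_complete; apply/cauchyP => e e0; have [a Fa] := h e e0.
  by exists a.
pose coord (f : R[i] -> R) := forall z w, f (z - w) = f z - f w.
have lim (f : R[i] -> R) : (forall z w, f (z - w) = f z - f w) ->
    (forall z, `|f z| <= complex.Re `|z|) -> exists l : R, f @ F --> l.
  move=> fB fN; apply/cvg_ex; apply: R_complete; apply/cauchyP => e e0.
  have [a Fa] := h e e0; exists (f a); 
  apply: (@filterS _ F _ [set x | complex.Re `|a - x| < e]) Fa => x /= ax.
  by rewrite /= -ball_normE /= -fB; exact: le_lt_trans (fN _) ax.
have [||a Fa] := lim (@complex.Re R).
- by move=> [? ?] [? ?].
- by move=> z; have := normc_ge_Re z; rewrite lecE => /andP[].
have [||b Fb] := lim (@complex.Im R).
- by move=> [? ?] [? ?].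
- exact: normc_ge_Im.
apply/cvg_ex; exists (a +i* b)%C; apply/cvgrPdist_lt => e.
rewrite ltcE /= => /andP[/eqP ie e0].
have e20 : 0 < complex.Re e / 2 by rewrite divr_gt0.
move/cvgrPdist_lt : Fa => /(_ _ e20) Fa; move/cvgrPdist_lt : Fb => /(_ _ e20) Fb.
apply: (filterS _ (filterI Fa Fb)) => -[x y] /= [ax bY].
rewrite [X in `|X|](_ : _ = (a - x)%:C%C + 'i%C * (b - y)%:C%C); last first.
  by apply/eqP; rewrite eq_complex /=; simpc.
rewrite (le_lt_trans (ler_normD _ _))// normrM.
have -> : `|'i%C : R[i]| = 1 by rewrite normc_def/= expr0n expr1n add0r sqrtr1.
rewrite mul1r !normc_def/= !expr0n !addr0 !sqrtr_sqr -rmorphD/=.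
by rewrite ltcE /= ie eqxx/= [ltRHS]splitr ltrD.
Qed.

(* K as a one-dimensional Banach space over itself. *)
Definition scalar_space : completeNormedModType K :=
  HB.pack K^o (Uniform_isComplete.Build K^o scalar_cauchy_cvg).

End Scalars.
Arguments emb {R k} r.

Section Operators.
Variables (R : realType) (k : scalar_kind).
Local Notation K := (scalar_field R k).
Section Def.
Variables X Y : normedModType K.

Definition bounded_linear (f : X -> Y) : Prop :=
  linear f /\ exists M : R, forall x, rnorm (f x) <= M * rnorm x.

Definition is_op : {pred X -> Y} := fun f => `[< bounded_linear f >].

Record operator := Op { op_fun :> X -> Y; op_prop : op_fun \in is_op }.

HB.instance Definition _ := [isSub for op_fun].
HB.instance Definition _ := [Choice of operator by <:].

Lemma is_op_submod : submod_closed is_op.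
Proof.
split=> [|a f g].
  apply/asboolP; split; first by move=> a x y /=; rewrite scaler0 addr0.
  by exists 0 => x; rewrite mul0r rnorm0.
move=> /asboolP[lf [M fM]] /asboolP[lg [N gN]]; apply/asboolP; split.
  have E z : (a *: f + g) z = a *: f z + g z by [].
  move=> b x y /=; rewrite !E lf lg.
  by rewrite !scalerDr addrACA !scalerA (mulrC b).
exists (re `|a| * M + N) => x.
rewrite (le_trans (rnormD _ _))// mulrDl lerD// rnormZ -mulrA.
by rewrite ler_wpM2l// -(re0 R k) re_le.
Qed.
HB.instance Definition _ := GRing.isSubmodClosed.Build K (X -> Y) is_op is_op_submod.
HB.instance Definition _ := [SubChoice_isSubLmodule of operator by <:].

Lemma opP (T : operator) : bounded_linear T.
Proof. by case: T => f /= /asboolP. Qed.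

Lemma op_eq (S T : operator) : (forall x, S x = T x) -> S = T.
Proof. by move=> h; apply/val_inj/funext. Qed.

HB.instance Definition _ (T : operator) := GRing.isLinear.Build K X Y *:%R T (opP T).1.

Definition opnorm (T : operator) : R :=
  sup [set rnorm (T x) | x in [set x | rnorm x <= 1]].

Lemma opnorm_has_sup (T : operator) :
  has_sup [set rnorm (T x) | x in [set x | rnorm x <= 1]].
Proof.
split; first by exists (rnorm (T 0)); exists 0 => //=; rewrite rnorm0.
have [_ [M TM]] := opP T; exists `|M| => _ [x /= x1 <-].
rewrite (le_trans (TM x))// (le_trans (ler_wpM2r (rnorm_ge0 _) (ler_norm M)))//.
by rewrite ler_piMr.
Qed.

Lemma opnorm_ub (T : operator) x : rnorm x <= 1 -> rnorm (T x) <= opnorm T.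
Proof.
move=> x1; apply: sup_upper_bound; first exact: opnorm_has_sup.
by exists x.
Qed.

Lemma opnorm_le (T : operator) c :
  (forall x, rnorm x <= 1 -> rnorm (T x) <= c) -> opnorm T <= c.
Proof.
move=> h; apply: ge_sup; first exact: (opnorm_has_sup T).1.
by move=> _ [x /= x1 <-]; exact: h.
Qed.

Lemma opnorm_ge0 (T : operator) : 0 <= opnorm T.
Proof.
apply: le_trans (opnorm_ub T (x := 0) _); first exact: rnorm_ge0.
by rewrite rnorm0.
Qed.

Lemma le_opnorm (T : operator) x : rnorm (T x) <= opnorm T * rnorm x.
Proof.
have [->|x0] := eqVneq x 0; first by rewrite (linear0 (T : {linear X -> Y})) !rnorm0 mulr0.
have nx0 : 0 < rnorm x.
  rewrite lt_neqAle rnorm_ge0 andbT eq_sym; apply: contra_neq x0.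
  exact: rnorm0_eq0.
have e0 : re `|@emb R k (rnorm x)^-1| = (rnorm x)^-1.
  by rewrite ger0_norm ?embK// -(emb0 R k) emb_le invr_ge0 ltW.
have := opnorm_ub T (x := emb (rnorm x)^-1 *: x).
rewrite linearZ !rnormZ e0 mulVf ?gt_eqF// => /(_ (lexx _)).
by rewrite mulrC ler_pdivrMr.
Qed.

Let opnormD (S T : operator) : @emb R k (opnorm (S + T)) <= emb (opnorm S) + emb (opnorm T).
Proof.
rewrite -embD emb_le; apply: opnorm_le => x x1.
by rewrite (le_trans (rnormD _ _))// lerD// opnorm_ub.
Qed.
Let opnormZ_le a (T : operator) : opnorm (a *: T) <= re `|a| * opnorm T.
Proof.
apply: opnorm_le => x x1; rewrite rnormZ ler_wpM2l ?opnorm_ub//.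
by rewrite -(re0 R k) re_le.
Qed.

Let opnormZ a (T : operator) : @emb R k (opnorm (a *: T)) = `|a| * emb (opnorm T).
Proof.
rewrite -[`|a|]reK// -embM; congr emb; apply/eqP; rewrite eq_le opnormZ_le/=.
have [->|a0] := eqVneq a 0; first by rewrite normr0 re0 mul0r opnorm_ge0.
have := opnormZ_le a^-1 (a *: T); rewrite scalerA mulVf// scale1r.
by rewrite re_normV ler_pdivlMl// re_gt0 ?normr_gt0.
Qed.

Let opnorm_eq0 (T : operator) : @emb R k (opnorm T) = 0 -> T = 0.
Proof.
rewrite -(emb0 R k) => /emb_inj T0; apply: op_eq => x; apply: rnorm0_eq0.
by apply/eqP; rewrite eq_le rnorm_ge0 andbT -(mul0r (rnorm x)) -T0 le_opnorm.
Qed.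

HB.instance Definition _ := @Lmodule_isNormed.Build K operator (fun T => emb (opnorm T)) opnormD opnormZ opnorm_eq0.

Lemma rnorm_op (T : operator) : rnorm T = opnorm T. Proof. exact: embK. Qed.
End Def.
End Operators.

Section Composition.
Variables (R : realType) (k : scalar_kind).
Local Notation K := (scalar_field R k).
Implicit Types X Y Z : normedModType K.

Lemma id_op_subproof X : (id : X -> X) \in @is_op R k X X.
Proof. by apply/asboolP; split=> //; exists 1 => x; rewrite mul1r. Qed.
Definition id_op X : operator X X := Op (id_op_subproof X).

Lemma comp_op_subproof X Y Z (S : operator Y Z) (T : operator X Y) :
  (S \o T : X -> Z) \in @is_op R k X Z.
Proof.
apply/asboolP; split; first by move=> a x y /=; rewrite !linearP.
exists (opnorm S * opnorm T) => x /=.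
rewrite (le_trans (le_opnorm _ _))// -mulrA ler_wpM2l ?opnorm_ge0//.
exact: le_opnorm.
Qed.
Definition comp_op X Y Z (S : operator Y Z) (T : operator X Y) : operator X Z :=
  Op (comp_op_subproof S T).

End Composition.

Section ClosedSubspaces.
Variables (R : realType) (k : scalar_kind).
Local Notation K := (scalar_field R k).

(* Closedness makes the subspace and the quotient Banach spaces.  It is
   automatic for finite-dimensional subspaces, see [finite_span_closed]. *)
Record closed_subspace (X : normedModType K) := ClosedSubspace {
  subspace_set : set X;
  subspace0 : subspace_set 0;
  subspaceP : forall (a : K) x y,
    subspace_set x -> subspace_set y -> subspace_set (a *: x + y);
  subspace_closed : closed subspace_set
}.

Section Subspace.
Variables (X : normedModType K) (E : closed_subspace X).

Definition in_subspace : {pred X} := fun x => `[< subspace_set E x >].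

Record sub_space := SubSpace { sub_val : X; sub_valP : sub_val \in in_subspace }.

HB.instance Definition _ := [isSub for sub_val].
HB.instance Definition _ := [Choice of sub_space by <:].

Lemma in_subspace_submod : submod_closed in_subspace.
Proof.
split=> [|a x y /asboolP Ex /asboolP Ey]; apply/asboolP; first exact: subspace0.
exact: subspaceP.
Qed.
HB.instance Definition _ :=
  GRing.isSubmodClosed.Build K X in_subspace in_subspace_submod.
HB.instance Definition _ := [SubChoice_isSubLmodule of sub_space by <:].

Let sub_normD (x y : sub_space) : `|val (x + y)| <= `|val x| + `|val y|.
Proof. exact: ler_normD. Qed.
Let sub_normZ a (x : sub_space) : `|val (a *: x)| = `|a| * `|val x|.
Proof. exact: normrZ. Qed.
Let sub_norm_eq0 (x : sub_space) : `|val x| = 0 -> x = 0.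
Proof. by move/normr0_eq0 => h; apply: val_inj. Qed.
HB.instance Definition _ := @Lmodule_isNormed.Build K sub_space
  (fun x => `|val x|) sub_normD sub_normZ sub_norm_eq0.

Lemma inclusion_subproof : sub_val \in @is_op R k sub_space X.
Proof. by apply/asboolP; split=> //; exists 1 => x; rewrite mul1r. Qed.
Definition inclusion : operator sub_space X := Op inclusion_subproof.

End Subspace.

Section SubspaceComplete.
Variables (X : completeNormedModType K) (E : closed_subspace X).

Let sub_cauchy_cvg (F : set_system (sub_space E)) :
  ProperFilter F -> cauchy F -> cvg F.
Proof.
move=> FF cF.
have vF : cauchy (@sub_val X E @ F).
  apply: rnorm_cauchy => e e0; have [a Fa] := cauchy_rnorm FF cF e0.
  by exists (val a); exact: Fa.
have /cvg_ex[l Fl] : cvg (@sub_val X E @ F) by exact: cauchy_cvg vF.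
have El : subspace_set E l.
  apply: (rnorm_closed (@subspace_closed _ E)) => e e0.
  have /filter_ex[x lx] : F [set x | rnorm (l - sub_val x) < e].
    exact: (cvg_rnorm_lt _ Fl).
  by exists (sub_val x) => //; apply/asboolP; exact: sub_valP.
have El' : l \in in_subspace E by apply/asboolP.
apply/cvg_ex; exists (SubSpace El'); apply: cvg_rnormP => e e0.
exact: (cvg_rnorm_lt _ Fl).
Qed.
HB.instance Definition _ :=
  Uniform_isComplete.Build (sub_space E) sub_cauchy_cvg.
End SubspaceComplete.

Section Quotient.
Variables (X : normedModType K) (F : closed_subspace X).

Definition quot_rel : rel X := fun x y => `[< subspace_set F (x - y) >].

Lemma subspaceD x y : subspace_set F x -> subspace_set F y -> subspace_set F (x + y).
Proof. by move=> Fx Fy; rewrite -[x]scale1r; exact: subspaceP. Qed.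
Lemma subspaceZ a x : subspace_set F x -> subspace_set F (a *: x).
Proof.
by move=> Fx; rewrite -[_ *: _]addr0; apply: subspaceP => //; exact: subspace0.
Qed.
Lemma subspaceN x : subspace_set F x -> subspace_set F (- x).
Proof. by move=> Fx; rewrite -scaleN1r; exact: subspaceZ. Qed.

Let quot_refl : reflexive quot_rel.
Proof. by move=> x; apply/asboolP; rewrite subrr; exact: subspace0. Qed.
Let quot_sym : symmetric quot_rel.
Proof.
move=> x y; apply/asboolP/asboolP => h; rewrite -opprB; exact: subspaceN.
Qed.
Let quot_trans : transitive quot_rel.
Proof.
move=> y x z /asboolP xy /asboolP yz; apply/asboolP.
by rewrite -[x](subrK y) -addrA; exact: subspaceD.
Qed.

Definition quot_equiv := EquivRel quot_rel quot_refl quot_sym quot_trans.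

Definition quot_space := {eq_quot quot_equiv}.
HB.instance Definition _ := EqQuotient.on quot_space.
HB.instance Definition _ := Choice.on quot_space.

Implicit Types a b c : quot_space.

Definition quot_pi : X -> quot_space := \pi_quot_space.

Lemma quot_piW (P : quot_space -> Prop) :
  (forall x, P (quot_pi x)) -> forall a, P a.
Proof. by move=> h a; rewrite -[a]reprK; exact: h. Qed.

Lemma quot_piE x y : (quot_pi x = quot_pi y) <-> subspace_set F (x - y).
Proof.
split=> [/eqmodP/asboolP//|h]; apply/eqmodP; exact/asboolP.
Qed.

Let zeroq : quot_space := quot_pi 0.
Let oppq a : quot_space := quot_pi (- repr a).
Let addq a b : quot_space := quot_pi (repr a + repr b).
Let scaleq s a : quot_space := quot_pi (s *: repr a).

Lemma repr_pi x : subspace_set F (repr (quot_pi x) - x).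
Proof. by apply/quot_piE; exact: reprK. Qed.

Let oppE x : oppq (quot_pi x) = quot_pi (- x).
Proof. by apply/quot_piE; rewrite -opprD; apply: subspaceN; exact: repr_pi. Qed.
Let addE x y : addq (quot_pi x) (quot_pi y) = quot_pi (x + y).
Proof. by apply/quot_piE; rewrite opprD addrACA; apply: subspaceD; exact: repr_pi. Qed.
Let scaleE s x : scaleq s (quot_pi x) = quot_pi (s *: x).
Proof. by apply/quot_piE; rewrite -scalerBr; apply: subspaceZ; exact: repr_pi. Qed.

Let addqA : associative addq.
Proof.
elim/quot_piW=> x; elim/quot_piW=> y; elim/quot_piW=> z.
by rewrite !addE addrA.
Qed.
Let addqC : commutative addq.
Proof. by elim/quot_piW=> x; elim/quot_piW=> y; rewrite !addE addrC. Qed.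
Let add0q : left_id zeroq addq.
Proof. by elim/quot_piW=> x; rewrite addE add0r. Qed.
Let addNq : left_inverse zeroq oppq addq.
Proof. by elim/quot_piW=> x; rewrite oppE addE addNr. Qed.
HB.instance Definition _ :=
  GRing.isZmodule.Build quot_space addqA addqC add0q addNq.

Let scaleqA s t a : scaleq s (scaleq t a) = scaleq (s * t) a.
Proof. by elim/quot_piW: a => x; rewrite !scaleE scalerA. Qed.
Let scale1q : left_id 1 scaleq.
Proof. by elim/quot_piW=> x; rewrite scaleE scale1r. Qed.
Let scaleqDr : right_distributive scaleq +%R.
Proof.
move=> s; elim/quot_piW=> x; elim/quot_piW=> y.
by rewrite /GRing.add/= addE !scaleE addE scalerDr.
Qed.
Let scaleqDl a : {morph scaleq^~ a : s t / s + t}.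
Proof.
move=> s t; elim/quot_piW: a => x.
by rewrite [in RHS]/GRing.add/= !scaleE addE scalerDl.
Qed.
HB.instance Definition _ := GRing.Zmodule_isLmodule.Build K quot_space
  scaleqA scale1q scaleqDr scaleqDl.

Lemma quot_piD x y : quot_pi (x + y) = quot_pi x + quot_pi y.
Proof. by rewrite -addE. Qed.
Lemma quot_piZ s x : quot_pi (s *: x) = s *: quot_pi x.
Proof. by rewrite -scaleE. Qed.

Definition quot_norm a : R :=
  inf [set rnorm x | x in [set x | quot_pi x = a]].

Lemma quot_norm_has_inf a :
  has_inf [set rnorm x | x in [set x | quot_pi x = a]].
Proof.
split; first by exists (rnorm (repr a)); exists (repr a) => //=; exact: reprK.
by exists 0 => _ [x _ <-]; exact: rnorm_ge0.
Qed.

Lemma quot_norm_le x : quot_norm (quot_pi x) <= rnorm x.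
Proof.
by apply: inf_lbound; [exact: (quot_norm_has_inf _).2|exists x].
Qed.

Lemma quot_norm_lift a e : 0 < e ->
  exists2 x, quot_pi x = a & rnorm x < quot_norm a + e.
Proof.
by move=> /inf_adherent-/(_ _ (quot_norm_has_inf a))[_ [x /= xa <-]]; exists x.
Qed.

Lemma quot_norm_ge0 a : 0 <= quot_norm a.
Proof.
apply: lb_le_inf; first exact: (quot_norm_has_inf a).1.
by move=> _ [x _ <-]; exact: rnorm_ge0.
Qed.

Let quot_normD a b :
  emb (quot_norm (a + b)) <= emb (quot_norm a) + emb (quot_norm b) :> K.
Proof.
rewrite -embD emb_le; apply/ler_addgt0Pr => e e0.
have e20 : 0 < e / 2 by rewrite divr_gt0.
have [x <- xe] := quot_norm_lift a e20; have [y <- ye] := quot_norm_lift b e20.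
rewrite -quot_piD (le_trans (quot_norm_le _))// (le_trans (rnormD _ _))//.
by rewrite [e]splitr addrACA lerD// ltW.
Qed.

Let quot_normZ_le s a : quot_norm (s *: a) <= re `|s| * quot_norm a.
Proof.
apply/ler_addgt0Pr => e e0.
have s0 : 0 <= re `|s| by rewrite -(re0 R k) re_le.
have [x <- xe] := quot_norm_lift a (e := e / (re `|s| + 1)) (divr_gt0 e0 (ltr_wpDl s0 ltr01)).
rewrite -quot_piZ (le_trans (quot_norm_le _))// rnormZ.
rewrite (le_trans (ler_wpM2l s0 (ltW xe)))// mulrDr lerD2l.
by rewrite mulrCA ler_piMr ?ltW// ltr_pdivrMr ?mul1r ?ltrDl// ltr_wpDl.
Qed.

Let quot_normZ s a : emb (quot_norm (s *: a)) = `|s| * emb (quot_norm a) :> K.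
Proof.
rewrite -[`|s|]reK// -embM; congr emb; apply/eqP; rewrite eq_le quot_normZ_le/=.
have [->|s0] := eqVneq s 0; first by rewrite normr0 re0 mul0r quot_norm_ge0.
have := quot_normZ_le s^-1 (s *: a); rewrite scalerA mulVf// scale1r.
by rewrite re_normV ler_pdivlMl// re_gt0 ?normr_gt0.
Qed.

Let quot_norm_eq0 a : emb (quot_norm a) = 0 :> K -> a = 0.
Proof.
rewrite -(emb0 R k) => /emb_inj a0.
elim/quot_piW: a a0 => x0 a0; apply/quot_piE; rewrite subr0.
apply: (rnorm_closed (@subspace_closed _ F)) => e e0.
have [x xa xe] := quot_norm_lift (quot_pi x0) e0.
exists (x0 - x); last by rewrite opprB addrC subrK -[e]add0r -a0.
exact/quot_piE.
Qed.

HB.instance Definition _ := @Lmodule_isNormed.Build K quot_space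
  (fun a => emb (quot_norm a)) quot_normD quot_normZ quot_norm_eq0.

Lemma rnorm_quot a : rnorm a = quot_norm a. Proof. exact: embK. Qed.

Lemma quot_map_subproof : quot_pi \in @is_op R k X quot_space.
Proof.
apply/asboolP; split; first by move=> s x y; rewrite quot_piD quot_piZ.
by exists 1 => x; rewrite mul1r rnorm_quot; exact: quot_norm_le.
Qed.
Definition quot_map : operator X quot_space := Op quot_map_subproof.

End Quotient.

Section QuotientComplete.
Variables (X : completeNormedModType K) (F : closed_subspace X).

Let quot_cauchy_cvg (G : set_system (quot_space F)) :
  ProperFilter G -> cauchy G -> cvg G.
Proof.
move=> GG cG; pose h n : R := 1 / 2 ^+ n.
have h0 n : 0 < h n by rewrite divr_gt0// exprn_gt0.
have hS n : h n.+1 + h n.+1 = h n.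
  by rewrite /h exprS; field; rewrite expf_eq0 pnatr_eq0 andbF.
pose P n a := G [set b | rnorm (a - b) < h n].
have /choice[a Ga] : forall n, exists a, P n a.
  by move=> n; exact: cauchy_rnorm.
have da n : rnorm (a n.+1 - a n) < h n + h n.
  have /filter_ex[b [ab ab']] :
      G ([set b | rnorm (a n - b) < h n] `&` [set b | rnorm (a n.+1 - b) < h n.+1]).
    by apply: filterI; exact: Ga.
  rewrite -[a n.+1](subrK b) -addrA (le_lt_trans (rnormD _ _))//.
  rewrite ltrD//; last by rewrite rnormB.
  by rewrite (lt_trans ab')// -(hS n) ltrDl.
have /choice[d dE] : forall n, exists x, quot_pi F x = a n.+1 - a n /\
    rnorm x < h n + h n + h n.
  move=> n; have [x xa xe] := quot_norm_lift (a n.+1 - a n) (h0 n).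
  by exists x; split=> //; rewrite (lt_trans xe)// ltrD2r -rnorm_quot.
pose y n := repr (a 0%N) + \sum_(i < n) d i.
have yS n : y n.+1 = y n + d n by rewrite /y big_ord_recr /= addrA.
have yE n : quot_pi F (y n) = a n.
  elim: n => [|n IH]; first by rewrite /y big_ord0 addr0; exact: reprK.
  by rewrite yS quot_piD IH (dE n).1 addrC subrK.
have yy n m : rnorm (y n - y (n + m)%N) + 6 * h (n + m)%N <= 6 * h n.
  elim: m => [|m IH]; first by rewrite addn0 subrr rnorm0 add0r.
  apply: le_trans IH; rewrite addnS yS opprD addrA.
  rewrite (le_trans (lerD (rnormD _ _) (lexx _)))// -addrA lerD2l rnormN.
  have := (dE (n + m)%N).2; have := hS (n + m)%N; lra.
have small (e : R) : 0 < e -> exists n, 6 * h n < e.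
  move=> e0; have [n _ hn] := near_infty_natSinv_expn_lt (PosNum (divr_gt0 e0 (ltr0Sn R 5))).
  by exists n; have /= := hn n (leqnn n); rewrite -/(h n); lra.
have /cvg_ex[l yl] : cvg (y @ \oo).
  apply: cauchy_cvg; apply: rnorm_cauchy => e e0; have [n ne] := small e e0.
  exists (y n); exists n => // m /= nm; rewrite -(subnKC nm).
  apply: le_lt_trans ne; apply: le_trans (yy n (m - n)%N).
  by have := h0 (n + (m - n))%N; lra.
apply/cvg_ex; exists (quot_pi F l); apply: cvg_rnormP => e e0.
have e20 : 0 < e / 2 by rewrite divr_gt0.
have [n ne] := small _ e20.
have [N _ yN] := cvg_rnorm_lt _ yl e20.
have := yN (maxn n N) (leq_maxr n N).
set m := maxn n N => lm.
apply: filterS (Ga m) => b /= mb.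
rewrite -(subrK (a m) (quot_pi F l)) -addrA (le_lt_trans (rnormD _ _))//.
rewrite [e]splitr ltrD//.
  rewrite -yE; apply: le_lt_trans lm.
  have -> : quot_pi F l - quot_pi F (y m) = quot_pi F (l - y m).
    by rewrite -[- quot_pi F _]scaleN1r -quot_piZ -quot_piD scaleN1r.
  by rewrite rnorm_quot; exact: quot_norm_le.
apply: lt_le_trans mb _.
have := yy n (m - n)%N; rewrite subnKC ?leq_maxl//.
have := rnorm_ge0 (y n - y m); have := h0 m; lra.
Qed.
HB.instance Definition _ :=
  Uniform_isComplete.Build (quot_space F) quot_cauchy_cvg.

End QuotientComplete.
End ClosedSubspaces.

Section FiniteDimension.
Variables (R : realType) (k : scalar_kind).
Local Notation K := (scalar_field R k).

Definition finite_dim (V : normedModType K) : Prop :=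
  exists n (v : 'I_n -> V), forall x, exists c : 'I_n -> K,
    x = \sum_(i < n) c i *: v i.

Definition finite_rank (X Y : normedModType K) (T : operator X Y) : Prop :=
  exists n (v : 'I_n -> Y), forall x, exists c : 'I_n -> K,
    T x = \sum_(i < n) c i *: v i.

Definition approximable (X Y : normedModType K) (T : operator X Y) : Prop :=
  closure [set S : operator X Y | finite_rank S] T.

Lemma span_closed (V : normedModType K) n (v : nat -> V) :
  closed [set x | exists c : nat -> K, x = \sum_(i < n) c i *: v i].
Proof.
elim: n => [|n IH].
  have -> : [set x | exists c : nat -> K, x = \sum_(i < 0) c i *: v i] = [set 0].
    apply/seteqP; split=> x /=; first by move=> [c ->]; rewrite big_ord0.
    by move=> ->; exists (fun=> 0); rewrite big_ord0.
  apply: compact_closed; first exact: norm_hausdorff.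
  exact: compact_set1.
set W := [set x | _] in IH.
have W0 : W 0 by exists (fun=> 0); rewrite big1// => i _; rewrite scale0r.
have WP a x y : W x -> W y -> W (a *: x + y).
  move=> [c ->] [d ->]; exists (fun i => a * c i + d i).
  rewrite scaler_sumr -big_split/=; apply: eq_bigr => i _.
  by rewrite scalerDl scalerA.
have WE x : (exists c : nat -> K, x = \sum_(i < n.+1) c i *: v i) <->
    exists a, exists2 w, W w & x = w + a *: v n.
  split=> [[c ->]|[a [_ [c ->] ->]]].
    rewrite big_ord_recr/=; exists (c n), (\sum_(i < n) c i *: v i) => //.
    by exists c.
  exists (fun i => if (i < n)%N then c i else a).
  rewrite big_ord_recr/= ltnn; congr (_ + _); apply: eq_bigr => i _.
  by rewrite ltn_ord.
have [vW|vW] := pselect (W (v n)).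
  rewrite (_ : [set x | _] = W)//; apply/seteqP; split=> x /=.
    by move=> /WE[a [w Ww ->]]; rewrite addrC; exact: WP.
  by move=> Wx; apply/WE; exists 0, x => //; rewrite scale0r addr0.
have [d d0 dW] : exists2 d : R, 0 < d & forall w, W w -> d <= rnorm (v n - w).
  apply: contrapT => h; apply: vW; apply: (rnorm_closed IH) => e e0.
  apply: contrapT => h'; apply: h; exists e => // w Ww; rewrite leNgt.
  by apply/negP => we; apply: h'; exists w.
have dK a w : W w -> re `|a| * d <= rnorm (w + a *: v n).
  move=> Ww; have [->|a0] := eqVneq a 0.
    by rewrite normr0 re0 mul0r rnorm_ge0.
  have -> : w + a *: v n = a *: (v n - (- a^-1 *: w + 0)).
    by rewrite addr0 scalerBr scaleNr scalerN opprK scalerA mulfV// scale1r addrC.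
  by rewrite rnormZ ler_wpM2l ?dW//; [rewrite -(re0 R k) re_le|exact: WP].
move=> l cl; apply/WE.
have app (e : R) : 0 < e -> exists aw : K * V, W aw.2 /\ rnorm (l - (aw.2 + aw.1 *: v n)) < e.
  move=> e0; have /= := cl _ (@cvg_rnorm_lt _ _ _ (nbhs l) l _ (fun _ h => h) e e0).
  by move=> [x [/WE[a [w Ww ->]] xe]]; exists (a, w).
pose h n : R := 1 / 2 ^+ n.
have h0 m : 0 < h m by rewrite divr_gt0// exprn_gt0.
have small (e : R) : 0 < e -> exists N, forall m, (N <= m)%N -> h m < e.
  move=> e0; have [N _ hN] := near_infty_natSinv_expn_lt (PosNum e0).
  by exists N => m; exact: hN.
have /choice[aw awP] := fun m => app _ (h0 m).
have ca m p : re `|(aw m).1 - (aw p).1| * d <= h m + h p.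
  have [Wm lm] := awP m; have [Wp lp] := awP p.
  have Wmp : W ((aw m).2 - (aw p).2) by rewrite addrC -scaleN1r; exact: WP.
  apply: le_trans (dK _ _ Wmp) _.
  rewrite scalerBl addrACA -opprD -(subrKA l) (le_trans (rnormD _ _))//.
  by rewrite lerD//; [rewrite rnormB|]; exact: ltW.
have /cvg_ex[a aa] : cvg (((fun m => (aw m).1 : scalar_space R k)) @ \oo).
  apply: cauchy_cvg; apply: rnorm_cauchy => e e0.
  have ed : 0 < e * d / 2 by rewrite divr_gt0// mulr_gt0.
  have [N hN] := small _ ed; exists (aw N).1; exists N => // m /= Nm.
  rewrite -(ltr_pM2r d0); apply: le_lt_trans (ca N m) _.
  by have := hN _ Nm; have := hN _ (leqnn N); lra.
exists a, (l - a *: v n); last by rewrite subrK.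
apply: (rnorm_closed IH) => e e0.
have vp : 0 < rnorm (v n) + 1 by rewrite ltr_wpDl// rnorm_ge0.
have [N hN] := small _ (divr_gt0 e0 (ltr0Sn R 1)).
have [M _ aM] := cvg_rnorm_lt _ aa (divr_gt0 (divr_gt0 e0 (ltr0Sn R 1)) vp).
have am := aM (maxn N M) (leq_maxr N M); have hm := hN _ (leq_maxl N M).
move: am hm; set m := maxn N M => /= am hm; have [Wm lm] := awP m.
exists (aw m).2 => //.
have -> : l - a *: v n - (aw m).2 =
    (l - ((aw m).2 + (aw m).1 *: v n)) - (a - (aw m).1) *: v n.
  by rewrite scalerBl opprB opprD !addrA subrK addrAC.
rewrite (le_lt_trans (rnormD _ _))// rnormN rnormZ [e]splitr.
rewrite ltr_leD//; first exact: lt_trans hm.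
rewrite (le_trans (ler_wpM2l _ (_ : rnorm (v n) <= rnorm (v n) + 1)))//.
- by rewrite -(re0 R k) re_le.
- by rewrite lerDl.
- by rewrite -ler_pdivlMr// ltW.
Qed.

(* Finite-dimensional subspaces are closed, so requiring closedness of E in
   [adjoint_norm] below is no restriction. *)
Lemma finite_span_closed (V : normedModType K) n (v : 'I_n -> V) :
  closed [set x | exists c : 'I_n -> K, x = \sum_(i < n) c i *: v i].
Proof.
case: n v => [|n] v.
  have := @span_closed V 0 (fun=> 0); congr closed; apply/seteqP.
  by split=> x [c ->]; [exists (fun=> 0)|exists (fun=> 0)]; rewrite !big_ord0.
have := @span_closed V n.+1 (fun i => v (inord i)); congr closed; apply/seteqP.
split=> x [c ->]; [exists c|exists (fun i => c (inord i))];
  by apply: eq_bigr => i _; rewrite inord_val.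
Qed.

End FiniteDimension.

Section OperatorIdeals.
Variables (R : realType) (k : scalar_kind).
Local Notation K := (scalar_field R k).
Local Notation banach := (completeNormedModType K).

Definition dual (X : normedModType K) : normedModType K :=
  operator X (scalar_space R k).

(* [t] is the trace of the finite rank operator [U], read off from a
   representation U = sum_i a_i (x) v_i; it does not depend on the
   representation. *)
Definition is_trace (V : normedModType K) (U : operator V V) (t : K) : Prop :=
  exists n (a : 'I_n -> operator V (scalar_space R k)) (v : 'I_n -> V),
    (forall x, U x = \sum_(i < n) (a i x : K) *: v i) /\
    t = \sum_(i < n) (a i (v i) : K).

Definition trace (V : normedModType K) (U : operator V V) : K :=
  xget 0 [set t | is_trace U t].

(* The values of [qnorm] outside [component] carry no meaning: every definition
   below consults them on members only. *)
Record operator_class := OperatorClass {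
  component : forall X Y : banach, set (operator X Y);
  qnorm : forall X Y : banach, operator X Y -> R
}.

(* Pietsch's axioms.  Absolute homogeneity of the quasi-norm follows from
   [ideal_comp]. *)
Record quasi_banach_ideal (A : operator_class) : Prop := QuasiBanachIdeal {
  ideal_id : component A (id_op (scalar_space R k));
  ideal_id_qnorm : qnorm A (id_op (scalar_space R k)) = 1;
  ideal_qnorm_ge0 : forall (X Y : banach) (T : operator X Y),
    component A T -> 0 <= qnorm A T;
  ideal_add : exists2 c : R, 1 <= c &
    forall (X Y : banach) (S T : operator X Y), component A S -> component A T ->
      component A (S + T) /\ qnorm A (S + T) <= c * (qnorm A S + qnorm A T);
  ideal_comp : forall (X0 X Y Y0 : banach)
      (V : operator Y Y0) (T : operator X Y) (U : operator X0 X), component A T ->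
    component A (comp_op V (comp_op T U)) /\
    qnorm A (comp_op V (comp_op T U)) <= rnorm V * qnorm A T * rnorm U;
  ideal_complete : forall (X Y : banach) (T : nat -> operator X Y),
    (forall n, component A (T n)) ->
    (forall e : R, 0 < e -> exists N, forall m n, (N <= m)%N -> (N <= n)%N ->
      qnorm A (T m - T n) < e) ->
    exists2 S, component A S & qnorm A (T n - S) @[n --> \oo] --> (0 : R)
}.

Definition normed_class (A : operator_class) : Prop :=
  forall X Y : banach,
  [/\ forall S T : operator X Y, component A S -> component A T ->
        qnorm A (S + T) <= qnorm A S + qnorm A T,
      forall (a : K) (T : operator X Y), component A T ->
        qnorm A (a *: T) = re `|a| * qnorm A T &
      forall T : operator X Y, component A T -> qnorm A T = 0 -> T = 0].

Definition banach_ideal (A : operator_class) : Prop :=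
  quasi_banach_ideal A /\ normed_class A.

Definition product_class (A B : operator_class) : operator_class :=
  OperatorClass
    (fun X Y => [set T | exists (Z : banach) (V : operator Z Y) (S : operator X Z),
       [/\ component A V, component B S & T = comp_op V S]])
    (fun X Y T => inf [set r | exists (Z : banach) (V : operator Z Y) (S : operator X Z),
       [/\ component A V, component B S, T = comp_op V S &
           r = qnorm A V * qnorm B S]]).

(* The form is linear in its first argument and conjugate-linear in the second
   one; a Hilbert space is a Banach space whose norm comes from such a form. *)
Definition is_hilbert (H : banach) : Prop :=
  exists ip : {dot H for @scalar_conj R k}, forall x : H, ip x x = `|x| ^+ 2.

Definition hilbert_class : operator_class :=
  OperatorClass
    (fun X Y => [set T | exists (H : banach) (V : operator H Y) (S : operator X H),
       is_hilbert H /\ T = comp_op V S])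
    (fun X Y T => inf [set r | exists (H : banach) (V : operator H Y) (S : operator X H),
       [/\ is_hilbert H, T = comp_op V S & r = rnorm V * rnorm S]]).

Definition hull_norm (A : operator_class) (X Y : banach) (T : operator X Y) : \bar R :=
  ereal_sup [set r | exists (X0 Y0 : banach) (V : operator Y Y0) (S : operator X0 X),
    [/\ approximable V, approximable S, rnorm V <= 1, rnorm S <= 1 &
        r = (qnorm A (comp_op V (comp_op T S)))%:E]].

Definition maximal_hull (A : operator_class) : operator_class :=
  OperatorClass
    (fun X Y => [set T | forall (X0 Y0 : banach) (V : operator Y Y0) (S : operator X0 X),
       approximable V -> approximable S ->
       component A (comp_op V (comp_op T S))])
    (fun X Y T => fine (hull_norm A T)).

Definition maximal_class (A : operator_class) : Prop :=
  forall X Y : banach,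
    @component A X Y = @component (maximal_hull A) X Y /\
    forall T : operator X Y, component A T -> hull_norm A T = (qnorm A T)%:E.

(* For an ideal the set contains 0 (take S = 0), so the supremum is nonnegative. *)
Definition adjoint_norm (A : operator_class) (X Y : banach) (T : operator X Y) :
    \bar R :=
  ereal_sup [set r | exists (E : closed_subspace X) (F : closed_subspace Y)
      (S : operator (quot_space F) (sub_space E)),
    [/\ finite_dim (sub_space E), finite_dim (quot_space F),
        component A S, qnorm A S <= 1 &
        r = (re `|trace (comp_op T
               (comp_op (inclusion E) (comp_op S (quot_map F))))|)%:E]].

Definition adjoint_class (A : operator_class) : operator_class :=
  OperatorClass
    (fun X Y => [set T | (adjoint_norm A T < +oo)%E])
    (fun X Y T => fine (adjoint_norm A T)).

(* r_i(t) = sign (sin (2^i pi t)), for i = 1, 2, 3 and so on. *)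
Definition rademacher (i : nat) (t : R) : R := Num.sg (sin (2 ^+ i * pi * t)).

Definition cotype2_bound (V : normedModType K) (C : R) : Prop :=
  0 <= C /\ forall n (x : 'I_n -> V),
  Num.sqrt (\sum_(i < n) rnorm (x i) ^+ 2) <=
  C * Num.sqrt (\int[lebesgue_measure]_(t in `[0, 1])
    rnorm (\sum_(i < n) (emb (rademacher i.+1 t) : K) *: x i) ^+ 2).

Definition has_cotype2 (V : normedModType K) : Prop :=
  exists C, cotype2_bound V C.

Definition cotype2_const (V : normedModType K) : R :=
  inf [set C | cotype2_bound V C].

End OperatorIdeals.

(* Main.v *)
From HB Require Import structures.
Require Import Defs.
From mathcomp Require Import all_boot all_order all_algebra complex sesquilinear.
From mathcomp Require Import all_classical all_reals all_analysis.
From mathcomp Require Import ring lra.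
Set Implicit Arguments.
Unset Strict Implicit.
Unset Printing Implicit Defensive.
Import Order.TTheory GRing.Theory Num.Theory numFieldNormedType.Exports.
Local Open Scope classical_set_scope.
Local Open Scope ring_scope.

(** The norm of the product of the Hilbert operators with [A] satisfies the
    triangle inequality only if [A] is small on operators into Hilbert spaces:
    up to averaging, it is dominated there by the 2-summing norm. Since the
    2-summing norm is its own dual under the trace, an operator [T] whose
    adjoint norm with respect to the product is [t] is 2-summing with constant
    [t]. By Pietsch's domination theorem it then factors through a Hilbert
    space with norm at most [t].

    To see what the triangle inequality forces, let [r_j] be the coordinate
    functions on the set of signs of length [m], and consider the operator from
    the functions on ['I_m] to the functions on the signs, both with the
    supremum norm, that maps the [j]-th unit vector to [r_j]. It is a sum of [m]
    rank one operators of norm 1, so it is a composition [V U] through a Hilbert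
    space with [|V| A(U) < m (1 + eps)]. Orthonormalizing the images of the unit
    vectors under [U] gives [e_i] and diagonal coefficients
    [d_i = <U unit_i, e_i>]; averages over signs show that the sum of the
    [d_i^-2] is at most [|V|^2], whence
    [A(U) sqrt m <= (1 + eps) \sum_i d_i] ([diagonal_factor]).

    Let now [x_i] be in [X] and [b_i] in the unit ball of the dual of [Y], for
    [i] below [m]. The operators [y |-> (b_j y)_j], [U] and
    [h |-> \sum_i <h, e_i> x_i] compose to a test operator for the adjoint norm,
    and its trace with [T] is the sum of the [<U unit_j, e_i> b_j (T x_i)]
    ([adjoint_bilinear_le]). Changing signs and shifting the indices cyclically
    gives further test operators; their average is the mean of the [d_i] times
    the sum of the [b_i (T x_i)]. Norming functionals [b_i] give
    [\sum_i |T x_i| <= t w sqrt m], where [w^2] is the weak square sum of the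
    [x_i] ([adjoint_sum_le]), and repeating vectors turns this into the
    2-summing inequality ([adjoint_two_summing]).

    Pietsch's theorem is proved by applying the Hahn-Banach theorem to
    functions on the dual ball ([pietsch_domination]). It yields a semi-inner
    product on [X] whose completion is the Hilbert space
    ([hilbert_completion], [two_summing_hilbert]). The passage from the estimate
    with constant 1 to the one with the cotype constants rests on these being at
    least 1 on nonzero spaces ([cotype2_const_ge1]). *)

(** * The scalar field *)

Section ScalarTheory.
Variables (R : realType) (k : scalar_kind).
Local Notation K := (scalar_field R k).
Implicit Types (z w : K) (r s : R).

Definition sabs z : R := re `|z|.

Lemma sabsE z : emb (sabs z) = `|z|. Proof. exact: reK. Qed.

Lemma sabs_ge0 z : 0 <= sabs z.
Proof. by rewrite -(re0 R k); apply: re_le. Qed.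

Lemma sabsM z w : sabs (z * w) = sabs z * sabs w.
Proof. by rewrite /sabs normrM reM. Qed.

Lemma sabsD z w : sabs (z + w) <= sabs z + sabs w.
Proof. by rewrite /sabs -reD; apply/re_le/ler_normD. Qed.

Lemma sabsV z : sabs z^-1 = (sabs z)^-1. Proof. exact: re_normV. Qed.

Lemma sabs0 : sabs 0 = 0. Proof. by rewrite /sabs normr0 re0. Qed.

Lemma sabsN z : sabs (- z) = sabs z. Proof. by rewrite /sabs normrN. Qed.

Lemma sabs1 : sabs 1 = 1. Proof. by rewrite /sabs normr1 -(emb1 R k) embK. Qed.

Lemma sabs_eq0 z : sabs z = 0 -> z = 0.
Proof. by move=> h; apply/eqP; rewrite -normr_eq0 -sabsE h emb0. Qed.

Lemma sabs_sum I (r : seq I) (P : pred I) (F : I -> K) :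
  sabs (\sum_(i <- r | P i) F i) <= \sum_(i <- r | P i) sabs (F i).
Proof.
elim/big_ind2 : _ => //; first by rewrite sabs0.
by move=> a b c d ab cd; apply: le_trans (sabsD _ _) _; rewrite lerD.
Qed.

Lemma embN r : @emb R k (- r) = - emb r.
Proof. by apply/eqP; rewrite -addr_eq0 -embD addNr emb0. Qed.

Lemma emb_sum I (r : seq I) (P : pred I) (F : I -> R) :
  @emb R k (\sum_(i <- r | P i) F i) = \sum_(i <- r | P i) emb (F i).
Proof. by apply: (big_morph _ (@embD R k)); rewrite emb0. Qed.

Lemma emb_nat n : @emb R k n%:R = n%:R.
Proof. by elim: n => [|n IH]; rewrite ?emb0// -!natr1 embD IH emb1. Qed.

Lemma reN z : re (- z) = - re z.
Proof. by apply/eqP; rewrite -addr_eq0 -reD addNr re0. Qed.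

Lemma reB z w : re (z - w) = re z - re w.
Proof. by rewrite reD reN. Qed.

Lemma re_sum I (r : seq I) (P : pred I) (F : I -> K) :
  re (\sum_(i <- r | P i) F i) = \sum_(i <- r | P i) re (F i).
Proof. by apply: (big_morph _ (@reD R k)); rewrite re0. Qed.

Lemma re_embM r z : re (emb r * z) = r * re z.
Proof.
rewrite /re /emb; move: z; case: k => //= -[a b] /=.
by rewrite mul0r subr0.
Qed.

Lemma sabs_emb r : sabs (emb r) = `|r|.
Proof.
rewrite /sabs /re /emb; case: k => //=.
by rewrite expr0n addr0 sqrtr_sqr.
Qed.

Lemma re_le_sabs z : `|re z| <= sabs z.
Proof.
rewrite /sabs /re; move: z; case: k => // z.
by have := normc_ge_Re z; rewrite lecE => /andP[].
Qed.

Lemma re_ler z : re z <= sabs z.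
Proof. exact: le_trans (ler_norm _) (re_le_sabs z). Qed.

Lemma sabs_nat n : sabs n%:R = n%:R.
Proof. by rewrite -emb_nat sabs_emb ger0_norm. Qed.

Local Notation conj := (@scalar_conj R k).

Lemma conjD z w : conj (z + w) = conj z + conj w.
Proof.
rewrite /scalar_conj; move: z w; case: k => //= -[a b] [c d] /=.
by apply/eqP; rewrite eq_complex /= opprD !eqxx.
Qed.

Lemma conjM z w : conj (z * w) = conj z * conj w.
Proof.
rewrite /scalar_conj; move: z w; case: k => //= -[a b] [c d] /=.
by apply/eqP; rewrite eq_complex /= mulrNN mulrN mulNr -opprD !eqxx.
Qed.

Lemma conj_emb r : conj (emb r) = emb r.
Proof. by rewrite /scalar_conj /emb; case: k => //=; rewrite oppr0. Qed.

Lemma scalar_conjK z : conj (conj z) = z.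
Proof. by rewrite /scalar_conj; move: z; case: k => //= -[a b]; rewrite /= opprK. Qed.

Lemma re_conj z : re (conj z) = re z.
Proof. by rewrite /scalar_conj /re; move: z; case: k => //= -[a b]. Qed.

Lemma mul_conj z : z * conj z = emb (sabs z ^+ 2).
Proof.
rewrite /scalar_conj /sabs /re /emb; move: z; case: k => //= z.
  by rewrite real_normK ?num_real// expr2.
case: z => a b /=; rewrite sqr_sqrtr ?addr_ge0 ?sqr_ge0//.
by apply/eqP; rewrite eq_complex /= !expr2; apply/andP; split; apply/eqP; ring.
Qed.

Lemma conj0 : conj 0 = 0. Proof. by rewrite -(emb0 R k) conj_emb. Qed.

Lemma conjN z : conj (- z) = - conj z.
Proof. by apply/eqP; rewrite -addr_eq0 -conjD addNr conj0. Qed.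

Lemma conjB z w : conj (z - w) = conj z - conj w.
Proof. by rewrite conjD conjN. Qed.

Lemma conj_sum I (r : seq I) (P : pred I) (F : I -> K) :
  conj (\sum_(i <- r | P i) F i) = \sum_(i <- r | P i) conj (F i).
Proof. by apply: (big_morph _ conjD); rewrite conj0. Qed.

Lemma sabs_conj z : sabs (conj z) = sabs z.
Proof.
have h : sabs (conj z) ^+ 2 = sabs z ^+ 2.
  by apply: (@emb_inj R k); rewrite -!mul_conj scalar_conjK mulrC.
by move/eqP : h; rewrite eqrXn2// ?sabs_ge0// => /eqP.
Qed.

(** With the value 0 over the reals, one formula over both scalar fields
    recovers a linear functional from its real part, and a sesquilinear form
    from its quadratic form. *)
Definition imag : K :=
  match k return scalar_field R k with
  | real_scalars => 0
  | complex_scalars => Complex 0 1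
  end.

Lemma re_imE z : z = emb (re z) - imag * emb (re (imag * z)).
Proof.
rewrite /imag /emb /re; move: z; case: k => /= [z|[a b]].
  by rewrite mul0r subr0.
by apply/eqP; rewrite eq_complex /=; apply/andP; split; apply/eqP; ring.
Qed.

Lemma imagP : imag = 0 /\ (forall z, conj z = z) \/ imag * imag = -1.
Proof.
rewrite /imag /scalar_conj; case: k => /=; [by left|right].
by apply/eqP; rewrite eq_complex /=; apply/andP; split; apply/eqP; ring.
Qed.

Lemma conj_imag : conj imag = - imag.
Proof.
rewrite /imag /scalar_conj; case: k => /=; first by rewrite oppr0.
by apply/eqP; rewrite eq_complex /= oppr0 !eqxx.
Qed.

Lemma conj_real z : conj z = z -> z = emb (re z).
Proof.
rewrite /scalar_conj /re /emb; move: z; case: k => //= -[a b] /= [] h.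
by have -> : b = 0 by lra.
Qed.

Lemma phaseP z : exists2 u : K, sabs u <= 1 & u * z = emb (sabs z).
Proof.
have [->|z0] := eqVneq z 0.
  by exists 0; rewrite sabs0 ?ler01// mulr0 emb0.
have s0 : sabs z != 0 by apply: contra_neq z0; exact: sabs_eq0.
exists (emb (sabs z)^-1 * conj z).
  by rewrite sabsM sabs_conj sabs_emb ger0_norm ?invr_ge0 ?sabs_ge0// mulVf.
by rewrite -mulrA (mulrC _ z) mul_conj -embM expr2 mulKf.
Qed.

End ScalarTheory.
Arguments imag {R k}.

(** * The Hahn-Banach theorem *)

Section HahnBanach.
Variables (R : realType) (k : scalar_kind).
Local Notation K := (scalar_field R k).
Variable V : lmodType K.
Implicit Types (x y : V) (p : V -> R).

Definition sublinear p : Prop :=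
  (forall x y, p (x + y) <= p x + p y) /\
  (forall r x, 0 < r -> p (emb r *: x) = r * p x).

Lemma sublinear0 p : sublinear p -> p 0 = 0.
Proof. by move=> [_ /(_ 2 0 ltac:(by []))]; rewrite scaler0; lra. Qed.

Lemma sublinear_ge p x : sublinear p -> - p (- x) <= p x.
Proof.
move=> sp; have := sp.1 x (- x); rewrite subrr sublinear0//; lra.
Qed.

Lemma inf_sublinear (S : V -> set R) :
  (forall x, has_inf (S x)) ->
  (forall x y a b, S x a -> S y b -> exists2 c, S (x + y) c & c <= a + b) ->
  (forall r x a, 0 < r -> S x a -> S (emb r *: x) (r * a)) ->
  sublinear (fun x => inf (S x)).
Proof.
move=> Si SD SZ.
have lb x a : S x a -> inf (S x) <= a by move=> Sa; apply: ge_inf => //; exact: (Si x).2.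
have Zle r x : 0 < r -> r * inf (S x) <= inf (S (emb r *: x)).
  move=> r0; apply: lb_le_inf; first exact: (Si _).1.
  move=> a Sa; rewrite -ler_pdivlMl//; apply: lb.
  rewrite -[x in S x](_ : emb r^-1 *: (emb r *: x) = x); last first.
    by rewrite scalerA -embM mulVf ?gt_eqF// emb1 scale1r.
  by apply: SZ => //; rewrite invr_gt0.
split=> [x y|r x r0].
  rewrite -lerBlDr; apply: lb_le_inf; first exact: (Si _).1.
  move=> a Sa; rewrite lerBlDr -lerBlDl; apply: lb_le_inf; first exact: (Si _).1.
  move=> b Sb; rewrite lerBlDl.
  have [c Sc] := SD _ _ _ _ Sa Sb; apply: le_trans.
  exact: lb.
apply/eqP; rewrite eq_le Zle// andbT.
have := @Zle r^-1 (emb r *: x); rewrite invr_gt0 => /(_ r0).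
rewrite scalerA -embM mulVf ?gt_eqF// emb1 scale1r.
by rewrite ler_pdivrMl.
Qed.

(** A sublinear functional below [p], and linear along the direction [y]: a
    minimal [p] must agree with it. *)
Let tilt p y x := inf [set p (x + emb t *: y) - t * p y | t in [set t | 0 <= t]].

Let tilt_inf p y x : sublinear p ->
  has_inf [set p (x + emb t *: y) - t * p y | t in [set t | 0 <= t]].
Proof.
move=> sp; split.
  by exists (p (x + emb 0 *: y) - 0 * p y); exists 0 => /=.
exists (- p (- x)) => _ [t /= t0 <-].
have [->|t1] := eqVneq t 0.
  by rewrite emb0 scale0r addr0 mul0r subr0 sublinear_ge.
rewrite -(sp.2 t y) ?lt_def ?t1//.
have := sp.1 (x + emb t *: y) (- x); rewrite addrAC subrr add0r; lra.
Qed.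

Let tilt_sublinear p y : sublinear p -> sublinear (tilt p y).
Proof.
move=> sp; apply: inf_sublinear => [x|x x' _ _ [t /= t0 <-] [t' /= t'0 <-]|
    r x _ r0 [t /= t0 <-]].
- exact: tilt_inf.
- exists (p (x + x' + emb (t + t') *: y) - (t + t') * p y).
    by exists (t + t') => //=; rewrite addr_ge0.
  rewrite embD scalerDl addrACA.
  by have := sp.1 (x + emb t *: y) (x' + emb t' *: y); lra.
- exists (r * t) => /=; first by rewrite mulr_ge0// ltW.
  by rewrite embM -scalerA -scalerDr sp.2// mulrBr mulrA.
Qed.

Let tilt_le p y x : sublinear p -> tilt p y x <= p x.
Proof.
move=> sp; apply: ge_inf; first exact: (tilt_inf y x sp).2.
by exists 0 => //=; rewrite emb0 scale0r addr0 mul0r subr0.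
Qed.

Let tilt_le1 p y x : sublinear p -> tilt p y x <= p (x + y) - p y.
Proof.
move=> sp; apply: ge_inf; first exact: (tilt_inf y x sp).2.
by exists 1 => //=; rewrite emb1 scale1r mul1r.
Qed.

(** A minimal sublinear functional below [p] is linear, since it agrees with
    all its tilts; minimal ones exist by Zorn's lemma. *)
Lemma hahn_banach p : sublinear p -> exists f : V -> R,
  [/\ forall x y, f (x + y) = f x + f y,
      forall r x, f (emb r *: x) = r * f x & forall x, f x <= p x].
Proof.
move=> sp.
pose T := {q : V -> R | sublinear q /\ forall x, q x <= p x}.
pose t0 : T := exist _ p (conj sp (fun x => lexx (p x))).
pose Rel (q q' : T) := `[< forall x, sval q' x <= sval q x >].
have [q mq] : exists q : T, premaximal Rel q.
  apply: (@ZL_preorder _ t0).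
  - by move=> q; apply/asboolP.
  - move=> a b c /asboolP ab /asboolP bc; apply/asboolP => x.
    exact: le_trans (bc x) (ab x).
  move=> A totA; have [[a Aa]|A0] := pselect (exists a, A a); last first.
    by exists t0 => s As; exfalso; apply: A0; exists s.
  pose S x := [set sval q x | q in A].
  have Si x : has_inf (S x).
    split; first by exists (sval a x), a.
    exists (- p (- x)) => _ [q Aq <-]; have [sq qp] := svalP q.
    by apply: le_trans (sublinear_ge _ sq); rewrite lerN2.
  have sS : sublinear (fun x => inf (S x)).
    apply: inf_sublinear => // [x y _ _ [b Ab <-] [c Ac <-]|r x _ r0 [b Ab <-]].
      have [/asboolP bc|/asboolP cb] := totA _ _ Ab Ac.
        exists (sval c (x + y)); first by exists c.
        apply: le_trans ((svalP c).1.1 x y) _.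
        by rewrite lerD2r.
      exists (sval b (x + y)); first by exists b.
      apply: le_trans ((svalP b).1.1 x y) _.
      by rewrite lerD2l.
    by exists b => //; rewrite (svalP b).1.2.
  have Sle q x : A q -> inf (S x) <= sval q x.
    by move=> Aq; apply: ge_inf; [exact: (Si x).2|exists q].
  have Sp x : inf (S x) <= p x by apply: le_trans (Sle _ x Aa) _; exact: (svalP a).2.
  exists (exist _ (fun x => inf (S x)) (conj sS Sp)) => s As.
  by apply/asboolP => x; exact: Sle.
have [sq qp] := svalP q; set f := sval q in sq qp.
have fadd y x : f (x + y) = f x + f y.
  have tp x' : tilt f y x' <= p x' by apply: le_trans (tilt_le y x' sq) (qp x').
  have /asboolP /(_ x) /= := mq (exist _ (tilt f y) (conj (tilt_sublinear y sq) tp))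
    (asboolT (fun x => tilt_le y x sq)).
  have := tilt_le1 y x sq; have := sq.1 x y; rewrite -/f => h1 h2 h3.
  apply/eqP; rewrite eq_le h1; lra.
have f0 : f 0 = 0 by exact: sublinear0.
have fN x : f (- x) = - f x.
  by apply/eqP; rewrite -addr_eq0 -fadd addNr f0.
exists f; split=> // r x.
have [r0|r0|->] := ltgtP r 0; last by rewrite emb0 scale0r f0 mul0r.
  rewrite -[r]opprK embN scaleNr fN sq.2 ?oppr_gt0//; lra.
exact: sq.2.
Qed.

(** Tilting [p] along [x0] first makes the functional attain [p x0]. *)
Lemma hahn_banach_attained p x0 : sublinear p -> exists f : V -> R,
  [/\ forall x y, f (x + y) = f x + f y,
      forall r x, f (emb r *: x) = r * f x,
      forall x, f x <= p x & f x0 = p x0].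
Proof.
move=> sp; have [f [fD fZ fp]] := hahn_banach (tilt_sublinear x0 sp).
have fp' x : f x <= p x := le_trans (fp x) (tilt_le x0 x sp).
exists f; split=> //; apply/eqP; rewrite eq_le fp'/=.
have := le_trans (fp (- x0)) (tilt_le1 x0 (- x0) sp).
rewrite addNr sublinear0// -[- x0]scale1r -(emb1 R k) scalerN -scaleNr -embN fZ.
lra.
Qed.

(** Over the complex numbers, the only linear functional with real part [f];
    over the reals, where [imag] is 0, [f] itself. *)
Definition complexify (f : V -> R) x : K :=
  emb (f x) - imag * emb (f (imag *: x)).

Section Complexify.
Variable f : V -> R.
Hypotheses (fD : forall x y, f (x + y) = f x + f y)
  (fZ : forall r x, f (emb r *: x) = r * f x).

Let f0 : f 0 = 0.
Proof. by have := fZ 0 0; rewrite scaler0 mul0r. Qed.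

Let fN x : f (- x) = - f x.
Proof. by apply/eqP; rewrite -addr_eq0 -fD addNr f0. Qed.

Let FD x y : complexify f (x + y) = complexify f x + complexify f y.
Proof.
by rewrite /complexify scalerDr !fD !embD mulrDr opprD addrACA.
Qed.

Let FZr r x : complexify f (emb r *: x) = emb r * complexify f x.
Proof.
by rewrite /complexify scalerA (mulrC imag (emb r)) -scalerA !fZ !embM mulrBr (mulrCA (emb r)).
Qed.

Let FZi x : complexify f (imag *: x) = imag * complexify f x.
Proof.
rewrite /complexify scalerA mulrBr mulrA; have [[-> _]|->] := imagP R k.
  by rewrite !mul0r !scale0r f0 emb0 subrr.
by rewrite scaleN1r fN embN mulrN opprK mulN1r opprK addrC.
Qed.

Lemma complexify_linear (a : K) x y :
  complexify f (a *: x + y) = a * complexify f x + complexify f y.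
Proof.
rewrite FD; congr (_ + _); rewrite {1 2}(re_imE a).
rewrite scalerBl -[- _]scaleN1r -[-1]opprK opprK -(emb1 R k) -embN FD -scalerA !FZr.
by rewrite FZi FZr embN emb1 mulN1r mulrBl mulrA.
Qed.

Lemma re_complexify x : re (complexify f x) = f x.
Proof.
rewrite /complexify reB embK mulrC re_embM.
suff -> : re (@imag R k) = 0 by rewrite mulr0 subr0.
by rewrite /imag /re; case: k.
Qed.

(** The modulus of a linear functional is controlled by its real part, after
    a rotation of the argument. *)
Lemma complexify_le (p : V -> R) :
  (forall x, f x <= p x) -> (forall u x, sabs u <= 1 -> p (u *: x) <= p x) ->
  forall x, sabs (complexify f x) <= p x.
Proof.
move=> fp pu x; have [u u1 e] := phaseP (complexify f x).
have h : complexify f (u *: x) = emb (sabs (complexify f x)).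
  rewrite -[u *: x]addr0 complexify_linear e.
  by have := FZr 0 0; rewrite scaler0 emb0 mul0r => ->; rewrite addr0.
by rewrite -(embK k (sabs _)) -h re_complexify; apply: le_trans (fp _) (pu _ _ u1).
Qed.

End Complexify.
End HahnBanach.

Section NormingFunctional.
Variables (R : realType) (k : scalar_kind).
Local Notation K := (scalar_field R k).

Lemma norming_functional (X : normedModType K) (x0 : X) :
  exists2 f : operator X (scalar_space R k), opnorm f <= 1 &
    f x0 = emb (rnorm x0) :> K.
Proof.
have sp : sublinear (@rnorm R k X).
  split; first exact: rnormD.
  by move=> r x r0; rewrite rnormZ -/(sabs _) sabs_emb gtr0_norm.
have [f [fD fZ fp fx]] := hahn_banach_attained x0 sp.
have Fle : forall x, sabs (complexify f x) <= rnorm x.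
  apply: complexify_le => // u x u1; rewrite rnormZ -/(sabs u).
  by rewrite ler_piMl// rnorm_ge0.
have Fop : (complexify f : X -> scalar_space R k) \in @is_op R k X (scalar_space R k).
  apply/asboolP; split; first by move=> a x y; exact: complexify_linear.
  by exists 1 => x; rewrite mul1r; exact: Fle.
exists (Op Fop).
  by apply: opnorm_le => x x1 /=; apply: le_trans (Fle x) x1.
rewrite /=; have h : re (complexify f x0) = rnorm x0 by rewrite re_complexify.
(* a scalar whose real part equals its modulus is nonnegative *)
have h2 : sabs (complexify f x0) <= re (complexify f x0) by rewrite h.
rewrite -h; move: (complexify f x0) h2 => z.
rewrite /sabs /re /emb; move: z; case: k => //= -[a b] /= h2.
suff -> : b = 0 by [].
apply/eqP; rewrite -sqrf_eq0 -[_ == 0](_ : (b ^+ 2 <= 0) = _); last first.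
  by rewrite eq_le sqr_ge0 andbT.
have a0 : 0 <= a := le_trans (sqrtr_ge0 _) h2.
have : Num.sqrt (a ^+ 2 + b ^+ 2) ^+ 2 <= a ^+ 2.
  by rewrite ler_sqr ?nnegrE ?sqrtr_ge0.
rewrite sqr_sqrtr ?addr_ge0 ?sqr_ge0//; lra.
Qed.

End NormingFunctional.

(** * Banach spaces of bounded functions *)

Section BoundedFunctions.
Variables (R : realType) (k : scalar_kind).
Local Notation K := (scalar_field R k).
Local Notation S := (scalar_space R k).
Variable B : Type.

Definition is_bounded : {pred B -> S} :=
  fun f => `[< exists M, forall b, sabs (f b) <= M >].

Record bfun_space := BoundedFun {
  bfun :> B -> S; bfunP : bfun \in is_bounded }.

HB.instance Definition _ := [isSub for bfun].
HB.instance Definition _ := [Choice of bfun_space by <:].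

Lemma is_bounded_submod : submod_closed is_bounded.
Proof.
split=> [|a f g /asboolP[M fM] /asboolP[N gN]]; apply/asboolP.
  by exists 0 => b /=; rewrite sabs0.
exists (sabs a * M + N) => b.
apply: le_trans (sabsD _ _) _; rewrite lerD//.
by rewrite [X in sabs X](_ : _ = a * f b)// sabsM ler_wpM2l// sabs_ge0.
Qed.
HB.instance Definition _ :=
  GRing.isSubmodClosed.Build K (B -> S) is_bounded is_bounded_submod.
HB.instance Definition _ := [SubChoice_isSubLmodule of bfun_space by <:].

Implicit Types f g : bfun_space.

(** 0 is thrown in so that the supremum makes sense when [B] is empty. *)
Let values f : set R := [set r | r = 0 \/ exists b, r = sabs (f b)].

Definition sup_norm f : R := sup (values f).

Let values_sup f : has_sup (values f).
Proof.
split; first by exists 0; left.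
have /asboolP[M fM] := bfunP f; exists `|M| => _ [->|[b ->]] //.
exact: le_trans (fM b) (ler_norm M).
Qed.

Lemma sup_norm_ge0 f : 0 <= sup_norm f.
Proof. by apply: sup_upper_bound; [exact: values_sup|left]. Qed.

Lemma sup_norm_ub f b : sabs (f b) <= sup_norm f.
Proof. by apply: sup_upper_bound; [exact: values_sup|right; exists b]. Qed.

Lemma sup_norm_le f c : 0 <= c -> (forall b, sabs (f b) <= c) -> sup_norm f <= c.
Proof.
move=> c0 fc; apply: ge_sup; first exact: (values_sup f).1.
by move=> _ [->|[b ->]].
Qed.

Lemma bfunD f g b : (f + g) b = f b + g b. Proof. by []. Qed.
Lemma bfunN f b : (- f) b = - f b. Proof. by []. Qed.
Lemma bfunZ (a : K) f b : (a *: f) b = a * f b. Proof. by []. Qed.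
Lemma bfun_eq f g : (forall b, f b = g b) -> f = g.
Proof. by move=> h; apply/val_inj/funext. Qed.

Let supD f g : @emb R k (sup_norm (f + g)) <= emb (sup_norm f) + emb (sup_norm g).
Proof.
rewrite -embD emb_le; apply: sup_norm_le => [|b].
  by rewrite addr_ge0 ?sup_norm_ge0.
by rewrite bfunD (le_trans (sabsD _ _))// lerD ?sup_norm_ub.
Qed.

Let supZ_le (a : K) f : sup_norm (a *: f) <= sabs a * sup_norm f.
Proof.
apply: sup_norm_le => [|b]; first by rewrite mulr_ge0 ?sabs_ge0 ?sup_norm_ge0.
by rewrite bfunZ sabsM ler_wpM2l ?sabs_ge0 ?sup_norm_ub.
Qed.

Let supZ (a : K) f : @emb R k (sup_norm (a *: f)) = `|a| * emb (sup_norm f).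
Proof.
rewrite -sabsE -embM; congr emb; apply/eqP; rewrite eq_le supZ_le/=.
have [->|a0] := eqVneq a 0; first by rewrite sabs0 mul0r sup_norm_ge0.
have := supZ_le a^-1 (a *: f); rewrite scalerA mulVf// scale1r.
by rewrite /sabs re_normV ler_pdivlMl// re_gt0 ?normr_gt0.
Qed.

Let sup_eq0 f : @emb R k (sup_norm f) = 0 -> f = 0.
Proof.
rewrite -(emb0 R k) => /emb_inj f0; apply: bfun_eq => b; apply: sabs_eq0.
by apply/eqP; rewrite eq_le sabs_ge0 andbT -f0 sup_norm_ub.
Qed.

HB.instance Definition _ := @Lmodule_isNormed.Build K bfun_space
  (fun f => emb (sup_norm f)) supD supZ sup_eq0.

Lemma rnorm_bfun f : rnorm f = sup_norm f. Proof. exact: embK. Qed.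

Lemma rnorm_bfun_ub f b : sabs (f b) <= rnorm f.
Proof. by rewrite rnorm_bfun sup_norm_ub. Qed.

Let bfun_cauchy_cvg (F : set_system bfun_space) :
  ProperFilter F -> cauchy F -> cvg F.
Proof.
move=> FF cF; have cE := cauchy_rnorm FF cF.
have ev b : cvg ((fun f : bfun_space => f b) @ F).
  apply: cauchy_cvg; apply: rnorm_cauchy => e e0; have [a Fa] := cE e e0.
  exists (a b).
  apply: (@filterS _ F _ [set f | rnorm (a - f) < e]) Fa => f /=.
  by apply: le_lt_trans; exact: (rnorm_bfun_ub (a - f) b).
pose l b := lim ((fun f : bfun_space => f b) @ F).
have close (e : R) (a : bfun_space) : F [set f | rnorm (a - f) < e] ->
    forall b, sabs (a b - l b) <= e.
  move=> Fa b; apply/ler_addgt0Pr => d d0.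
  have Fl : F [set f : bfun_space | rnorm (l b - f b) < d].
    exact: (cvg_rnorm_lt _ (ev b) d0).
  have /filter_ex[f [af fl]] := @filterI _ F FF _ _ Fa Fl.
  rewrite -(subrKA (f b)) (le_trans (sabsD _ _))// lerD//.
    exact: le_trans (rnorm_bfun_ub (a - f) b) (ltW af).
  by move: fl => /= /ltW; rewrite rnormB.
have lP : (l : B -> S) \in is_bounded.
  have [a Fa] := cE 1 ltr01; apply/asboolP; exists (1 + rnorm a) => b.
  rewrite -[l b](subrK (a b)) (le_trans (sabsD _ _))// lerD ?rnorm_bfun_ub//.
  by rewrite -sabsN opprB; exact: close.
apply/cvg_ex; exists (BoundedFun lP); apply: cvg_rnormP => e e0.
have e30 : 0 < e / 3 by rewrite divr_gt0.
have [a Fa] := cE _ e30.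
apply: filterS (Fa) => f /= af; rewrite rnormB.
apply: (@le_lt_trans _ _ (e / 3 + e / 3)); last by lra.
rewrite rnorm_bfun; apply: sup_norm_le => [|b]; first by lra.
change (sabs (f b - l b) <= e / 3 + e / 3).
rewrite -(subrKA (a b)) (le_trans (sabsD _ _))// lerD ?close//.
by apply: le_trans (rnorm_bfun_ub (f - a) b) _; rewrite rnormB ltW.
Qed.
HB.instance Definition _ :=
  Uniform_isComplete.Build bfun_space bfun_cauchy_cvg.

End BoundedFunctions.

(** * Semi-inner products *)

Lemma discriminant_le (R : realType) (a b c : R) : 0 <= c ->
  (forall t, 0 <= a - 2 * t * b + t ^+ 2 * c) -> b ^+ 2 <= a * c.
Proof.
move=> c0 h; have [c1|c1] := eqVneq c 0.
  have [->|b0] := eqVneq b 0; first by rewrite c1 mulr0 expr0n.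
  have := h ((a + 1) / (2 * b)); rewrite c1 mulr0 addr0.
  have -> : 2 * ((a + 1) / (2 * b)) * b = a + 1 by field.
  by lra.
have cp : 0 < c by rewrite lt_def c1.
have := h (b / c).
have -> : a - 2 * (b / c) * b + (b / c) ^+ 2 * c = (a * c - b ^+ 2) / c by field.
by rewrite pmulr_lge0 ?invr_gt0// subr_ge0.
Qed.

Section SemiInner.
Variables (R : realType) (k : scalar_kind).
Local Notation K := (scalar_field R k).
Local Notation conj := (@scalar_conj R k).

Definition semi_inner (V : lmodType K) (q : V -> V -> K) : Prop :=
  [/\ forall a x y z, q (a *: x + y) z = a * q x z + q y z,
      forall x y, q x y = conj (q y x) &
      forall x, 0 <= re (q x x)].

Section Theory.
Variables (V : lmodType K) (q : V -> V -> K) (hq : semi_inner q).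
Implicit Types x y z : V.

Lemma inner_sym x y : q x y = conj (q y x).
Proof. by case: hq. Qed.

Lemma innerDl x y z : q (x + y) z = q x z + q y z.
Proof. by case: hq => h _ _; rewrite -{1}[x]scale1r h mul1r. Qed.

Lemma inner0l z : q 0 z = 0.
Proof. by apply: (addrI (q 0 z)); rewrite -innerDl !addr0. Qed.

Lemma innerZl a x z : q (a *: x) z = a * q x z.
Proof. by case: hq => h _ _; rewrite -[a *: x]addr0 h inner0l addr0. Qed.

Lemma innerNl x z : q (- x) z = - q x z.
Proof. by rewrite -scaleN1r innerZl mulN1r. Qed.

Lemma innerBl x y z : q (x - y) z = q x z - q y z.
Proof. by rewrite innerDl innerNl. Qed.

Lemma innerDr x y z : q x (y + z) = q x y + q x z.
Proof. by rewrite inner_sym innerDl conjD -!inner_sym. Qed.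

Lemma innerZr a x y : q x (a *: y) = conj a * q x y.
Proof. by rewrite inner_sym innerZl conjM -inner_sym. Qed.

Lemma innerNr x y : q x (- y) = - q x y.
Proof. by rewrite inner_sym innerNl conjN -inner_sym. Qed.

Lemma innerBr x y z : q x (y - z) = q x y - q x z.
Proof. by rewrite innerDr innerNr. Qed.

Lemma inner0r x : q x 0 = 0.
Proof. by rewrite inner_sym inner0l conj0. Qed.

Lemma inner_suml I (r : seq I) (P : pred I) (F : I -> V) z :
  q (\sum_(i <- r | P i) F i) z = \sum_(i <- r | P i) q (F i) z.
Proof. by apply: (big_morph (q^~ z)) => [x y|]; [exact: innerDl|exact: inner0l]. Qed.

Lemma inner_sumr I (r : seq I) (P : pred I) (F : I -> V) z :
  q z (\sum_(i <- r | P i) F i) = \sum_(i <- r | P i) q z (F i).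
Proof. by apply: (big_morph (q z)) => [x y|]; [exact: innerDr|exact: inner0r]. Qed.

Definition quad x : R := re (q x x).

Lemma quad_ge0 x : 0 <= quad x. Proof. by case: hq => _ _; exact. Qed.

Lemma innerE x : q x x = emb (quad x).
Proof. by apply: conj_real; rewrite -inner_sym. Qed.

Lemma quadZ a x : quad (a *: x) = sabs a ^+ 2 * quad x.
Proof. by rewrite /quad innerZl innerZr mulrA mul_conj re_embM. Qed.

Lemma cauchy_schwarz x y : sabs (q x y) ^+ 2 <= quad x * quad y.
Proof.
have [u u1 uE] := phaseP (q x y); apply: discriminant_le; first exact: quad_ge0.
move=> t; have := quad_ge0 (u *: x - emb t *: y).
have -> : quad (u *: x - emb t *: y) =
    quad (u *: x) - 2 * t * re (q (u *: x) y) + t ^+ 2 * quad y.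
  rewrite {1}/quad innerBl !innerBr !(innerZl (emb t)) !(innerZr (emb t)) conj_emb.
  by rewrite [q y _]inner_sym !reB !re_embM re_conj /quad; ring.
rewrite innerZl uE embK.
move/le_trans; apply; rewrite lerD2r lerD2r quadZ ler_piMl ?quad_ge0//.
by rewrite expr_le1 ?sabs_ge0.
Qed.

(** Over the reals the terms with [imag] vanish, and symmetry of [q] takes
    their place. *)
Lemma polarization x y : q (x + y) (x + y) - q (x - y) (x - y) +
    imag * (q (x + imag *: y) (x + imag *: y) - q (x - imag *: y) (x - imag *: y))
  = 4 * q x y.
Proof.
have E z : q (x + z) (x + z) - q (x - z) (x - z) = 2 * (q x z + q z x).
  rewrite !innerDl !innerDr !innerNl !innerNr opprK.
  by move: (q x x) (q x z) (q z x) (q z z) => a b c d; ring.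
rewrite !E innerZl innerZr conj_imag; have [[-> h]|] := imagP R k.
  by rewrite [q y x]inner_sym h mul0r addr0; move: (q x y) => a; ring.
move: (@imag R k) (q x y) (q y x) => i a b ii.
have -> : 2 * (a + b) + i * (2 * (- i * a + i * b)) =
  2 * (a + b) + 2 * (b - a) * (i * i) by ring.
by rewrite ii; ring.
Qed.

End Theory.
End SemiInner.

(** * Extension of operators from a dense range *)

Section DenseRange.
Variables (R : realType) (k : scalar_kind).
Local Notation K := (scalar_field R k).

Lemma closedI_rnorm (V : normedModType K) (C : set V) :
  (forall l, (forall e : R, 0 < e -> exists2 x, C x & rnorm (l - x) < e) -> C l) -> closed C.
Proof.
move=> h l cl; apply: h => e e0.
have [x [Cx xl]] := cl _ (@cvg_rnorm_lt _ _ _ (nbhs l) l _ (fun _ h => h) _ e0).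
by exists x.
Qed.

Variables (V : lmodType K) (Z : completeNormedModType K) (h : V -> Z).
Hypothesis h_lin : linear h.

Let hB x y : h (x - y) = h x - h y.
Proof. by rewrite -scaleN1r addrC h_lin scaleN1r addrC. Qed.

Let h0 : h 0 = 0.
Proof. by rewrite -(subrr (0 : V)) hB subrr. Qed.

Let close_set := [set f : Z | forall e : R, 0 < e -> exists x, rnorm (f - h x) < e].

Let close0 : close_set 0.
Proof. by move=> e e0; exists 0; rewrite h0 subrr rnorm0. Qed.

Let closeP (a : K) f g : close_set f -> close_set g -> close_set (a *: f + g).
Proof.
move=> cf cg e e0.
have ea : 0 < e / 2 / (sabs a + 1).
  by rewrite !divr_gt0// ltr_wpDl ?sabs_ge0.
have [x xf] := cf _ ea; have e20 : 0 < e / 2 by rewrite divr_gt0.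
have [y yg] := cg _ e20; exists (a *: x + y).
rewrite h_lin opprD addrACA -scalerBr (le_lt_trans (rnormD _ _))// [e]splitr.
rewrite ltr_leD//; last exact: ltW.
rewrite rnormZ -/(sabs a); move: xf; rewrite ltr_pdivlMr ?ltr_wpDl ?sabs_ge0//.
by apply: le_lt_trans; rewrite mulrC ler_wpM2l ?rnorm_ge0// lerDl.
Qed.

Let close_closed : closed close_set.
Proof.
apply: closedI_rnorm => f cf e e0; have e20 : 0 < e / 2 by rewrite divr_gt0.
have [g /(_ _ e20)[x gx] fg] := cf _ e20.
exists x; rewrite -(subrKA g) (le_lt_trans (rnormD _ _))// [e]splitr ltrD//.
Qed.

Definition range_closure : closed_subspace Z :=
  ClosedSubspace close0 closeP close_closed.

Local Notation H := (sub_space range_closure).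

Let h_in x : h x \in in_subspace range_closure.
Proof. by apply/asboolP => e e0; exists x; rewrite subrr rnorm0. Qed.

Definition range_point x : H := SubSpace (h_in x).

Lemma range_point_linear : linear range_point.
Proof. by move=> a x y; apply: val_inj; exact: h_lin. Qed.

Let approx (f : H) (e : R) : 0 < e -> exists x, rnorm (val f - h x) < e.
Proof. by case: f => f /= /asboolP; exact. Qed.

Section Extension.
Variables (Y : completeNormedModType K) (L : V -> Y) (C : R).
Hypotheses (L_lin : linear L) (LC : forall x, rnorm (L x) <= C * rnorm (h x)).
Hypothesis C0 : 0 <= C.

Let LB x y : L (x - y) = L x - L y.
Proof. by rewrite -scaleN1r addrC L_lin scaleN1r addrC. Qed.

Let ext_spec (f : H) (y : Y) := forall x, rnorm (y - L x) <= C * rnorm (val f - h x).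

Let ext_unique f y y' : ext_spec f y -> ext_spec f y' -> y = y'.
Proof.
move=> yf y'f; apply/eqP; rewrite -subr_eq0; apply/eqP; apply: rnorm0_eq0.
apply/eqP; rewrite eq_le rnorm_ge0 andbT; apply/ler_addgt0Pr => e e0; rewrite add0r.
have d0 : 0 < e / (2 * (C + 1)).
  by rewrite divr_gt0 ?mulr_gt0// ltr_wpDl.
have [x] := approx f d0; rewrite ltr_pdivlMr ?mulr_gt0 ?ltr_wpDl// => xf.
rewrite -(subrKA (L x)) (le_trans (rnormD _ _))// [rnorm (L x - _)]rnormB.
have := yf x; have := y'f x; have := rnorm_ge0 (val f - h x); nra.
Qed.

Let ext_exists f : exists y, ext_spec f y.
Proof.
pose d n : R := n.+1%:R^-1.
have d0 n : 0 < d n by rewrite /d invr_gt0.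
have /choice[x xf] := fun n => approx f (d0 n).
have dle n m : (n <= m)%N -> d m <= d n.
  by move=> nm; rewrite /d lef_pV2 ?posrE// ler_nat.
have small (e : R) : 0 < e -> exists N, d N < e.
  move=> e0; have [N _ hN] := near_infty_natSinv_lt (PosNum e0).
  by exists N; exact: (hN N (leqnn N)).
have Ld n m : rnorm (L (x n) - L (x m)) <= C * (d n + d m).
  rewrite -LB; apply: le_trans (LC _) _; rewrite ler_wpM2l// hB.
  rewrite -(subrKA (val f)) (le_trans (rnormD _ _))//.
  by rewrite lerD// ?[rnorm (h _ - _)]rnormB ltW.
have C1 : 0 < 2 * (C + 1) by rewrite mulr_gt0 ?ltr_wpDl.
have /cvg_ex[y Ly] : cvg ((fun n => L (x n)) @ \oo).
  apply: cauchy_cvg; apply: rnorm_cauchy => e e0.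
  have [N dN] := small _ (divr_gt0 e0 C1).
  exists (L (x N)); exists N => // m /= Nm.
  apply: le_lt_trans (Ld _ _) _; move: dN; rewrite ltr_pdivlMr// => dN.
  have h1 : C * d m <= C * d N by rewrite ler_wpM2l// dle.
  move: h1 dN (d0 N); move: (d N) (d m) => p r h1 h2 h3; lra.
exists y => z; apply/ler_addgt0Pr => e e0.
have e20 : 0 < e / 2 by rewrite divr_gt0.
have [N _ yN] := cvg_rnorm_lt _ Ly e20.
have [M dM] := small _ (divr_gt0 e20 C1).
have := yN (maxn N M) (leq_maxl _ _); set n := maxn N M => /= yn.
have {dM} dn : d n < e / 2 / (2 * (C + 1)) by apply: le_lt_trans dM; rewrite dle ?leq_maxr.
move: dn; rewrite ltr_pdivlMr// => dn.
rewrite -(subrKA (L (x n))) (le_trans (rnormD _ _))// -LB.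
have := LC (x n - z); rewrite hB => Lz.
have : rnorm (h (x n) - h z) <= d n + rnorm (val f - h z).
  rewrite -(subrKA (val f)) (le_trans (rnormD _ _))// lerD// rnormB; exact: ltW.
move=> hz; have h1 : C * rnorm (h (x n) - h z) <= C * (d n + rnorm (val f - h z)).
  by rewrite ler_wpM2l.
move: h1 hz dn Lz yn (d0 n); move: (d n) => p h1 hz dn Lz yn p0; lra.
Qed.

(** The value of the extension at [f] is the only [y] such that
    [|y - L x| <= C |f - h x|] for all [x]; linearity and the norm bound follow
    from this description without any choice of approximating sequences. *)
Lemma range_extension : exists W : operator H Y,
  opnorm W <= C /\ forall x, W (range_point x) = L x.
Proof.
have /choice[w wP] := ext_exists.
have w_lin : linear w.
  move=> a f g; apply: (ext_unique (wP _)) => z; apply/ler_addgt0Pr => e e0.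
  have D0 : 0 < 2 * (C + 1) * (sabs a + 1).
    by rewrite !mulr_gt0 ?ltr_wpDl ?sabs_ge0.
  have [x xf] := approx f (divr_gt0 e0 D0); have [y yg] := approx g (divr_gt0 e0 D0).
  have -> : a *: w f + w g - L z =
      a *: (w f - L x) + (w g - L y) + L (a *: x + y - z).
    by rewrite LB L_lin scalerBr [a *: w f - _ + _]addrACA -opprD subrKA.
  have N1 := LC (a *: x + y - z).
  have N2 : rnorm (h (a *: x + y - z)) <= rnorm (val (a *: f + g) - h z)
      + (sabs a * rnorm (val f - h x) + rnorm (val g - h y)).
    rewrite -rnormZ -(rnormN (a *: _)) -(rnormN (val g - _)) -scalerN.
    have -> : h (a *: x + y - z) = (val (a *: f + g) - h z) +
        (a *: - (val f - h x) + - (val g - h y)).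
      rewrite hB h_lin scalerN -opprD scalerBr addrACA -opprD opprB.
      by rewrite [val (_ + _)](_ : _ = a *: val f + val g)// addrC [RHS]addrC subrKA addrC.
    by rewrite (le_trans (rnormD _ _))// lerD2l rnormD.
  rewrite (le_trans (rnormD _ _))// (le_trans (lerD (rnormD _ _) (lexx _)))//.
  rewrite rnormZ -/(sabs a).
  move: xf yg; rewrite !ltr_pdivlMr// => xf yg.
  have A0 := sabs_ge0 a; have wf := wP f x; have wg := wP g y.
  have f0 := rnorm_ge0 (val f - h x); have g0 := rnorm_ge0 (val g - h y).
  have T1 : sabs a * rnorm (w f - L x) <= sabs a * (C * rnorm (val f - h x)).
    by rewrite ler_wpM2l.
  have T2 : rnorm (L (a *: x + y - z)) <= C * (rnorm (val (a *: f + g) - h z)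
      + (sabs a * rnorm (val f - h x) + rnorm (val g - h y))).
    by apply: le_trans N1 _; rewrite ler_wpM2l.
  have a1 : 0 < sabs a + 1 by rewrite ltr_wpDl.
  have T3 : (sabs a * rnorm (val f - h x) + rnorm (val g - h y)) * (2 * (C + 1)) <= e.
    rewrite -(ler_pM2r a1).
    have := ler_wpM2l A0 (ltW xf); lra.
  have T4 : 0 <= sabs a * rnorm (val f - h x) by rewrite mulr_ge0.
  lra.
have w_le f : rnorm (w f) <= C * rnorm f.
  have := wP f 0; rewrite h0 subr0.
  have -> : L 0 = 0 by rewrite -(subrr (0 : V)) LB subrr.
  by rewrite subr0.
have wop : w \in @is_op R k H Y.
  by apply/asboolP; split=> //; exists C.
exists (Op wop); split=> [|x].
  apply: opnorm_le => f f1 /=; apply: le_trans (w_le f) _.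
  by rewrite ler_piMr.
apply: (ext_unique (wP _)) => z /=.
by rewrite -LB (le_trans (LC _))// hB.
Qed.

End Extension.
End DenseRange.

(** * Hilbert spaces *)

Section HilbertSpaces.
Variables (R : realType) (k : scalar_kind).
Local Notation K := (scalar_field R k).
Local Notation conj := (@scalar_conj R k).

Lemma conj_cvg T (F : set_system T) (f : T -> K) (l : K) : Filter F ->
  f @ F --> l -> conj (f x) @[x --> F] --> conj l.
Proof.
move=> FF fl; apply: (@cvg_rnormP R k (scalar_space R k)) => e e0.
have fe : F [set x | sabs (l - f x) < e].
  exact: (@cvg_rnorm_lt R k (scalar_space R k) _ l _ fl).
apply: (@filterS _ F FF [set x | sabs (l - f x) < e]) fe => x /=.
by rewrite /rnorm -conjB -/(sabs _) sabs_conj.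
Qed.

Lemma semi_inner_hilbert (H : completeNormedModType K) (ip : H -> H -> K) :
  semi_inner ip -> (forall x, ip x x = `|x| ^+ 2) -> is_hilbert H.
Proof.
move=> hip ipn.
pose B := @isBilinear.Build K H H K *%R (conj \; *%R) ip
  (fun z x y => innerBl hip x y z) (fun x y z => innerBr hip x y z)
  (fun z a x => innerZl hip a x z) (fun x a y => innerZr hip a x y).
have sym x y : ip x y = (-1) ^+ false * conj (ip y x).
  by rewrite expr0 mul1r -(inner_sym hip).
have pos x : x != 0 -> 0 < ip x x.
  by move=> x0; rewrite ipn exprn_gt0// normr_gt0.
pose ip' : {dot H for conj} := HB.pack ip B
  (@isHermitianSesquilinear.Build K H false conj ip sym)
  (@isDotProduct.Build K H ip pos).
by exists ip' => x; exact: ipn.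
Qed.

Lemma hilbert_semi_inner (H : completeNormedModType K) : is_hilbert H ->
  exists2 ip : H -> H -> K, semi_inner ip & forall x, ip x x = emb (rnorm x ^+ 2).
Proof.
move=> [ip ipn].
have ipE x : ip x x = emb (rnorm x ^+ 2).
  by rewrite ipn expr2 embM rnormE -expr2.
exists (ip : H -> H -> K) => //; split=> [a x y z|x y|x].
- by rewrite linearDl linearZl_LR.
- by have := @hermitian_subproof _ _ _ _ ip x y; rewrite expr0 mul1r.
- by rewrite ipE embK sqr_ge0.
Qed.

Section Closure.
Variables (V : lmodType K) (q : V -> V -> K) (hq : semi_inner q).
Variables (Z : completeNormedModType K) (h : V -> Z).
Hypothesis h_lin : linear h.
Hypothesis h_norm : forall x, rnorm (h x) ^+ 2 = quad q x.

Let ip (f g : Z) : K := 4^-1 * (`|f + g| ^+ 2 - `|f - g| ^+ 2 +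
  imag * (`|f + imag *: g| ^+ 2 - `|f - imag *: g| ^+ 2)).

Let ip_h x y : ip (h x) (h y) = q x y.
Proof.
have hZ a z : h (a *: z) = a *: h z.
  have h0 : h 0 = 0 by apply: (addrI (h 0)); rewrite -{1}[h 0]scale1r -h_lin scaler0 !addr0.
  by rewrite -[a *: z]addr0 h_lin h0 addr0.
have hD z w : h (z + w) = h z + h w by rewrite -{1}[z]scale1r h_lin scale1r.
have hN z : - h z = h (- z) by rewrite -[- h z]scaleN1r -hZ scaleN1r.
have n2 z : `|h z| ^+ 2 = q z z.
  by rewrite -rnormE expr2 -embM -expr2 h_norm -innerE.
rewrite /ip -hZ !hN -!hD !n2 polarization// mulKf// pnatr_eq0.
Qed.

Let ip_cvg (f g : nat -> Z) (a b : Z) : f @ \oo --> a -> g @ \oo --> b ->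
  ip (f n) (g n) @[n --> \oo] --> ip a b.
Proof.
move=> fa gb.
have n2 (u : nat -> Z) c : u @ \oo --> c -> (`|u n| ^+ 2) @[n --> \oo] --> (`|c| ^+ 2 : K).
  by move=> uc; rewrite expr2; under eq_fun do rewrite expr2; apply: cvgM; exact: cvg_norm.
have D : (fun n => f n + g n) @ \oo --> a + b by exact: cvgD.
have E : (fun n => f n - g n) @ \oo --> a - b by exact: cvgB.
have ig : (fun n => imag *: g n) @ \oo --> imag *: b by exact: cvgZl_tmp.
have D' : (fun n => f n + imag *: g n) @ \oo --> a + imag *: b by exact: cvgD.
have E' : (fun n => f n - imag *: g n) @ \oo --> a - imag *: b by exact: cvgB.
apply: cvgMr; apply: cvgD.
  by apply: cvgB; exact: n2.
by apply: cvgMr; apply: cvgB; exact: n2.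
Qed.

Let approx_seq (f : sub_space (range_closure h_lin)) :
  exists x : nat -> V, (fun n => h (x n)) @ \oo --> val f.
Proof.
case: f => f fP; have /asboolP cf := fP.
have /choice[x xf] : forall n, exists x, rnorm (f - h x) < n.+1%:R^-1.
  by move=> n; apply: cf; rewrite invr_gt0.
exists x; apply: cvg_rnormP => e e0 /=.
have [N _ hN] := near_infty_natSinv_lt (PosNum e0).
by exists N => // n Nn; apply: lt_trans (xf n) (hN n Nn).
Qed.

(** The inner product is the polarized norm; its algebraic properties pass
    from the range of [h] to the closure by continuity. *)
Lemma range_closure_hilbert : is_hilbert (sub_space (range_closure h_lin)).
Proof.
have hq' a x y z := let: And3 h _ _ := hq in h a x y z.
have U (u : nat -> K) (a b : K) : u @ \oo --> a -> u @ \oo --> b -> a = b.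
  by move=> ua ub; exact: (@norm_cvg_unique K K^o _ _ a b ua ub).
pose ipH (f g : sub_space (range_closure h_lin)) := ip (val f) (val g).
have ipHn f : ipH f f = `|f| ^+ 2.
  have [x xf] := approx_seq f.
  apply: (U (fun n => q (x n) (x n))).
    by under eq_fun do rewrite -ip_h; exact: ip_cvg.
  under eq_fun do rewrite innerE// -h_norm expr2 embM rnormE.
  by rewrite expr2; apply: cvgM; exact: cvg_norm.
apply: (@semi_inner_hilbert _ ipH) => //; split=> [a f g w|f g|f].
- have [x xf] := approx_seq f; have [y yg] := approx_seq g; have [z zw] := approx_seq w.
  apply: (U (fun n => q (a *: x n + y n) (z n))).
    under eq_fun do rewrite -ip_h h_lin; apply: ip_cvg => //.
    by apply: cvgD => //; exact: cvgZl_tmp.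
  under eq_fun do rewrite hq' -!ip_h; apply: cvgD; last exact: ip_cvg.
  by apply: cvgMr; exact: ip_cvg.
- have [x xf] := approx_seq f; have [y yg] := approx_seq g.
  apply: (U (fun n => q (x n) (y n))).
    by under eq_fun do rewrite -ip_h; exact: ip_cvg.
  under eq_fun do rewrite inner_sym// -ip_h; apply: conj_cvg; exact: ip_cvg.
- by rewrite ipHn -rnormE expr2 -embM embK mulr_ge0 ?rnorm_ge0.
Qed.

End Closure.

(** By the Cauchy-Schwarz inequality, [x] and the function [q x] on the unit
    ball of [q] have the same norm; the closure of these functions in the space
    of bounded functions is a Hilbert space. *)
Lemma hilbert_completion (V : lmodType K) (q : V -> V -> K) : semi_inner q ->
  exists (H : completeNormedModType K) (i : V -> H),
  [/\ is_hilbert H, linear i, forall x, rnorm (i x) ^+ 2 = quad q x &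
      forall (Y : completeNormedModType K) (L : V -> Y) (C : R), 0 <= C -> linear L ->
        (forall x, rnorm (L x) <= C * rnorm (i x)) ->
        exists2 W : operator H Y, opnorm W <= C & forall x, W (i x) = L x].
Proof.
move=> hq; pose B := {y : V | quad q y <= 1}.
have b_le x (y : B) : sabs (q x (sval y)) <= Num.sqrt (quad q x).
  rewrite -(ger0_norm (sabs_ge0 _)) -sqrtr_sqr ler_wsqrtr//.
  apply: le_trans (cauchy_schwarz hq _ _) _.
  by rewrite ler_piMr ?quad_ge0// (svalP y).
have hP x : (fun y : B => q x (sval y) : scalar_space R k) \in @is_bounded R k B.
  by apply/asboolP; exists (Num.sqrt (quad q x)) => y; exact: b_le.
pose h x := BoundedFun (hP x).
have h_lin : linear h.
  move=> a x y; apply: bfun_eq => b; case: (hq) => hl _ _.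
  exact: hl.
have h_norm x : rnorm (h x) ^+ 2 = quad q x.
  suff -> : rnorm (h x) = Num.sqrt (quad q x) by rewrite sqr_sqrtr ?quad_ge0.
  have hle : sup_norm (h x) <= Num.sqrt (quad q x).
    by apply: sup_norm_le; [exact: sqrtr_ge0|exact: b_le].
  rewrite rnorm_bfun; apply/eqP; rewrite eq_le hle/=.
  have [->|q0] := eqVneq (quad q x) 0; first by rewrite sqrtr0 sup_norm_ge0.
  have s0 : 0 < Num.sqrt (quad q x) by rewrite sqrtr_gt0 lt_def q0 quad_ge0.
  have yP : quad q (emb (Num.sqrt (quad q x))^-1 *: x) <= 1.
    rewrite quadZ// sabs_emb gtr0_norm ?invr_gt0// exprVn sqr_sqrtr ?quad_ge0//.
    by rewrite mulVf.
  have := sup_norm_ub (h x) (exist (fun y => quad q y <= 1) _ yP).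
  rewrite /= innerZr// conj_emb innerE// -embM sabs_emb.
  rewrite -{2}[quad q x]sqr_sqrtr ?quad_ge0// expr2 mulKf ?gt_eqF//.
  by rewrite ger0_norm ?sqrtr_ge0.
exists (sub_space (range_closure h_lin)), (range_point h_lin); split.
- exact: (range_closure_hilbert hq h_lin h_norm).
- exact: range_point_linear.
- by move=> x; rewrite -h_norm.
- move=> Y L C C0 L_lin LC.
  have [W [WC WL]] := range_extension h_lin L_lin LC C0.
  by exists W.
Qed.

End HilbertSpaces.

(** * 2-summing operators factor through Hilbert spaces *)

Section TwoSumming.
Variables (R : realType) (k : scalar_kind).
Local Notation K := (scalar_field R k).
Local Notation conj := (@scalar_conj R k).
Local Notation S := (scalar_space R k).

Lemma re_imag_conj (z : K) : re (imag * (conj z + z)) = 0.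
Proof.
rewrite /re /imag /scalar_conj; move: z; case: k => /= [z|[a b]] /=.
  by rewrite mul0r.
by ring.
Qed.

Lemma functionalP (X : normedModType K) (f : operator X S) (a : K) x y :
  f (a *: x + y) = a * f x + f y :> K.
Proof. exact: linearP. Qed.

Lemma functionalZ (X : normedModType K) (f : operator X S) (a : K) x :
  f (a *: x) = a * f x :> K.
Proof. exact: linearZ. Qed.

Definition dual_ball (X : normedModType K) := {f : operator X S | opnorm f <= 1}.

Lemma dual_ball0 (X : normedModType K) : dual_ball X.
Proof.
exists 0; apply: opnorm_le => x _.
by rewrite [X in rnorm X](_ : _ = 0 :> S)// rnorm0.
Qed.

Lemma dual_ball_le (X : normedModType K) (f : dual_ball X) x : sabs (sval f x) <= rnorm x.
Proof.
apply: le_trans (le_opnorm _ _) _.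
by rewrite ler_piMl ?rnorm_ge0// (svalP f).
Qed.

(** The 2-summing norm of [T] is at most [t]. The weak square sum enters
    through its upper bounds [c], which covers [t = 0] as well. *)
Definition two_summing (X Y : normedModType K) (T : operator X Y) (t : R) : Prop :=
  forall (s : seq X) (c : R),
    (forall f : dual_ball X, t ^+ 2 * \sum_(x <- s) sabs (sval f x) ^+ 2 <= c) ->
  \sum_(x <- s) rnorm (T x) ^+ 2 <= c.

Section Domination.
Variables (X Y : normedModType K) (T : operator X Y) (t : R).
Hypothesis T2 : two_summing T t.
Local Notation W := (bfun_space R k (dual_ball X)).

(** The values whose infimum is a sublinear functional; any linear functional
    below it is positive and dominates [T], as in Pietsch's theorem. *)
Let bounds (f : W) : set R := [set r | exists (s : seq X) (c : R),
  (forall b, re (f b) + t ^+ 2 * \sum_(x <- s) sabs (sval b x) ^+ 2 <= c) /\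
  r = c - \sum_(x <- s) rnorm (T x) ^+ 2].

Let bounds_inf f : has_inf (bounds f).
Proof.
split.
  exists (rnorm f - 0), [::], (rnorm f); rewrite !big_nil; split=> // b.
  by rewrite big_nil mulr0 addr0 (le_trans (re_ler _))// rnorm_bfun_ub.
exists (- rnorm f) => _ [s [c [sc ->]]].
rewrite lerBrDr addrC -lerBrDr opprK; apply: T2 => b.
have := sc b; have := re_le_sabs (f b); have := rnorm_bfun_ub f b.
rewrite ler_norml => h1 /andP[h2 _] h3; lra.
Qed.

(** A finitely additive version of Pietsch's measure on the dual ball. *)
Let pietsch_functional : exists mu : W -> R,
  [/\ forall f g, mu (f + g) = mu f + mu g,
      forall r f, mu (emb r *: f) = r * mu f,
      forall (f : W) (c : R), (forall b, re (f b) <= c) -> mu f <= c &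
      forall x (f : W), (forall b, re (f b) = - (t ^+ 2 * sabs (sval b x) ^+ 2)) ->
        mu f <= - rnorm (T x) ^+ 2].
Proof.
have sp : sublinear (fun f => inf (bounds f)).
  apply: inf_sublinear => [f|f g _ _ [s [c [sc ->]]] [s' [c' [sc' ->]]]|
      r f _ r0 [s [c [sc ->]]]].
  - exact: bounds_inf.
  - exists (c + c' - \sum_(x <- s ++ s') rnorm (T x) ^+ 2).
      exists (s ++ s'), (c + c'); split=> // b.
      by rewrite big_cat bfunD reD /=; have := sc b; have := sc' b; lra.
    by rewrite big_cat /=; lra.
  - exists [seq emb (Num.sqrt r) *: x | x <- s], (r * c).
    have sr (z : R) : (Num.sqrt r * z) ^+ 2 = r * z ^+ 2.
      by rewrite exprMn sqr_sqrtr// ltW.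
    split=> [b|].
      rewrite big_map bfunZ re_embM; under eq_bigr => x _.
        rewrite functionalZ sabsM sabs_emb ger0_norm ?sqrtr_ge0// sr; over.
      by rewrite -mulr_sumr mulrCA -mulrDr ler_pM2l.
    rewrite big_map mulrBr mulr_sumr; congr (_ - _); apply: eq_bigr => x _.
    by rewrite linearZ rnormZ -/(sabs _) sabs_emb ger0_norm ?sqrtr_ge0// sr.
have [mu [muD muZ mup]] := hahn_banach sp.
have mub f r : bounds f r -> mu f <= r.
  by move=> fr; apply: le_trans (mup f) _; apply: ge_inf => //; exact: (bounds_inf f).2.
exists mu; split=> // [f c fc|x f fx]; apply: mub.
  exists [::], c; rewrite !big_nil subr0; split=> // b.
  by rewrite big_nil mulr0 addr0.
exists [:: x], 0; rewrite big_seq1 sub0r; split=> // b.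
by rewrite big_seq1 fx addNr.
Qed.

(** The form is the integral of [f x] times the conjugate of [f y] over the
    dual ball, with respect to [mu]. *)
Lemma pietsch_domination : exists q : X -> X -> K, semi_inner q /\
  forall x, rnorm (T x) ^+ 2 <= t ^+ 2 * quad q x /\ quad q x <= rnorm x ^+ 2.
Proof.
have [mu [muD muZ muc muT]] := pietsch_functional.
have mu0 : mu 0 = 0 by have := muZ 0 0; rewrite scaler0 mul0r.
have muN f : mu (- f) = - mu f by apply/eqP; rewrite -addr_eq0 -muD addNr mu0.
have mu_re0 (f : W) : (forall b, re (f b) = 0) -> mu f = 0.
  move=> f0; apply/eqP; rewrite eq_le muc ?f0// => [|b]; last by rewrite f0.
  by rewrite -oppr_le0 -muN muc// => b; rewrite bfunN reN f0 oppr0.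
have gP x y : (fun b : dual_ball X => (sval b x : K) * conj (sval b y) : S)
    \in @is_bounded R k (dual_ball X).
  apply/asboolP; exists (rnorm x * rnorm y) => b; rewrite sabsM sabs_conj.
  by rewrite ler_pM ?sabs_ge0 ?dual_ball_le.
pose g x y : W := BoundedFun (gP x y).
have gxx x b : re (g x x b) = sabs (sval b x) ^+ 2.
  by rewrite [g x x b]mul_conj embK.
pose q x y : K := complexify mu (g x y).
have qx x : quad q x = mu (g x x) by rewrite /quad re_complexify.
have glin a x y z : g (a *: x + y) z = a *: g x z + g y z.
  apply: bfun_eq => b; rewrite bfunD bfunZ /= functionalP.
  by rewrite mulrDl mulrA.
exists q; split.
  split=> [a x y z|x y|x]; first by rewrite /q glin complexify_linear.
    have gC b : g x y b = conj (g y x b) by rewrite /= conjM scalar_conjK mulrC.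
    rewrite /q /complexify conjB conjM !conj_emb conj_imag mulNr opprK.
    have -> : mu (g x y) = mu (g y x).
      apply/eqP; rewrite -subr_eq0 -muN -muD; apply/eqP/mu_re0 => b.
      by rewrite bfunD bfunN gC reB re_conj subrr.
    suff -> : mu (imag *: g x y) = - mu (imag *: g y x) by rewrite embN mulrN opprK.
    apply/eqP; rewrite -addr_eq0 -muD; apply/eqP/mu_re0 => b.
    by rewrite bfunD !bfunZ gC -mulrDr re_imag_conj.
  rewrite -/(quad q x) qx -oppr_le0 -muN muc// => b.
  by rewrite bfunN reN gxx oppr_le0 sqr_ge0.
move=> x; rewrite qx; split.
  rewrite -lerN2.
  rewrite -(muZ (t ^+ 2)) -muN; apply: muT => b.
  by rewrite bfunN bfunZ reN re_embM gxx.
by apply: muc => b; rewrite gxx lerXn2r ?nnegrE ?sabs_ge0 ?rnorm_ge0 ?dual_ball_le.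
Qed.

End Domination.

(** The Hilbert space is the completion of [X] for the dominating form. *)
Lemma two_summing_hilbert (X Y : completeNormedModType K) (T : operator X Y) (t : R) :
  0 <= t -> two_summing T t ->
  component (hilbert_class R k) T /\ qnorm (hilbert_class R k) T <= t.
Proof.
move=> t0 T2; have [q [hq qT]] := pietsch_domination T2.
have [H [i [hH i_lin iq iE]]] := hilbert_completion hq.
have sq (a b : R) : 0 <= a -> 0 <= b -> a ^+ 2 <= b ^+ 2 -> a <= b.
  by move=> a0 b0; rewrite ler_sqr.
have i_le x : rnorm (i x) <= rnorm x.
  by apply: sq; rewrite ?rnorm_ge0// iq; exact: (qT x).2.
have [|x|V Vt VT] := iE Y T t t0.
- exact: (opP T).1.
- apply: sq; rewrite ?mulr_ge0 ?rnorm_ge0// exprMn iq; exact: (qT x).1.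
have iP : i \in @is_op R k X H.
  by apply/asboolP; split=> //; exists 1 => x; rewrite mul1r.
have TE : T = comp_op V (Op iP) by apply: op_eq => x; rewrite /= VT.
have i1 : opnorm (Op iP) <= 1.
  by apply: opnorm_le => x x1; apply: le_trans (i_le x) x1.
split; first by exists H, V, (Op iP).
apply: le_trans (_ : opnorm V * opnorm (Op iP) <= t); last first.
  by rewrite -[t]mulr1 ler_pM ?opnorm_ge0.
apply: ge_inf; first by exists 0 => _ [H' [V' [S' [_ _ ->]]]]; rewrite mulr_ge0 ?rnorm_ge0.
by exists H, V, (Op iP); rewrite !rnorm_op.
Qed.

End TwoSumming.

(** * Products with the ideal of Hilbert operators *)

Section EuclideanForm.
Variables (R : realType) (k : scalar_kind).
Local Notation K := (scalar_field R k).
Local Notation conj := (@scalar_conj R k).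
Local Notation S := (scalar_space R k).

Section Form.
Variable I : finType.

Definition euclid (x y : I -> S) : K := \sum_i (x i : K) * conj (y i).

Lemma euclid_semi_inner : semi_inner euclid.
Proof.
split=> [a x y z|x y|x].
- rewrite /euclid mulr_sumr -big_split/=; apply: eq_bigr => i _.
  by rewrite [(_ + _) i](_ : _ = a * x i + y i)// mulrDl mulrA.
- by rewrite /euclid conj_sum; apply: eq_bigr => i _; rewrite conjM scalar_conjK mulrC.
- rewrite /euclid re_sum; apply: sumr_ge0 => i _.
  by rewrite mul_conj embK sqr_ge0.
Qed.

Lemma quad_euclid (x : I -> S) : quad euclid x = \sum_i sabs (x i) ^+ 2.
Proof. by rewrite /quad /euclid re_sum; apply: eq_bigr => i _; rewrite mul_conj embK. Qed.

Lemma sum_cauchy_schwarz (a b : I -> K) :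
  sabs (\sum_i a i * b i) ^+ 2 <=
  (\sum_i sabs (a i) ^+ 2) * (\sum_i sabs (b i) ^+ 2).
Proof.
have := cauchy_schwarz euclid_semi_inner (a : I -> S) (fun i => conj (b i) : S).
have -> : euclid (a : I -> S) (fun i => conj (b i) : S) = \sum_i a i * b i.
  by apply: eq_bigr => i _; rewrite scalar_conjK.
rewrite !quad_euclid => /le_trans; apply; rewrite ler_wpM2l//.
  by apply: sumr_ge0 => i _; exact: sqr_ge0.
by apply: ler_sum => i _; rewrite sabs_conj.
Qed.

End Form.

Lemma scalar_hilbert : is_hilbert S.
Proof.
apply: (@semi_inner_hilbert _ _ S (fun x y => (x : K) * conj y)).
  split=> [a x y z|x y|x].
  - by rewrite [a *: x + y](_ : _ = (a * x : K) + y)// mulrDl mulrA.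
  - by rewrite conjM scalar_conjK mulrC.
  - by rewrite mul_conj embK sqr_ge0.
by move=> x; rewrite mul_conj expr2 embM expr2 !sabsE.
Qed.

End EuclideanForm.

Section ProductIdeal.
Variables (R : realType) (k : scalar_kind).
Local Notation K := (scalar_field R k).
Local Notation S := (scalar_space R k).
Local Notation banach := (completeNormedModType K).

Lemma opZ (X Y : normedModType K) (T : operator X Y) (c : K) x : T (c *: x) = c *: T x.
Proof. exact: linearZ. Qed.

Lemma opnorm_id (X : normedModType K) : opnorm (id_op X) <= 1.
Proof. exact: opnorm_le. Qed.

Section Vector.
Variables (Y : normedModType K) (y : Y).

Lemma vector_op_subproof : (fun c : S => (c : K) *: y) \in @is_op R k S Y.
Proof.
apply/asboolP; split=> [a b c|].
  by rewrite scalerA -scalerDl.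
by exists (rnorm y) => c; rewrite rnormZ mulrC.
Qed.

Definition vector_op : operator S Y := Op vector_op_subproof.

Lemma opnorm_vector : opnorm vector_op <= rnorm y.
Proof.
apply: opnorm_le => c c1 /=; rewrite rnormZ.
by rewrite ler_piMl ?rnorm_ge0.
Qed.

End Vector.

Definition rank_one (X Y : normedModType K) (a : operator X S) (y : Y) : operator X Y :=
  comp_op (vector_op y) a.

Lemma sum_opE (X Y : normedModType K) I (r : seq I) (F : I -> operator X Y) x :
  (\sum_(i <- r) F i) x = \sum_(i <- r) F i x.
Proof.
elim: r => [|i r IH]; first by rewrite !big_nil.
by rewrite !big_cons -IH.
Qed.

Variable A : operator_class R k.
Hypothesis hA : quasi_banach_ideal A.

Local Notation L2 := (hilbert_class R k).
Local Notation L2A := (product_class L2 A).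

Lemma ideal_compl (X Y Z : banach) (V : operator Y Z) (U : operator X Y) :
  component A U -> component A (comp_op V U) /\
  qnorm A (comp_op V U) <= opnorm V * qnorm A U.
Proof.
move=> AU; have [h1 h2] := ideal_comp hA V (id_op X) AU.
have E : comp_op V (comp_op U (id_op X)) = comp_op V U by exact: op_eq.
rewrite E in h1 h2; split=> //; apply: le_trans h2 _; rewrite !rnorm_op.
rewrite ler_piMr ?opnorm_id// mulr_ge0 ?opnorm_ge0//; exact: (ideal_qnorm_ge0 hA).
Qed.

Lemma ideal_compr (X Y Z : banach) (V : operator Y Z) (U : operator X Y) :
  component A V -> component A (comp_op V U) /\
  qnorm A (comp_op V U) <= qnorm A V * opnorm U.
Proof.
move=> AV; have [h1 h2] := ideal_comp hA (id_op Z) U AV.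
have E : comp_op (id_op Z) (comp_op V U) = comp_op V U by exact: op_eq.
rewrite E in h1 h2; split=> //; apply: le_trans h2 _; rewrite !rnorm_op.
rewrite ler_wpM2r ?opnorm_ge0// ler_piMl ?opnorm_id//; exact: (ideal_qnorm_ge0 hA).
Qed.

Lemma functional_ideal (X : banach) (a : operator X S) :
  component A a /\ qnorm A a <= opnorm a.
Proof.
have [] := ideal_compr a (ideal_id hA).
have -> : comp_op (id_op S) a = a by exact: op_eq.
by rewrite (ideal_id_qnorm hA) mul1r.
Qed.

Lemma rank_one_ideal (X Y : banach) (a : operator X S) (y : Y) : component A (rank_one a y).
Proof. exact: (ideal_compl _ (functional_ideal a).1).1. Qed.

Lemma ideal0 (X Y : banach) : component A (0 : operator X Y).
Proof.
have := (rank_one_ideal (0 : operator X S) (0 : Y)).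
by have -> : rank_one (0 : operator X S) (0 : Y) = 0 by apply: op_eq => x; rewrite /= scaler0.
Qed.

Lemma ideal_sum (X Y : banach) I (r : seq I) (F : I -> operator X Y) :
  (forall i, component A (F i)) -> component A (\sum_(i <- r) F i).
Proof.
move=> AF; have [c _ hc] := ideal_add hA.
elim: r => [|i r IH]; first by rewrite big_nil; exact: ideal0.
by rewrite big_cons; exact: (hc _ _ _ _ (AF i) IH).1.
Qed.

Lemma hilbert_values_ge0 (X Y : banach) (T : operator X Y) :
  has_lbound [set r | exists (H : banach) (V : operator H Y) (U : operator X H),
    [/\ is_hilbert H, T = comp_op V U & r = rnorm V * rnorm U]].
Proof.
by exists 0 => _ [H [V [U [_ _ ->]]]]; rewrite mulr_ge0 ?rnorm_ge0.
Qed.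

Lemma hilbert_qnorm_ge0 (X Y : banach) (T : operator X Y) :
  component L2 T -> 0 <= qnorm L2 T.
Proof.
move=> [H [V [U [hH TE]]]]; apply: lb_le_inf; first by exists (rnorm V * rnorm U), H, V, U.
by move=> _ [H' [V' [U' [_ _ ->]]]]; rewrite mulr_ge0 ?rnorm_ge0.
Qed.

Lemma hilbert_qnorm_le (X H Y : banach) (V : operator H Y) (U : operator X H) :
  is_hilbert H -> qnorm L2 (comp_op V U) <= opnorm V * opnorm U.
Proof.
move=> hH; apply: ge_inf; first exact: hilbert_values_ge0.
by exists H, V, U; rewrite !rnorm_op.
Qed.

Lemma product_values_ge0 (X Y : banach) (T : operator X Y) :
  has_lbound [set r | exists (Z : banach) (V : operator Z Y) (U : operator X Z),
    [/\ component L2 V, component A U, T = comp_op V U & r = qnorm L2 V * qnorm A U]].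
Proof.
exists 0 => _ [Z [V [U [LV AU _ ->]]]].
by rewrite mulr_ge0 ?hilbert_qnorm_ge0//; exact: (ideal_qnorm_ge0 hA).
Qed.

(** These are the typical members of the product, as the next lemma shows. *)
Lemma hilbert_product (X H Y : banach) (V : operator H Y) (U : operator X H) :
  is_hilbert H -> component A U ->
  component L2A (comp_op V U) /\ qnorm L2A (comp_op V U) <= opnorm V * qnorm A U.
Proof.
move=> hH AU.
have VE : comp_op V (id_op H) = V by exact: op_eq.
have LV : component L2 V by exists H, V, (id_op H).
split; first by exists H, V, U.
apply: le_trans (_ : qnorm L2 V * qnorm A U <= _).
  by apply: ge_inf; [exact: product_values_ge0|exists H, V, U].
rewrite ler_wpM2r//; first exact: (ideal_qnorm_ge0 hA).
rewrite -{1}VE (le_trans (hilbert_qnorm_le _ _ hH))//.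
by rewrite ler_piMr ?opnorm_ge0 ?opnorm_id.
Qed.

(** The first half of a factorization of the left factor through a Hilbert
    space can be absorbed in the right factor. *)
Lemma product_factor (X Y : banach) (T : operator X Y) (c : R) :
  component L2A T -> qnorm L2A T < c ->
  exists (H : banach) (V : operator H Y) (U : operator X H),
    [/\ is_hilbert H, component A U, T = comp_op V U & opnorm V * qnorm A U < c].
Proof.
move=> [Z0 [V0 [U0 [LV0 AU0 TE0]]]] Tc.
have hi : has_inf [set r | exists (Z : banach) (V : operator Z Y) (U : operator X Z),
    [/\ component L2 V, component A U, T = comp_op V U & r = qnorm L2 V * qnorm A U]].
  split; last exact: product_values_ge0.
  by exists (qnorm L2 V0 * qnorm A U0), Z0, V0, U0.
have d0 : 0 < c - qnorm L2A T by rewrite subr_gt0.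
have [_ [Z [V [U [LV AU TE ->]]]]] := inf_adherent d0 hi.
rewrite -[inf _]/(qnorm L2A T) addrCA subrr addr0 => VUc.
have a0 := ideal_qnorm_ge0 hA AU.
have h2 : has_inf [set r | exists (H : banach) (V' : operator H Y) (U' : operator Z H),
    [/\ is_hilbert H, V = comp_op V' U' & r = rnorm V' * rnorm U']].
  split; last exact: hilbert_values_ge0.
  by case: LV => H [V' [U' [hH E]]]; exists (rnorm V' * rnorm U'), H, V', U'.
have e0 : 0 < (c - qnorm L2 V * qnorm A U) / (qnorm A U + 1).
  by rewrite divr_gt0 ?subr_gt0// ltr_wpDl.
have [_ [H [V2 [V1 [hH VE ->]]]]] := inf_adherent e0 h2.
rewrite -[inf _]/(qnorm L2 V) !rnorm_op => V2V1.
have [AV1U qV1U] := ideal_compl V1 AU.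
exists H, V2, (comp_op V1 U); split=> //; first by rewrite TE VE; exact: op_eq.
apply: le_lt_trans (_ : opnorm V2 * (opnorm V1 * qnorm A U) < c).
  by rewrite ler_wpM2l ?opnorm_ge0.
rewrite mulrA; set e := (X in _ < _ + X) in V2V1.
have h3 : opnorm V2 * opnorm V1 * qnorm A U <= (qnorm L2 V + e) * qnorm A U.
  by rewrite ler_wpM2r// ltW.
apply: le_lt_trans h3 _.
have : e * (qnorm A U + 1) = c - qnorm L2 V * qnorm A U.
  by rewrite /e divfK// gt_eqF// ltr_wpDl.
rewrite -/e in e0; rewrite mulrDr mulr1 mulrDl; lra.
Qed.

(** Hence the adjoint norm of the product is a supremum over fewer operators
    than the one of [A]. *)
Lemma product_le (X Y : banach) (T : operator X Y) :
  component L2A T -> component A T /\ qnorm A T <= qnorm L2A T.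
Proof.
move=> LT; split.
  by case: LT => Z [V [U [_ AU ->]]]; exact: (ideal_compl V AU).1.
apply/ler_addgt0Pr => e e0.
have [|H [V [U [_ AU -> VU]]]] := product_factor (c := qnorm L2A T + e) LT.
  by rewrite ltrDl.
exact: le_trans (ideal_compl V AU).2 (ltW VU).
Qed.

Section FiniteSums.
Variables (X Y : banach) (a : nat -> operator X S) (y : nat -> Y).

(** The sums factor through the Euclidean space of dimension [n]. *)
Lemma sum_rank_one_product n : component L2A (\sum_(i < n) rank_one (a i) (y i)).
Proof.
have [H [i [hH i_lin iq iE]]] := hilbert_completion (euclid_semi_inner R k 'I_n).
pose L (x : 'I_n -> S) := \sum_(j < n) (x j : K) *: y j.
pose C := \sum_(j < n) rnorm (y j).
have [||x|V _ VL] := iE Y L C.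
- by apply: sumr_ge0 => j _; exact: rnorm_ge0.
- move=> b x z; rewrite /L scaler_sumr -big_split/=; apply: eq_bigr => j _.
  by rewrite scalerA -scalerDl.
- rewrite /L /C mulr_suml; elim/big_ind2 : _ => [|u v u' v' uv u'v'|j _].
  + by rewrite rnorm0.
  + by apply: le_trans (rnormD _ _) _; rewrite lerD.
  + rewrite rnormZ mulrC ler_wpM2l ?rnorm_ge0// -/(sabs _).
    have : sabs (x j) ^+ 2 <= rnorm (i x) ^+ 2.
      rewrite iq quad_euclid (bigD1 j)//= lerDl.
      by apply: sumr_ge0 => l _; exact: sqr_ge0.
    by rewrite ler_sqr ?nnegrE ?sabs_ge0 ?rnorm_ge0.
pose u (j : 'I_n) : 'I_n -> S := fun l => if l == j then 1 : K else 0.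
have -> : \sum_(j < n) rank_one (a j) (y j) =
    comp_op V (\sum_(j < n) rank_one (a j) (i (u j))).
  apply: op_eq => x; rewrite sum_opE /= sum_opE linear_sum; apply: eq_bigr => j _ /=.
  rewrite opZ VL /L (bigD1 j)//= big1 ?addr0 => [|l lj].
    by rewrite /u eqxx scale1r.
  by rewrite /u (negbTE lj) scale0r.
apply: (hilbert_product V hH _).1; apply: ideal_sum => j; exact: rank_one_ideal.
Qed.

(** The triangle inequality of the product norm is a strong requirement: the
    factorization through the Euclidean space only gives a bound that grows
    faster with [n]. *)
Lemma sum_rank_one_qnorm n : normed_class L2A ->
  qnorm L2A (\sum_(i < n) rank_one (a i) (y i)) <= \sum_(i < n) opnorm (a i) * rnorm (y i).
Proof.
move=> nL; have [nD nZ _] := nL X Y; elim: n => [|n IH].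
  have := sum_rank_one_product 0; rewrite !big_ord0 => L0.
  by have := nZ 0 _ L0; rewrite scale0r normr0 re0 mul0r => ->.
have Ln := sum_rank_one_product n.
have [L1 q1] := hilbert_product (vector_op (y n)) (scalar_hilbert R k) (functional_ideal (a n)).1.
rewrite !big_ord_recr/=; apply: le_trans (nD _ _ Ln L1) _.
rewrite lerD//; apply: le_trans q1 _; rewrite mulrC ler_pM ?opnorm_ge0//.
- exact: (ideal_qnorm_ge0 hA (functional_ideal _).1).
- exact: (functional_ideal _).2.
- exact: opnorm_vector.
Qed.

End FiniteSums.
End ProductIdeal.

(** * Signs and orthonormalization *)

Section Signs.
Variables (R : realType) (k : scalar_kind) (m : nat).
Local Notation K := (scalar_field R k).
Definition signs := {ffun 'I_m -> bool}.
Implicit Types (th : signs) (i j : 'I_m).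

Definition sgn th i : K := (-1) ^+ th i.

Lemma sgn_sqr th i : sgn th i * sgn th i = 1.
Proof. by rewrite /sgn -signr_addb addbb. Qed.

Lemma sabs_sgn th i : sabs (sgn th i) = 1.
Proof. by rewrite /sgn; case: (th i); rewrite ?expr1 ?sabsN sabs1. Qed.

(** Flipping the sign at [i] changes the sign of every term when [i != j]. *)
Lemma sgn_orthogonal i j :
  \sum_(th : signs) sgn th i * sgn th j = (#|{: signs}| * (i == j))%:R.
Proof.
have [<-|ij] := eqVneq i j.
  by rewrite (eq_bigr (fun=> 1)) ?sumr_const ?muln1// => th _; rewrite sgn_sqr.
rewrite muln0; set s := \sum_th _.
pose flip th : signs := [ffun l => (l == i) (+) th l].
have flipK : involutive flip.
  by move=> th; apply/ffunP => l; rewrite !ffunE addbA addbb.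
have : s = - s.
  rewrite {1}/s (reindex_inj (inv_inj flipK))/= -sumrN; apply: eq_bigr => th _.
  rewrite /sgn !ffunE eqxx eq_sym (negbTE ij) signr_addb expr1.
  by rewrite !mulN1r mulNr.
move/eqP; rewrite -subr_eq0 opprK -mulr2n mulrn_eq0 /=.
by move/eqP.
Qed.

Let N_gt0 : 0 < #|{: signs}|%:R :> R.
Proof. by rewrite ltr0n; apply/card_gt0P; exists [ffun=> true]. Qed.

(** Averaging over signs extracts the diagonal of a matrix. *)
Lemma sign_average_diag (b : 'I_m -> 'I_m -> K) (M : R) :
  (forall th : signs, sabs (\sum_i \sum_j sgn th i * sgn th j * b i j) <= M) ->
  sabs (\sum_i b i i) <= M.
Proof.
move=> h; rewrite -(ler_pM2l N_gt0).
have E : \sum_th \sum_i \sum_j sgn th i * sgn th j * b i j =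
    #|{: signs}|%:R * \sum_i b i i.
  rewrite exchange_big mulr_sumr; apply: eq_bigr => i _.
  rewrite exchange_big/= (bigD1 i)//= -mulr_suml sgn_orthogonal eqxx muln1 big1 ?addr0// => j ji.
  by rewrite -mulr_suml sgn_orthogonal eq_sym (negbTE ji) muln0 mul0r.
rewrite -(sabs_nat R k) -sabsM -E.
apply: le_trans (sabs_sum _ _ _) _; rewrite sabs_nat mulr_natl -sumr_const.
by apply: ler_sum.
Qed.

(** Cauchy-Schwarz, as the signs have modulus 1. *)
Lemma sign_coefficient_le (phi : signs -> K) i :
  #|{: signs}|%:R * sabs (#|{: signs}|%:R^-1 * \sum_th sgn th i * phi th) ^+ 2 <=
  \sum_th sabs (phi th) ^+ 2.
Proof.
have N0 := N_gt0; have Nn : #|{: signs}|%:R != 0 :> R by rewrite gt_eqF.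
have h := sum_cauchy_schwarz (fun th => sgn th i) phi.
have E : \sum_(th : signs) sabs (sgn th i) ^+ 2 = #|{: signs}|%:R.
  by rewrite -sumr_const; apply: eq_bigr => th _; rewrite sabs_sgn expr1n.
rewrite E in h.
rewrite -(ler_pM2l N0); apply: le_trans h.
rewrite sabsM exprMn sabsV sabs_nat.
by rewrite exprVn !mulrA -expr2 divff ?mul1r ?expf_neq0.
Qed.

End Signs.

Section GramSchmidt.
Variables (R : realType) (k : scalar_kind).
Local Notation K := (scalar_field R k).
Variables (H : lmodType K) (q : H -> H -> K).
Hypotheses (hq : semi_inner q) (q_def : forall x, quad q x = 0 -> x = 0).

Lemma inner_delta m (e : 'I_m -> H) (a : 'I_m -> K) (l : 'I_m) :
  (forall i j, q (e i) (e j) = (i == j)%:R) -> q (\sum_i a i *: e i) (e l) = a l.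
Proof.
move=> eE; rewrite inner_suml// (bigD1 l)//= innerZl// eE eqxx mulr1 big1 ?addr0// => i il.
by rewrite innerZl// eE (negbTE il) mulr0.
Qed.

(** Bessel's inequality, tested on the vector of the span of the [e i] that
    represents [phi] there; no representing vector in [H] is involved. *)
Lemma bessel_dual m (e : 'I_m -> H) (phi : H -> K) (c : R) : 0 <= c ->
  (forall i j, q (e i) (e j) = (i == j)%:R) ->
  (forall a x y, phi (a *: x + y) = a * phi x + phi y) ->
  (forall x, sabs (phi x) ^+ 2 <= c * quad q x) ->
  \sum_i sabs (phi (e i)) ^+ 2 <= c.
Proof.
move=> c0 eE phiP phic; set s := \sum_i _.
have s0 : 0 <= s by apply: sumr_ge0 => i _; exact: sqr_ge0.
have phi0 : phi 0 = 0.
  by have := phiP 1 0 0; rewrite scaler0 addr0 mul1r => /eqP; rewrite -subr_eq0 opprD addNKr oppr_eq0 => /eqP.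
pose x := \sum_i scalar_conj (phi (e i)) *: e i.
have phix : phi x = emb s.
  have -> : phi x = \sum_i scalar_conj (phi (e i)) * phi (e i).
    apply: (big_rec2 (fun a b => phi a = b)) => // i a b _ ab.
    by rewrite phiP ab.
  by rewrite emb_sum; apply: eq_bigr => i _; rewrite mulrC mul_conj.
have qx : quad q x = s.
  rewrite /quad {2}/x inner_sumr// -[RHS](embK k); congr re.
  rewrite emb_sum; apply: eq_bigr => i _.
  by rewrite innerZr// inner_delta// scalar_conjK mul_conj.
have := phic x; rewrite phix qx sabs_emb ger0_norm// expr2.
by have [->//|s1] := eqVneq s 0; rewrite ler_pM2r// lt_def s1.
Qed.

Section Biorthogonal.
Variables (M : nat) (u : nat -> H) (psi : nat -> H -> K).
Hypotheses (psiP : forall i a x y, psi i (a *: x + y) = a * psi i x + psi i y)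
  (psi_u : forall i j, (i < M)%N -> (j < M)%N -> psi i (u j) = (i == j)%:R).

Let psi0 i : psi i 0 = 0.
Proof.
have := psiP i 1 0 0; rewrite scaler0 addr0 mul1r => /eqP.
by rewrite -subr_eq0 opprD addNKr oppr_eq0 => /eqP.
Qed.

(** The coefficients [d i] are the distances of [u i] to the span of its
    predecessors; the dual functional [psi i], which vanishes on the
    predecessors, takes the reciprocal value at the normalized difference. *)
Lemma gram_schmidt_dual m : (m <= M)%N -> exists (e : nat -> H) (d : nat -> R),
  [/\ forall i j, (i < m)%N -> (j < m)%N -> q (e i) (e j) = (i == j)%:R,
      forall i, (i < m)%N ->
        [/\ 0 < d i, q (u i) (e i) = emb (d i) & psi i (e i) = emb (d i)^-1] &
      forall i j, (m <= i)%N -> (i < M)%N -> (j < m)%N -> psi i (e j) = 0].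
Proof.
elim: m => [_|m IH mM]; first by exists (fun=> 0), (fun=> 0).
have [e [d [eE dE psie]]] := IH (ltnW mM).
pose w := u m - \sum_(j < m) q (u m) (e j) *: e j.
have psiw i : (m <= i)%N -> (i < M)%N -> psi i w = (i == m)%:R.
  move=> mi iM; have -> : w = (-1) *: (\sum_(j < m) q (u m) (e j) *: e j) + u m.
    by rewrite scaleN1r addrC.
  rewrite psiP psi_u// [psi i _](_ : _ = 0) ?mulr0 ?add0r//.
  apply: (big_rec (fun a => psi i a = 0)) => // j a _ a0.
  by rewrite psiP a0 psie// mulr0 addr0.
have we j : (j < m)%N -> q w (e j) = 0.
  move=> jm; rewrite innerBl// (@inner_delta m (fun j => e j) _ (Ordinal jm))/= ?subrr//.
  by move=> i i'; rewrite eE.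
have w0 : quad q w != 0.
  apply/eqP => /q_def w0; have := psiw m (leqnn m) mM.
  by rewrite w0 psi0 eqxx => /eqP; rewrite eq_sym oner_eq0.
have s0 : 0 < Num.sqrt (quad q w) by rewrite sqrtr_gt0 lt_def w0 quad_ge0.
pose em := emb (Num.sqrt (quad q w))^-1 *: w.
have emem : q em em = 1.
  rewrite /em innerZl// innerZr// innerE// conj_emb -!embM -(emb1 R k); congr emb.
  rewrite -{3}[quad q w]sqr_sqrtr ?quad_ge0// expr2 mulKf ?mulVf//; exact: lt0r_neq0.
have eme j : (j < m)%N -> q em (e j) = 0 by move=> jm; rewrite innerZl// we// mulr0.
have uem : q (u m) em = emb (Num.sqrt (quad q w)).
  have -> : u m = w + \sum_(j < m) q (u m) (e j) *: e j by rewrite subrK.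
  rewrite innerDl// inner_suml// big1 ?addr0 => [|j _]; last first.
    by rewrite innerZl// [q (e j) em]inner_sym// eme// conj0 mulr0.
  rewrite innerZr// innerE// conj_emb -embM; congr emb.
  by rewrite -{2}[quad q w]sqr_sqrtr ?quad_ge0// expr2 mulKf//; exact: lt0r_neq0.
have psiem i : (m <= i)%N -> (i < M)%N ->
    psi i em = emb (Num.sqrt (quad q w))^-1 * (i == m)%:R.
  by move=> mi iM; rewrite -[em]addr0 psiP psi0 addr0 psiw.
exists (fun j => if j == m then em else e j),
  (fun j => if j == m then Num.sqrt (quad q w) else d j); split.
- move=> i j; rewrite ltnS leq_eqVlt => /predU1P im; rewrite ltnS leq_eqVlt => /predU1P jm.
  case: im jm => [->|ilt] [->|jlt]; rewrite ?eqxx ?(ltn_eqF ilt) ?(ltn_eqF jlt).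
  + by rewrite emem.
  + by rewrite eme// eq_sym (ltn_eqF jlt).
  + by rewrite inner_sym// eme// conj0.
  + exact: eE.
- move=> i; rewrite ltnS leq_eqVlt; have [-> _|im /= ilt] := eqVneq i m.
    by split=> //; rewrite psiem// eqxx mulr1.
  exact: dE.
- move=> i j mi iM; rewrite ltnS leq_eqVlt; have [-> _|jm /= jlt] := eqVneq j m.
    by rewrite psiem// ?(ltnW mi)// gtn_eqF// mulr0.
  by rewrite psie// ltnW.
Qed.

End Biorthogonal.

End GramSchmidt.

(** * Factorizations forced by the triangle inequality *)

Section HilbertFactor.
Variables (R : realType) (k : scalar_kind).
Local Notation K := (scalar_field R k).
Local Notation S := (scalar_space R k).

Section Evaluation.
Variables (B : Type) (b : B).

Lemma eval_op_subproof :
  (fun f : bfun_space R k B => f b) \in @is_op R k (bfun_space R k B) S.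
Proof.
apply/asboolP; split=> //; exists 1 => f; rewrite mul1r.
exact: rnorm_bfun_ub.
Qed.

Definition eval_op : operator (bfun_space R k B) S := Op eval_op_subproof.

Lemma opnorm_eval : opnorm eval_op <= 1.
Proof.
by apply: opnorm_le => f f1; apply: le_trans f1; exact: rnorm_bfun_ub.
Qed.

End Evaluation.

Lemma fin_bounded (I : finType) (f : I -> K) : (f : I -> S) \in @is_bounded R k I.
Proof.
apply/asboolP; exists (\sum_i sabs (f i)) => i.
by rewrite (bigD1 i)//= lerDl; apply: sumr_ge0 => j _; exact: sabs_ge0.
Qed.

Definition fin_fun (I : finType) (f : I -> K) : bfun_space R k I := BoundedFun (fin_bounded f).

Definition unit_fun (I : finType) (i : I) : bfun_space R k I := fin_fun (fun j => (j == i)%:R).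

Lemma fin_funE (I : finType) (f : bfun_space R k I) : f = \sum_i (f i : K) *: unit_fun i.
Proof.
apply: bfun_eq => j.
have -> : (\sum_i (f i : K) *: unit_fun i) j = \sum_i (f i : K) * (j == i)%:R.
  by apply: (big_rec2 (fun (g : bfun_space R k I) (a : K) => g j = a)) => // i g a _ <-.
rewrite (bigD1 j)//= eqxx mulr1 big1 ?addr0// => i; rewrite eq_sym => /negbTE->.
by rewrite mulr0.
Qed.

(** As a function of [d], the right-hand side is minimal at [d = s], where
    both sides agree. *)
Lemma tangent_le (d s : R) : 0 < d -> 0 <= s -> 3 / 2 * s <= d + s ^+ 3 / 2 * d^-1 ^+ 2.
Proof.
move=> d0 s0; rewrite -subr_ge0.
have -> : d + s ^+ 3 / 2 * d^-1 ^+ 2 - 3 / 2 * s = (d - s) ^+ 2 * (2 * d + s) / (2 * d ^+ 2).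
  by field; rewrite gt_eqF.
have d1 := ltW d0; apply: divr_ge0; last by rewrite mulr_ge0// sqr_ge0.
by rewrite mulr_ge0 ?sqr_ge0//; lra.
Qed.

(** The inequality between the power means of orders 1 and -2. *)
Lemma sum_ge_of_inv_squares (n : nat) (d : 'I_n.+1 -> R) (nu : R) : 0 < nu ->
  (forall i, 0 < d i) -> \sum_i (d i)^-1 ^+ 2 <= nu ^+ 2 ->
  n.+1%:R * (Num.sqrt n.+1%:R / nu) <= \sum_i d i.
Proof.
move=> nu0 d0 dnu; set s := _ / nu.
have s0 : 0 <= s by rewrite divr_ge0 ?sqrtr_ge0// ltW.
have snu : s ^+ 2 * nu ^+ 2 = n.+1%:R.
  by rewrite -exprMn divfK ?gt_eqF// sqr_sqrtr.
have h : \sum_(i < n.+1) (3 / 2 * s) <= \sum_i (d i + s ^+ 3 / 2 * (d i)^-1 ^+ 2).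
  by apply: ler_sum => i _; exact: tangent_le.
rewrite big_split/= sumr_const card_ord -mulr_sumr -[X in X <= _]mulr_natl in h.
have h2 : s ^+ 3 / 2 * \sum_i (d i)^-1 ^+ 2 <= s / 2 * n.+1%:R.
  rewrite -snu (_ : s / 2 * _ = s ^+ 3 / 2 * nu ^+ 2); last by ring.
  by rewrite ler_wpM2l// divr_ge0// exprn_ge0.
lra.
Qed.

Variable A : operator_class R k.
Hypotheses (hA : quasi_banach_ideal A)
  (nL : normed_class (product_class (hilbert_class R k) A)).

(** The sum of the rank one operators that send the unit vectors of the space
    of functions on ['I_m] to the coordinate functions on the set of signs has
    product norm at most [m], hence it is [V U] with [|V| A(U)] close to [m].
    Orthonormalize the images [u i] of the unit vectors. The coordinate
    functionals of the [u i] are averages over signs of functionals of norm at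
    most [|V|], and their values at the [e i] are the [1 / d i]; therefore the
    squares of these sum up to at most [|V|^2], and the power mean inequality
    turns this into a lower bound of the sum of the [d i]. *)
Lemma diagonal_factor (n : nat) (eps : R) : 0 < eps ->
  exists (H : completeNormedModType K) (ip : H -> H -> K)
    (U : operator (bfun_space R k 'I_n.+1) H) (e : 'I_n.+1 -> H) (d : 'I_n.+1 -> R),
  (is_hilbert H /\ semi_inner ip /\ (forall x, ip x x = emb (rnorm x ^+ 2))) /\
  [/\ component A U, forall i j, ip (e i) (e j) = (i == j)%:R,
      forall i, 0 < d i, forall i, ip (U (unit_fun i)) (e i) = emb (d i) &
      qnorm A U * Num.sqrt n.+1%:R <= (1 + eps) * \sum_i d i].
Proof.
move=> eps0; set m := n.+1.
have N0 : 0 < #|{: signs m}|%:R :> R.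
  by rewrite ltr0n; apply/card_gt0P; exists [ffun=> true].
pose z (j : nat) : bfun_space R k (signs m) := fin_fun (fun th => sgn R k th (inord j)).
pose a (j : nat) : operator (bfun_space R k 'I_m) S := eval_op (inord j : 'I_m).
have zn j : rnorm (z j) <= 1.
  by rewrite rnorm_bfun; apply: sup_norm_le => // th; rewrite /= sabs_sgn.
have qn : qnorm (product_class (hilbert_class R k) A) (\sum_(i < m) rank_one (a i) (z i))
    < m%:R * (1 + eps).
  apply: le_lt_trans (sum_rank_one_qnorm hA a z m nL) _.
  apply: (@le_lt_trans _ _ m%:R); last by rewrite ltr_pMr ?ltr0n// ltrDl.
  rewrite -[X in _ <= X%:R](card_ord m) -sumr_const; apply: ler_sum => i _.
  by rewrite mulr_ile1 ?opnorm_ge0 ?rnorm_ge0 ?opnorm_eval.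
have [H [V [U [hH AU VU VUq]]]] := product_factor hA (sum_rank_one_product hA a z m) qn.
have [ip hip ipn] := hilbert_semi_inner hH.
have quadE x : quad ip x = rnorm x ^+ 2 by rewrite /quad ipn embK.
have ip_def x : quad ip x = 0 -> x = 0.
  by rewrite quadE => /eqP; rewrite sqrf_eq0 => /eqP; exact: rnorm0_eq0.
pose u j := U (unit_fun (inord j : 'I_m)).
have Vu j : (j < m)%N -> V (u j) = z j.
  move=> jm; rewrite -[LHS]/(comp_op V U _) -VU sum_opE (bigD1 (Ordinal jm))//= big1.
    by rewrite eqxx scale1r addr0.
  move=> i ij; rewrite inord_val [_ == inord j](_ : _ = false) ?scale0r//.
  by apply/negbTE; apply: contra_neq ij => ->; apply: val_inj; rewrite /= inordK.
pose phi th x : K := V x th.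
have phiP th c x y : phi th (c *: x + y) = c * phi th x + phi th y.
  by rewrite /phi linearP.
have phi_le th x : sabs (phi th x) ^+ 2 <= opnorm V ^+ 2 * quad ip x.
  rewrite quadE -exprMn lerXn2r ?nnegrE ?sabs_ge0 ?mulr_ge0 ?opnorm_ge0 ?rnorm_ge0//.
  by apply: le_trans (rnorm_bfun_ub _ _) (le_opnorm _ _).
pose psi (i : nat) x : K :=
  #|{: signs m}|%:R^-1 * \sum_(th : signs m) sgn R k th (inord i) * phi th x.
have psiP i c x y : psi i (c *: x + y) = c * psi i x + psi i y.
  rewrite /psi mulrCA -mulrDr; congr (_ * _); rewrite mulr_sumr -big_split/=.
  by apply: eq_bigr => th _; rewrite phiP mulrDr mulrCA.
have psi_u i j : (i < m)%N -> (j < m)%N -> psi i (u j) = (i == j)%:R.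
  move=> im jm; rewrite /psi /phi Vu//= sgn_orthogonal -(inj_eq val_inj)/= !inordK//.
  rewrite natrM mulKf//; apply/eqP => N1; have := sabs_nat R k #|{: signs m}|.
  by rewrite N1 sabs0 => N2; move: N0; rewrite -N2 ltxx.
have [e [d [eE dE _]]] := gram_schmidt_dual hip ip_def psiP psi_u (leqnn m).
have eE' (i j : 'I_m) : ip (e i) (e j) = (i == j)%:R by rewrite eE.
exists H, ip, U, (fun i => e i), (fun i => d i); split; first by [].
have d0 (i : 'I_m) : 0 < d i by have [] := dE i (ltn_ord i).
have sumd : \sum_(i < m) (d i)^-1 ^+ 2 <= opnorm V ^+ 2.
  rewrite -(ler_pM2l N0) mulr_sumr.
  apply: (@le_trans _ _ (\sum_(i < m) \sum_(th : signs m) sabs (phi th (e i)) ^+ 2)).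
    apply: ler_sum => i _; have [di _ psie] := dE i (ltn_ord i).
    have := sign_coefficient_le (fun th => phi th (e i)) (inord i).
    by rewrite -/(psi i (e i)) psie sabs_emb gtr0_norm ?invr_gt0.
  rewrite exchange_big/= mulr_natl -sumr_const; apply: ler_sum => th _.
  by apply: (bessel_dual hip (sqr_ge0 _) eE' (phiP th)) => x; exact: phi_le.
have nu0 : 0 < opnorm V.
  rewrite lt_def opnorm_ge0 andbT; apply/eqP => V0; move: sumd; rewrite V0 expr0n/=.
  rewrite leNgt => /negP; apply; rewrite big_ord_recl ltr_pwDl ?exprn_gt0 ?invr_gt0//.
  by apply: sumr_ge0 => i _; exact: sqr_ge0.
split=> // [i|].
  by have [_ <- _] := dE i (ltn_ord i); rewrite /u inord_val.
have := sum_ge_of_inv_squares nu0 d0 sumd; rewrite -/m.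
set s := _ / opnorm V => sd.
have -> : qnorm A U * Num.sqrt m%:R = opnorm V * qnorm A U * s.
  by rewrite /s; field; rewrite gt_eqF.
have s0 : 0 <= s by rewrite divr_ge0 ?sqrtr_ge0 ?opnorm_ge0.
apply: le_trans (ler_wpM2r s0 (ltW VUq)) _.
have e1 : 0 <= 1 + eps by lra.
by rewrite mulrAC mulrC ler_wpM2l.
Qed.

End HilbertFactor.

(** * Traces, spans and joint kernels *)

Section TraceAndSubspaces.
Variables (R : realType) (k : scalar_kind).
Local Notation K := (scalar_field R k).
Local Notation S := (scalar_space R k).

Lemma op_sum (X Y : normedModType K) (T : operator X Y) I (r : seq I) (P : pred I)
    (F : I -> X) : T (\sum_(i <- r | P i) F i) = \sum_(i <- r | P i) T (F i).
Proof. exact: linear_sum. Qed.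

Section Trace.
Variable V : normedModType K.

Lemma functional_sum (f : operator V S) I (r : seq I) (P : pred I) (F : I -> V) :
  f (\sum_(i <- r | P i) F i) = \sum_(i <- r | P i) (f (F i) : K).
Proof. exact: linear_sum. Qed.

(** Independence of the representation, by induction on its length: either the
    last vector is a combination of the others, and its functional can be
    distributed over theirs, or its functional vanishes. *)
Lemma trace_of_zero n (a : 'I_n -> operator V S) (v : 'I_n -> V) :
  (forall x, \sum_(i < n) (a i x : K) *: v i = 0) -> \sum_(i < n) (a i (v i) : K) = 0.
Proof.
elim: n a v => [|n IH] a v av; first by rewrite big_ord0.
pose w i := widen_ord (leqnSn n) i.
have [[c vc]|nc] := pselect (exists c : 'I_n -> K, v ord_max = \sum_(i < n) c i *: v (w i)).
  have := IH (fun i => a (w i) + c i *: a ord_max) (fun i => v (w i)).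
  rewrite big_ord_recr/= => h; rewrite -[RHS]h => [|x].
    rewrite vc functional_sum -big_split/=; apply: eq_bigr => i _.
    by rewrite functionalZ.
  rewrite -[RHS](av x) big_ord_recr/= vc scaler_sumr -big_split/=.
  apply: eq_bigr => i _; rewrite -[(_ + _) x]/((a (w i) x : K) + c i * a ord_max x).
  by rewrite scalerDl scalerA [c i * _]mulrC.
have a0 x : a ord_max x = 0 :> K.
  apply: contrapT => /eqP ax; apply: nc.
  exists (fun i => - (a ord_max x : K)^-1 * a (w i) x).
  have := av x; rewrite big_ord_recr/= => /eqP; rewrite addrC addr_eq0 => /eqP h.
  apply: (scalerI ax); rewrite h scaler_sumr -sumrN; apply: eq_bigr => i _.
  by rewrite scalerA mulrA mulrN mulfV// mulN1r scaleNr.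
rewrite big_ord_recr/= a0 addr0; apply: IH => x.
by rewrite -[RHS](av x) big_ord_recr/= a0 scale0r addr0.
Qed.

Lemma trace_unique (U : operator V V) (t : K) : is_trace U t -> trace U = t.
Proof.
move=> Ut; rewrite /trace; have : is_trace U (xget 0 [set t | is_trace U t]).
  exact: (@xgetPex _ 0 [set t | is_trace U t] (ex_intro _ t Ut)).
move: (xget _ _) => t'; case: Ut => n [a [v [Ua ->]]] [n' [a' [v' [Ua' ->]]]].
pose b (i : 'I_(n' + n)) : operator V S :=
  match fintype.split i with inl j => a' j | inr j => - a j end.
pose w (i : 'I_(n' + n)) : V := match fintype.split i with inl j => v' j | inr j => v j end.
have bl j : b (lshift n j) = a' j by rewrite /b (unsplitK (inl j)).
have br j : b (rshift n' j) = - a j by rewrite /b (unsplitK (inr j)).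
have wl j : w (lshift n j) = v' j by rewrite /w (unsplitK (inl j)).
have wr j : w (rshift n' j) = v j by rewrite /w (unsplitK (inr j)).
have aN j x : (- a j) x = - (a j x : K) by [].
have := @trace_of_zero _ b w.
rewrite big_split_ord/=.
under eq_bigr => j _ do rewrite bl wl.
under [X in _ + X]eq_bigr => j _ do rewrite br wr aN.
rewrite sumrN => h; apply/eqP; rewrite -subr_eq0; apply/eqP/h => x.
rewrite big_split_ord/=.
under eq_bigr => j _ do rewrite bl wl.
under [X in _ + X]eq_bigr => j _ do rewrite br wr aN scaleNr.
by rewrite sumrN -Ua -Ua' subrr.
Qed.

End Trace.

Section Subspaces.
Variable V : normedModType K.

Section Span.
Variables (n : nat) (v : 'I_n -> V).

Let span_set := [set x | exists c : 'I_n -> K, x = \sum_(i < n) c i *: v i].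

Let span0 : span_set 0.
Proof. by exists (fun=> 0); rewrite big1// => i _; rewrite scale0r. Qed.

Let spanP (a : K) x y : span_set x -> span_set y -> span_set (a *: x + y).
Proof.
move=> [c ->] [d ->]; exists (fun i => a * c i + d i).
rewrite scaler_sumr -big_split/=; apply: eq_bigr => i _.
by rewrite scalerDl scalerA.
Qed.

Definition span_subspace : closed_subspace V :=
  ClosedSubspace span0 spanP (finite_span_closed (v := v)).

Lemma span_subspace_finite_dim : finite_dim (sub_space span_subspace).
Proof.
have vP i : v i \in in_subspace span_subspace.
  apply/asboolP; exists (fun j => (j == i)%:R); rewrite (bigD1 i)//= eqxx scale1r big1 ?addr0//.
  by move=> j /negbTE->; rewrite scale0r.
exists n, (fun i => SubSpace (vP i)) => -[x xP]; have /asboolP[c xc] := xP.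
exists c; apply: val_inj => /=; rewrite xc.
by apply: (big_rec2 (fun (a : V) b => a = val b)) => // i a b _ ->.
Qed.

End Span.

Section JointKernel.
Variables (n : nat) (b : 'I_n -> operator V S).

Let kernel_set := [set x | forall i, b i x = 0 :> K].

Let kernel0 : kernel_set 0.
Proof. by move=> i; rewrite (linear0 (b i)). Qed.

Let kernelP (a : K) x y : kernel_set x -> kernel_set y -> kernel_set (a *: x + y).
Proof. by move=> bx yb i; rewrite functionalP bx yb mulr0 addr0. Qed.

Let kernel_closed : closed kernel_set.
Proof.
apply: closedI_rnorm => l h i; apply: sabs_eq0; apply/eqP.
rewrite eq_le sabs_ge0 andbT; apply/ler_addgt0Pr => e e0; rewrite add0r.
have c0 : 0 < opnorm (b i) + 1 by rewrite ltr_wpDl ?opnorm_ge0.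
have [x bx] := h _ (divr_gt0 e0 c0); rewrite ltr_pdivlMr// => lx.
have -> : b i l = b i (l - x) :> K.
  by rewrite (linearB (b i)) -[LHS]subr0 -{1}(bx i).
apply: le_trans (le_opnorm (b i) _) _; apply: le_trans (ltW lx).
by rewrite mulrC ler_wpM2l ?rnorm_ge0// lerDl.
Qed.

Definition joint_kernel : closed_subspace V :=
  ClosedSubspace kernel0 kernelP kernel_closed.

End JointKernel.

(** Adding a functional to the family costs at most one more vector. *)
Lemma joint_kernel_complement n (b : 'I_n -> operator V S) :
  exists p (v : 'I_p -> V), forall x, exists c : 'I_p -> K,
    forall i, b i (x - \sum_(j < p) c j *: v j) = 0 :> K.
Proof.
elim: n b => [|n IH] b.
  by exists 0, (fun=> 0) => x; exists (fun=> 0) => -[].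
have [p [v hv]] := IH (fun i => b (widen_ord (leqnSn n) i)).
have wE (i : 'I_n.+1) : (exists i', i = widen_ord (leqnSn n) i') \/ i = ord_max.
  have := ltn_ord i; rewrite ltnS leq_eqVlt => /orP[/eqP im|im].
    by right; apply: val_inj.
  by left; exists (Ordinal im); apply: val_inj.
have [[x0 [bx0 x0m]]|nx] := pselect (exists x0,
    (forall i', b (widen_ord (leqnSn n) i') x0 = 0 :> K) /\ b ord_max x0 <> 0 :> K).
  exists p.+1, (fun j => if unlift ord_max j is Some j' then v j' else x0) => x.
  have [c cx] := hv x.
  pose r := (b ord_max (x - \sum_(j < p) c j *: v j) : K) / b ord_max x0.
  exists (fun j => if unlift ord_max j is Some j' then c j' else r) => i.
  rewrite big_ord_recr/= unlift_none.
  have -> : \sum_(j < p) (if unlift ord_max (widen_ord (leqnSn p) j) is Some j'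
        then c j' else r) *: (if unlift ord_max (widen_ord (leqnSn p) j) is Some j'
        then v j' else x0) = \sum_(j < p) c j *: v j.
    apply: eq_bigr => j _; have -> : widen_ord (leqnSn p) j = lift ord_max j.
      by apply: val_inj; rewrite /= /bump leqNgt ltn_ord.
    by rewrite liftK.
  rewrite opprD addrA -scaleNr addrC functionalP.
  case: (wE i) => [[i' ->]|->]; first by rewrite bx0 mulr0 add0r cx.
  by rewrite mulNr /r divfK ?addNr//; exact/eqP.
exists p, v => x; have [c cx] := hv x; exists c => i.
case: (wE i) => [[i' ->]|->]; first exact: cx.
by apply: contrapT => ne; apply: nx; eexists; split; [exact: cx|exact: ne].
Qed.

Lemma joint_kernel_finite_dim n (b : 'I_n -> operator V S) :
  finite_dim (quot_space (joint_kernel b)).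
Proof.
have [p [v hv]] := joint_kernel_complement b.
exists p, (fun j => quot_pi (joint_kernel b) (v j)); elim/quot_piW => x.
have [c cx] := hv x; exists c.
have -> : \sum_(j < p) c j *: quot_pi (joint_kernel b) (v j) =
    quot_pi (joint_kernel b) (\sum_(j < p) c j *: v j).
  apply: (big_rec2 (fun a y => a = quot_pi (joint_kernel b) y)) => // j a y _ ->.
  by rewrite quot_piD quot_piZ.
by apply/quot_piE.
Qed.

End Subspaces.
End TraceAndSubspaces.

(** * Test operators for the adjoint norm *)

Section AdjointEstimate.
Variables (R : realType) (k : scalar_kind).
Local Notation K := (scalar_field R k).
Local Notation S := (scalar_space R k).

Section QuotientFunctionals.
Variables (Y : normedModType K) (n : nat) (b : 'I_n -> operator Y S).
Hypothesis b1 : forall j, opnorm (b j) <= 1.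
Local Notation F := (joint_kernel b).

Let bq (a : quot_space F) : bfun_space R k 'I_n := fin_fun (fun j => b j (repr a)).

Let bqE y j : bq (quot_pi F y) j = b j y.
Proof.
have := repr_pi F y => /(_ j); rewrite (linearB (b j)) => /eqP.
by rewrite subr_eq0 => /eqP.
Qed.

Let bq_lin : linear bq.
Proof.
move=> c; elim/quot_piW=> x; elim/quot_piW=> y; apply: bfun_eq => j.
have -> : c *: quot_pi F x + quot_pi F y = quot_pi F (c *: x + y).
  by rewrite quot_piD quot_piZ.
by rewrite bfunD bfunZ !bqE functionalP.
Qed.

Let bq_le a : rnorm (bq a) <= rnorm a.
Proof.
rewrite rnorm_bfun; apply: sup_norm_le => [|j]; first exact: rnorm_ge0.
apply/ler_addgt0Pr => e e0; rewrite rnorm_quot.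
have [y <- ye] := quot_norm_lift a e0; rewrite bqE; apply: le_trans (ltW ye).
apply: le_trans (le_opnorm (b j) y) _.
by rewrite ler_piMl ?rnorm_ge0.
Qed.

(** The adjoint norm tests with operators on finite-dimensional quotients;
    this is how functionals on the whole space give rise to one. *)
Lemma quotient_functionals : exists B : operator (quot_space F) (bfun_space R k 'I_n),
  opnorm B <= 1 /\ forall y, B (quot_pi F y) = \sum_j (b j y : K) *: unit_fun R k j.
Proof.
have bqP : bq \in @is_op R k (quot_space F) (bfun_space R k 'I_n).
  by apply/asboolP; split; [exact: bq_lin|exists 1 => a; rewrite mul1r].
exists (Op bqP); split.
  by apply: opnorm_le => a a1; apply: le_trans (bq_le a) a1.
move=> y; rewrite [LHS]fin_funE; apply: eq_bigr => j _.
by rewrite -[in RHS]bqE.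
Qed.

End QuotientFunctionals.

Variable A : operator_class R k.
Hypotheses (hA : quasi_banach_ideal A)
  (nL : normed_class (product_class (hilbert_class R k) A)).
Local Notation L2A := (product_class (hilbert_class R k) A).

Variables (X Y : completeNormedModType K) (T : operator X Y) (t : R).
Hypotheses (t0 : 0 <= t) (Tt : (adjoint_norm L2A T <= t%:E)%E).

Lemma adjoint_trace_le (E : closed_subspace X) (F : closed_subspace Y)
    (U : operator (quot_space F) (sub_space E)) :
  finite_dim (sub_space E) -> finite_dim (quot_space F) ->
  component L2A U -> qnorm L2A U <= 1 ->
  sabs (trace (comp_op T (comp_op (inclusion E) (comp_op U (quot_map F))))) <= t.
Proof.
move=> fE fF LU U1; rewrite -lee_fin; apply: le_trans Tt.
by apply: ereal_sup_ubound; exists E, F, U; split.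
Qed.

Section Bilinear.
Variables (n : nat) (H : completeNormedModType K) (ip : H -> H -> K).
Hypotheses (hH : is_hilbert H) (hip : semi_inner ip)
  (ipn : forall x, ip x x = emb (rnorm x ^+ 2)).
Variables (U : operator (bfun_space R k 'I_n) H) (e : 'I_n -> H).
Hypotheses (AU : component A U) (eE : forall i j, ip (e i) (e j) = (i == j)%:R).

Lemma bessel_inequality (x : H) : \sum_i sabs (ip x (e i)) ^+ 2 <= rnorm x ^+ 2.
Proof.
have quadE y : quad ip y = rnorm y ^+ 2 by rewrite /quad ipn embK.
under eq_bigr => i _ do rewrite inner_sym// sabs_conj.
apply: (bessel_dual hip (phi := ip^~ x)) => //; first exact: sqr_ge0.
  by move=> a y z; rewrite innerDl// innerZl.
by move=> y; rewrite -quadE mulrC; exact: cauchy_schwarz.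
Qed.

(** Bessel's inequality, after applying a norming functional. *)
Lemma synthesis_le (x : 'I_n -> X) (c : R) : 0 <= c ->
  (forall f : dual_ball X, \sum_i sabs (sval f (x i)) ^+ 2 <= c ^+ 2) ->
  forall h, rnorm (\sum_i ip h (e i) *: x i) <= c * rnorm h.
Proof.
move=> c0 xc h; have [f f1 fx] := norming_functional (\sum_i ip h (e i) *: x i).
rewrite -[leLHS]ger0_norm ?rnorm_ge0// -(sabs_emb k) -fx functional_sum.
under eq_bigr => i _ do rewrite functionalZ.
rewrite -[leLHS]ger0_norm ?sabs_ge0// -[leRHS]ger0_norm ?mulr_ge0 ?rnorm_ge0//.
rewrite -!sqrtr_sqr ler_wsqrtr// exprMn mulrC.
apply: le_trans (sum_cauchy_schwarz _ _) _.
apply: ler_pM; rewrite ?bessel_inequality//; try by apply: sumr_ge0 => i _; exact: sqr_ge0.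
exact: (xc (exist (fun f => opnorm f <= 1) f f1)).
Qed.

(** The double sum is, up to a scalar, the trace of [T] composed with the test
    operator that sends [y] to the function [j |-> b j y], then to [H] by [U],
    and then to the span of the [x i] by [h |-> \sum_i ip h (e i) *: x i]. *)
Lemma adjoint_bilinear_le (x : 'I_n -> X) (b : 'I_n -> operator Y S) (c : R) :
  0 <= c -> (forall j, opnorm (b j) <= 1) ->
  (forall f : dual_ball X, \sum_i sabs (sval f (x i)) ^+ 2 <= c ^+ 2) ->
  sabs (\sum_i \sum_j ip (U (unit_fun R k j)) (e i) * b j (T (x i))) <=
  t * (c * qnorm A U).
Proof.
move=> c0 b1 xc; have q0 := ideal_qnorm_ge0 hA AU.
(* [eta] keeps the normalizing factor of the test operator positive *)
suff h eta : 0 < eta ->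
    sabs (\sum_i \sum_j ip (U (unit_fun R k j)) (e i) * b j (T (x i))) <=
    t * (c * qnorm A U + eta).
  apply/ler_addgt0Pr => d d0.
  have t1 : 0 < t + 1 by rewrite ltr_wpDl.
  apply: le_trans (h (d / (t + 1)) (divr_gt0 d0 t1)) _.
  rewrite mulrDr lerD2l mulrCA ler_piMr ?(ltW d0)// ler_pdivrMr// mul1r lerDl.
  exact: ler01.
move=> eta0; set c' := _ + eta.
have c'0 : 0 < c' by rewrite ltr_wpDl ?mulr_ge0.
pose E := span_subspace x; pose F := joint_kernel b.
have [B [B1 BE]] := quotient_functionals b1.
pose v h : X := emb c'^-1 *: \sum_i ip h (e i) *: x i.
have vE h : v h \in in_subspace E.
  apply/asboolP; exists (fun i => emb c'^-1 * ip h (e i)).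
  by rewrite /v scaler_sumr; apply: eq_bigr => i _; rewrite scalerA.
have v_lin : linear v.
  move=> a h h'; rewrite /v scalerA [a * _]mulrC -scalerA -scalerDr; congr (_ *: _).
  rewrite scaler_sumr -big_split/=; apply: eq_bigr => i _.
  by rewrite innerDl// innerZl// scalerDl scalerA.
have v_le h : rnorm (v h) <= c / c' * rnorm h.
  rewrite rnormZ -/(sabs _) sabs_emb ger0_norm ?invr_ge0 ?(ltW c'0)//.
  rewrite mulrAC mulrC ler_wpM2r ?invr_ge0 ?(ltW c'0)//.
  exact: synthesis_le.
pose W0 h : sub_space E := SubSpace (vE h).
have WP : W0 \in @is_op R k H (sub_space E).
  apply/asboolP; split; first by move=> a h h'; apply: val_inj; exact: v_lin.
  by exists (c / c') => h; exact: v_le.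
pose W := Op WP.
have cc0 : 0 <= c / c' by rewrite divr_ge0// ltW.
have Wn : opnorm W <= c / c'.
  by apply: opnorm_le => h h1; apply: le_trans (v_le h) _; rewrite ler_piMr.
have [AUB qUB] := ideal_compr hA B AU.
have [LS qS] := hilbert_product hA W hH AUB.
have S1 : qnorm L2A (comp_op W (comp_op U B)) <= 1.
  apply: le_trans qS _; apply: (@le_trans _ _ (c / c' * qnorm A U)).
    apply: ler_pM; rewrite ?opnorm_ge0//; first exact: (ideal_qnorm_ge0 hA).
    by apply: le_trans qUB _; rewrite ler_piMr.
  rewrite mulrAC ler_pdivrMr// mul1r /c' lerDl; exact: ltW.
have := adjoint_trace_le (span_subspace_finite_dim x) (joint_kernel_finite_dim b) LS S1.
rewrite (@trace_unique _ _ _ _ (emb c'^-1 *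
    (\sum_i \sum_j ip (U (unit_fun R k j)) (e i) * b j (T (x i))))).
  rewrite sabsM sabs_emb ger0_norm ?invr_ge0 ?(ltW c'0)//.
  by rewrite ler_pdivrMl// mulrC.
exists n, b, (fun j => T (v (U (unit_fun R k j)))); split.
  move=> y; rewrite /= -[quot_pi _ y]/(quot_pi F y) BE linear_sum.
  have -> : v (\sum_j U (b j y *: unit_fun R k j)) =
      \sum_j (b j y : K) *: v (U (unit_fun R k j)).
    rewrite -[LHS]/(comp_op (inclusion E) W _) linear_sum; apply: eq_bigr => j _.
    by rewrite opZ -[LHS]/(comp_op (inclusion E) W (_ *: _)) opZ.
  by rewrite linear_sum; apply: eq_bigr => j _; exact: opZ.
rewrite exchange_big mulr_sumr; apply: eq_bigr => j _.
rewrite /v opZ functionalZ op_sum functional_sum; congr (_ * _).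
by apply: eq_bigr => i _; rewrite opZ functionalZ.
Qed.

End Bilinear.
End AdjointEstimate.

(** * Membership in the adjoint ideal implies 2-summing *)

Section AdjointSumming.
Variables (R : realType) (k : scalar_kind).
Local Notation K := (scalar_field R k).
Local Notation S := (scalar_space R k).
Variable A : operator_class R k.
Hypotheses (hA : quasi_banach_ideal A)
  (nL : normed_class (product_class (hilbert_class R k) A)).
Local Notation L2A := (product_class (hilbert_class R k) A).

Variables (X Y : completeNormedModType K) (T : operator X Y) (t : R).
Hypotheses (t0 : 0 <= t) (Tt : (adjoint_norm L2A T <= t%:E)%E).

(** Averaging the bilinear estimate over signs keeps only the diagonal
    coefficients [d i], and averaging over cyclic shifts replaces them by their
    mean, which the factorization relates to [A(U)]. *)
Lemma adjoint_sum_le n (x : 'I_n.+1 -> X) (b : 'I_n.+1 -> operator Y S) (c : R) :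
  0 <= c -> (forall j, opnorm (b j) <= 1) ->
  (forall f : dual_ball X, \sum_i sabs (sval f (x i)) ^+ 2 <= c ^+ 2) ->
  sabs (\sum_i (b i (T (x i)) : K)) <= t * c * Num.sqrt n.+1%:R.
Proof.
move=> c0 b1 xc; set m := n.+1; set tot := \sum_i _.
have sm0 : 0 < Num.sqrt m%:R :> R by rewrite sqrtr_gt0 ltr0n.
suff h eps : 0 < eps -> sabs tot <= (1 + eps) * (t * c * Num.sqrt m%:R).
  set B := t * c * _ in h *; have B0 : 0 <= B by rewrite !mulr_ge0// ltW.
  apply/ler_addgt0Pr => d d0; have B1 : 0 < B + 1 by rewrite ltr_wpDl.
  apply: le_trans (h (d / (B + 1)) (divr_gt0 d0 B1)) _.
  rewrite mulrDl mul1r lerD2l mulrAC ler_pdivrMr// ler_pM2l//; lra.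
move=> eps0.
have [H [ip [U [e [d [[hH [hip ipn]] [AU eE d0 dE Ud]]]]]]] := diagonal_factor hA nL n eps0.
pose M := t * (c * qnorm A U).
(* addition in ['I_m] is modulo [m] *)
have shift (s : 'I_m) :
    sabs (\sum_i emb (d i) * (b (i + s) (T (x (i + s))) : K)) <= M.
  under eq_bigr => i _ do rewrite -dE.
  apply: (@sign_average_diag R k m
    (fun i j => ip (U (unit_fun R k j)) (e i) * b (j + s) (T (x (i + s))))) => th.
  have bs j : opnorm (sgn R k th j *: b (j + s)) <= 1.
    apply: opnorm_le => y y1; rewrite [X in rnorm X](_ : _ = sgn R k th j *: b (j + s) y)//.
    rewrite rnormZ -/(sabs _) sabs_sgn mul1r.
    by apply: le_trans (le_opnorm _ _) _; rewrite mulr_ile1 ?opnorm_ge0 ?rnorm_ge0.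
  have xs (f : dual_ball X) :
      \sum_i sabs (sval f (sgn R k th i *: x (i + s))) ^+ 2 <= c ^+ 2.
    apply: le_trans (xc f); rewrite [leRHS](reindex_inj (addIr s))/=.
    by apply: ler_sum => i _; rewrite functionalZ sabsM sabs_sgn mul1r.
  have := adjoint_bilinear_le hA t0 Tt hH hip ipn AU eE c0 bs xs.
  congr (sabs _ <= _); apply: eq_bigr => i _; apply: eq_bigr => j _.
  rewrite opZ [(_ *: b (j + s)) _](_ : _ = sgn R k th j * b (j + s) (sgn R k th i *: T (x (i + s))))//.
  rewrite functionalZ; move: (sgn R k th i) (sgn R k th j) (ip _ _) (b _ _ : K) => p r u w.
  by ring.
have sumM : (\sum_i d i) * sabs tot <= m%:R * M.
  have D0 : 0 <= \sum_i d i by apply: sumr_ge0 => i _; exact: ltW.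
  rewrite -[X in X * _](ger0_norm D0) -(sabs_emb k) -sabsM.
  have -> : emb (\sum_i d i) * tot =
      \sum_(s : 'I_m) \sum_i emb (d i) * (b (i + s) (T (x (i + s))) : K).
    rewrite exchange_big/= emb_sum mulr_suml; apply: eq_bigr => i _.
    rewrite /tot (reindex_inj (addrI i))/= mulr_sumr.
    by apply: eq_bigr.
  apply: le_trans (sabs_sum _ _ _) _.
  rewrite -[X in X%:R * _](card_ord m) mulr_natl -sumr_const.
  by apply: ler_sum => s _; exact: shift.
have D0 : 0 < \sum_i d i.
  rewrite big_ord_recl ltr_pwDl ?d0//; apply: sumr_ge0 => i _; exact: ltW.
rewrite -(ler_pM2l D0) -(ler_pM2r sm0).
apply: le_trans (ler_wpM2r (ltW sm0) sumM) _.
have h2 : m%:R * (t * c) * (qnorm A U * Num.sqrt m%:R) <=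
    m%:R * (t * c) * ((1 + eps) * \sum_i d i).
  by rewrite ler_wpM2l// mulr_ge0// mulr_ge0.
have -> : m%:R * M * Num.sqrt m%:R = m%:R * (t * c) * (qnorm A U * Num.sqrt m%:R).
  by rewrite /M; ring.
apply: le_trans h2 _.
move: (sqr_sqrtr (ler0n R m)); move: (Num.sqrt m%:R) => z <-.
by rewrite le_eqVlt; apply/orP; left; apply/eqP; ring.
Qed.

(** Take for the [b i] norming functionals of the [T x]. *)
Lemma adjoint_sum_norm_le (s : seq X) (c : R) : 0 <= c ->
  (forall f : dual_ball X, \sum_(x <- s) sabs (sval f x) ^+ 2 <= c ^+ 2) ->
  \sum_(x <- s) rnorm (T x) <= t * c * Num.sqrt (size s)%:R.
Proof.
move=> c0; case: s => [|x0 s']; first by rewrite big_nil sqrtr0 mulr0.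
set s := x0 :: s' => sc.
have /choice[b bP] : forall i : 'I_(size s').+1, exists f : operator Y S,
    opnorm f <= 1 /\ f (T (nth 0 s i)) = emb (rnorm (T (nth 0 s i))) :> K.
  by move=> i; have [f f1 fE] := norming_functional (T (nth 0 s i)); exists f.
have := @adjoint_sum_le (size s') (fun i => nth 0 s i) b c c0 (fun j => (bP j).1).
move=> h; rewrite (big_nth 0) big_mkord.
have -> : \sum_(i < size s) rnorm (T (nth 0 s i)) =
    sabs (\sum_(i < (size s').+1) (b i (T (nth 0 s i)) : K)).
  under [in RHS]eq_bigr => i _ do rewrite (bP i).2.
  by rewrite -emb_sum sabs_emb ger0_norm// sumr_ge0// => i _; exact: rnorm_ge0.
by apply: h => f; have := sc f; rewrite (big_nth 0) big_mkord.
Qed.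

Lemma adjoint_sum_square_le (s : seq X) (c : R) :
  (forall f : dual_ball X, t ^+ 2 * \sum_(x <- s) sabs (sval f x) ^+ 2 <= c) ->
  (\sum_(x <- s) rnorm (T x)) ^+ 2 <= c * (size s)%:R.
Proof.
move=> sc.
have P0 : 0 <= \sum_(x <- s) rnorm (T x) by apply: sumr_ge0 => x _; exact: rnorm_ge0.
have c0 : 0 <= c.
  apply: le_trans (sc (dual_ball0 X)); rewrite mulr_ge0 ?sqr_ge0//.
  by apply: sumr_ge0 => x _; exact: sqr_ge0.
have sq (w : R) : 0 <= w ->
    (forall f : dual_ball X, \sum_(x <- s) sabs (sval f x) ^+ 2 <= w) ->
    (\sum_(x <- s) rnorm (T x)) ^+ 2 <= t ^+ 2 * w * (size s)%:R.
  move=> w0 sw; have := @adjoint_sum_norm_le s (Num.sqrt w) (sqrtr_ge0 _).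
  rewrite sqr_sqrtr// => /(_ sw) h.
  have -> : t ^+ 2 * w * (size s)%:R = (t * Num.sqrt w * Num.sqrt (size s)%:R) ^+ 2.
    by rewrite !exprMn !sqr_sqrtr.
  by rewrite lerXn2r ?nnegrE// !mulr_ge0 ?sqrtr_ge0.
have [tz|t1] := eqVneq t 0.
  apply: le_trans (sq (\sum_(x <- s) rnorm x ^+ 2) _ _) _.
  - by apply: sumr_ge0 => x _; exact: sqr_ge0.
  - move=> f; apply: ler_sum => x _.
    by rewrite lerXn2r ?nnegrE ?sabs_ge0 ?rnorm_ge0// dual_ball_le.
  - by rewrite tz expr0n !mul0r mulr_ge0.
have t2 : 0 < t ^+ 2 by rewrite exprn_gt0// lt_def t1.
have := sq (c / t ^+ 2); rewrite [t ^+ 2 * _]mulrC divfK ?gt_eqF//; apply.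
  by rewrite divr_ge0// ltW.
by move=> f; rewrite ler_pdivlMr// mulrC.
Qed.

(** Replace [x] by about [N |T x|^2] copies of itself, divided by the root of
    their number. The weak square sum stays the same, and the estimate of the
    sum of norms becomes one of the sum of squares as [N] grows. *)
Lemma adjoint_two_summing : two_summing T t.
Proof.
move=> s c sc.
have c0 : 0 <= c.
  apply: le_trans (sc (dual_ball0 X)); rewrite mulr_ge0 ?sqr_ge0//.
  by apply: sumr_ge0 => x _; exact: sqr_ge0.
set P := \sum_(x <- s) _.
have P0 : 0 <= P by apply: sumr_ge0 => x _; exact: sqr_ge0.
have main (N : nat) : N%:R * P ^+ 2 <= c * (N%:R * P + (size s)%:R).
  pose r x := (Num.truncn (N%:R * rnorm (T x) ^+ 2)).+1.
  have y0 x : 0 <= N%:R * rnorm (T x) ^+ 2 by rewrite mulr_ge0 ?sqr_ge0.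
  have r1 x : N%:R * rnorm (T x) ^+ 2 <= (r x)%:R.
    by have /andP[_ /ltW] := truncn_itv (y0 x).
  have r2 x : (r x)%:R <= N%:R * rnorm (T x) ^+ 2 + 1.
    by rewrite /r -natr1 lerD2r; have /andP[] := truncn_itv (y0 x).
  pose w x : R := (Num.sqrt (r x)%:R)^-1.
  have sr0 x : 0 < Num.sqrt (r x)%:R :> R by rewrite sqrtr_gt0 ltr0n.
  have w0 x : 0 <= w x by rewrite invr_ge0 ltW.
  have rw2 x : (r x)%:R * w x ^+ 2 = 1.
    by rewrite exprVn sqr_sqrtr// mulfV// pnatr_eq0.
  pose s' := flatten [seq nseq (r x) (emb (w x) *: x) | x <- s].
  have sum_s' (F : X -> R) :
      \sum_(x <- s') F x = \sum_(x <- s) (r x)%:R * F (emb (w x) *: x).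
    rewrite big_flatten big_map; apply: eq_bigr => x _.
    by rewrite big_nseq iter_addr addr0 mulr_natl.
  have sizes : (size s')%:R = \sum_(x <- s) (r x)%:R :> R.
    have := sum_s' (fun=> 1); under [RHS]eq_bigr => x _ do rewrite mulr1.
    by move=> <-; rewrite big_const_seq count_predT iter_addr addr0.
  have := @adjoint_sum_square_le s' c; rewrite sum_s' sizes.
  have h1 : (forall f : dual_ball X, t ^+ 2 * \sum_(x <- s') sabs (sval f x) ^+ 2 <= c).
    move=> f; rewrite sum_s'; apply: le_trans (sc f).
    rewrite le_eqVlt; apply/orP; left; apply/eqP; congr (_ * _).
    apply: eq_bigr => x _; rewrite functionalZ sabsM sabs_emb ger0_norm//.
    by rewrite exprMn mulrA rw2 mul1r.
  move=> /(_ h1) h2.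
  have h3 : Num.sqrt N%:R * P <= \sum_(x <- s) (r x)%:R * rnorm (T (emb (w x) *: x)).
    rewrite mulr_sumr; apply: ler_sum => x _.
    rewrite opZ rnormZ -/(sabs _) sabs_emb ger0_norm// mulrA.
    have -> : (r x)%:R * w x = Num.sqrt (r x)%:R.
      by rewrite /w -{1}(sqr_sqrtr (ler0n R (r x))) expr2 mulfK// gt_eqF.
    have -> : Num.sqrt N%:R * rnorm (T x) ^+ 2 =
        Num.sqrt (N%:R * rnorm (T x) ^+ 2) * rnorm (T x).
      by rewrite sqrtrM// sqrtr_sqr ger0_norm ?rnorm_ge0// expr2 mulrA.
    by rewrite ler_wpM2r ?rnorm_ge0// ler_wsqrtr.
  have h4 : \sum_(x <- s) (r x)%:R <= N%:R * P + (size s)%:R.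
    apply: le_trans (ler_sum _ (fun x _ => r2 x)) _.
    by rewrite big_split/= -mulr_sumr big_const_seq count_predT iter_addr addr0.
  apply: le_trans (ler_wpM2l c0 h4); apply: le_trans h2.
  have -> : N%:R * P ^+ 2 = (Num.sqrt N%:R * P) ^+ 2 by rewrite exprMn sqr_sqrtr.
  by rewrite lerXn2r ?nnegrE ?(le_trans _ h3) ?mulr_ge0 ?sqrtr_ge0.
rewrite leNgt; apply/negP => cP.
have Pp : 0 < P := le_lt_trans c0 cP.
have D0 : 0 < P * (P - c) by rewrite mulr_gt0// subr_gt0.
pose N := (Num.truncn (c * (size s)%:R / (P * (P - c)))).+1.
have : c * (size s)%:R / (P * (P - c)) < N%:R.
  have y0 : 0 <= c * (size s)%:R / (P * (P - c)) by rewrite divr_ge0 ?(ltW D0)// mulr_ge0.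
  by have /andP[] := truncn_itv y0.
rewrite ltr_pdivrMr// => h; have := main N.
move: h; move: (N%:R) ((size s)%:R) => a b h1 h2; lra.
Qed.

End AdjointSumming.

(** * Cotype constants and the conclusion *)

Section Cotype.
Variables (R : realType) (k : scalar_kind).
Local Notation K := (scalar_field R k).

(** The integral of a nonnegative function is a supremum over the simple
    functions below it, hence monotone. *)
Lemma ge0_integral_le d (T : measurableType d) (mu : {measure set T -> \bar R})
    (D : set T) (f g : T -> \bar R) :
  (forall x, 0 <= f x)%E -> (forall x, f x <= g x)%E ->
  (\int[mu]_(x in D) f x <= \int[mu]_(x in D) g x)%E.
Proof.
move=> f0 fg; have g0 x : (0 <= g x)%E by apply: le_trans (f0 x) (fg x).
rewrite !(integral_mkcond D) !ge0_integralTE; try by move=> x; exact: erestrict_ge0.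
apply: le_ereal_sup => _ [h /= hf <-]; exists h => // x; apply: le_trans (hf x) _.
exact: lee_restrict.
Qed.

Lemma Rintegral01_le (f : R -> R) (c : R) : (forall t, 0 <= f t <= c) ->
  \int[lebesgue_measure]_(t in `[0, 1]) f t <= c.
Proof.
move=> fc; have f0 t : 0 <= f t by have /andP[] := fc t.
have h : (\int[lebesgue_measure]_(t in `[0%R, 1%R]) (f t)%:E <= c%:E)%E.
  apply: le_trans (_ : (\int[lebesgue_measure]_(t in `[0%R, 1%R]) (cst c%:E t) <= _)%E).
    apply: ge0_integral_le => t; first by rewrite lee_fin.
    by rewrite lee_fin; have /andP[] := fc t.
  rewrite integral_cst//= lebesgue_measure_itv/= lte_fin ltr01.
  by rewrite -EFinB subr0 mule1.
rewrite /Rintegral -[c]/(fine c%:E) fine_le//.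
rewrite fin_numE; apply/andP; split.
  by apply/eqP => e; have := @integral_ge0 _ _ R lebesgue_measure `[0%R, 1%R]
    (fun t => (f t)%:E) (fun t _ => f0 t); rewrite e.
by apply/eqP => e; rewrite e in h.
Qed.

(** Families with one member already force this. *)
Lemma cotype2_bound_ge1 (V : normedModType K) (x : V) (C : R) :
  x != 0 -> cotype2_bound V C -> 1 <= C.
Proof.
move=> x0 [C0 hC]; have := hC 1 (fun=> x).
rewrite big_ord1 sqrtr_sqr ger0_norm ?rnorm_ge0// => h.
have nx : 0 < rnorm x.
  rewrite lt_def rnorm_ge0 andbT; apply: contra_neq x0; exact: rnorm0_eq0.
rewrite -(ler_pM2r nx) mul1r; apply: le_trans h _; rewrite ler_wpM2l//.
rewrite -[leRHS]ger0_norm ?rnorm_ge0// -sqrtr_sqr ler_wsqrtr//.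
apply: Rintegral01_le => t; rewrite sqr_ge0/= big_ord1 rnormZ -/(sabs _) sabs_emb.
rewrite exprMn ler_piMl ?sqr_ge0// expr_le1// /rademacher normr_sg.
by case: (_ != 0).
Qed.

Lemma cotype2_const_ge1 (V : normedModType K) (x : V) :
  x != 0 -> has_cotype2 V -> 1 <= cotype2_const V.
Proof.
move=> x0 [C hC]; apply: lb_le_inf; first by exists C.
by move=> D; exact: (cotype2_bound_ge1 x0).
Qed.

End Cotype.

Section AdjointNorms.
Variables (R : realType) (k : scalar_kind).
Local Notation K := (scalar_field R k).
Variable A : operator_class R k.
Hypotheses (hA : quasi_banach_ideal A)
  (nL : normed_class (product_class (hilbert_class R k) A)).
Local Notation L2A := (product_class (hilbert_class R k) A).
Variables (X Y : completeNormedModType K) (T : operator X Y).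

Lemma adjoint_norm_product_le : (adjoint_norm L2A T <= adjoint_norm A T)%E.
Proof.
apply: le_ereal_sup => _ [E [F [U [fE fF LU U1 ->]]]].
have [AU AU1] := product_le hA LU.
by exists E, F, U; split=> //; exact: le_trans AU1 U1.
Qed.

Lemma adjoint_norm_product_ge0 : (0 <= adjoint_norm L2A T)%E.
Proof.
pose E := span_subspace (fun _ : 'I_0 => 0 : X).
pose F := joint_kernel (fun _ : 'I_0 => 0 : operator Y (scalar_space R k)).
have L0 := @sum_rank_one_product R k A hA (quot_space F) (sub_space E) (fun=> 0) (fun=> 0) 0.
have q0 := @sum_rank_one_qnorm R k A hA (quot_space F) (sub_space E) (fun=> 0) (fun=> 0) 0 nL.
rewrite !big_ord0 in L0 q0.
apply: le_trans (_ : ((sabs (trace (comp_op T (comp_op (inclusion E)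
  (comp_op 0 (quot_map F))))))%:E <= _)%E); first by rewrite lee_fin sabs_ge0.
apply: ereal_sup_ubound; exists E, F, 0; split=> //.
- exact: span_subspace_finite_dim.
- exact: joint_kernel_finite_dim.
- exact: le_trans q0 ler01.
Qed.

Lemma adjoint_component : component (adjoint_class A) T ->
  component (adjoint_class L2A) T /\
  0 <= qnorm (adjoint_class L2A) T <= qnorm (adjoint_class A) T.
Proof.
rewrite /= => Aoo; have Loo := le_lt_trans adjoint_norm_product_le Aoo.
have A0 := le_trans adjoint_norm_product_ge0 adjoint_norm_product_le.
split=> //; rewrite fine_ge0 ?adjoint_norm_product_ge0//= fine_le ?adjoint_norm_product_le//.
  by rewrite ge0_fin_numE// adjoint_norm_product_ge0.
by rewrite ge0_fin_numE.
Qed.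

Lemma adjoint_product_hilbert : component (adjoint_class L2A) T ->
  component (hilbert_class R k) T /\
  qnorm (hilbert_class R k) T <= qnorm (adjoint_class L2A) T.
Proof.
move=> /= Loo; have L0 := adjoint_norm_product_ge0.
apply: two_summing_hilbert; first exact: fine_ge0.
apply: (adjoint_two_summing hA nL); first exact: fine_ge0.
by rewrite fineK// ge0_fin_numE.
Qed.

End AdjointNorms.

Lemma hilbert_qnorm_zero (R : realType) (k : scalar_kind)
    (X Y : completeNormedModType (scalar_field R k)) (T : operator X Y) :
  (forall x, T x = 0) -> qnorm (hilbert_class R k) T <= 0.
Proof.
move=> Tz; apply: (two_summing_hilbert (lexx 0) _).2 => s c sc.
have := sc (dual_ball0 X); rewrite expr0n mul0r.
by apply: le_trans; rewrite big1// => x _; rewrite Tz rnorm0 expr0n.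
Qed.

Theorem theorem3p2 (R : realType) (k : scalar_kind) (A : operator_class R k)
    (A_banach : banach_ideal A) (A_maximal : maximal_class A)
    (L2A_normed : normed_class (product_class (hilbert_class R k) A))
    (X Y : completeNormedModType (scalar_field R k))
    (dX_cotype2 : has_cotype2 (dual X)) (Y_cotype2 : has_cotype2 Y) :
  let L2 := hilbert_class R k in
  let L2A_adj := adjoint_class (product_class L2 A) in
  let A_adj := adjoint_class A in
  let c := (2 * cotype2_const (dual X) * cotype2_const Y) `^ (3 / 2) in
  [/\ (forall T : operator X Y, component A_adj T ->
         component L2A_adj T /\ qnorm L2A_adj T <= qnorm A_adj T),
      (forall T : operator X Y, component L2A_adj T -> component L2 T) &
      (forall T : operator X Y, component A_adj T ->
         qnorm L2 T <= c * qnorm L2A_adj T /\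
         c * qnorm L2A_adj T <= c * qnorm A_adj T)].
Proof.
move=> L2 L2A_adj A_adj c; have [hA _] := A_banach.
have incl (T : operator X Y) := adjoint_component hA L2A_normed (T := T).
have fact (T : operator X Y) := adjoint_product_hilbert hA L2A_normed (T := T).
have c0 : 0 <= c by exact: powR_ge0.
split=> [T /incl[LT /andP[_ le]] //|T /fact[] //|T /incl[LT /andP[q0 le]]].
split; last exact: ler_wpM2l.
(* the factor [c] is at least 1, unless one of the spaces is zero; then so is
   [T] *)
have [[f f0]|dX0] := pselect (exists f : dual X, f != 0); last first.
  apply: le_trans (mulr_ge0 c0 q0); apply: hilbert_qnorm_zero => x.
  suff -> : x = 0 by exact: (linear0 T).
  have [g _ gx] := norming_functional x; apply: rnorm0_eq0; apply: (@emb_inj R k).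
  rewrite emb0 -gx; have [->//|g0] := eqVneq g 0.
  by exfalso; apply: dX0; exists g.
have [[y y0]|Y0] := pselect (exists y : Y, y != 0); last first.
  apply: le_trans (mulr_ge0 c0 q0); apply: hilbert_qnorm_zero => x.
  by apply: contrapT => /eqP Tx; apply: Y0; exists (T x).
have c1 : 1 <= c.
  have := cotype2_const_ge1 f0 dX_cotype2; have := cotype2_const_ge1 y0 Y_cotype2.
  move=> h1 h2; have a1 : 1 <= 2 * cotype2_const (dual X) * cotype2_const Y by nra.
  by apply: le_trans a1 (le1r_powR a1 _); lra.
apply: le_trans (fact T LT).2 _.
by rewrite ler_peMl.
Qed.
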